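(* Let $n\ge1$, let $E\to M$ be a vector bundle with a bundle map $\rho:E\to TM$ and an $\mathbb R$-bilinear skew-symmetric bracket $[-,-]$ on $\Gamma(E)$ satisfying $[e_1,fe_2]=f[e_1,e_2]+(\rho(e_1)f)e_2$. Let $J\in\Gamma(\wedge^nE^* )$ and let $H\in\Omega^{n+1}(M)$ be a pre-$n$-plectic form ($\mathrm{d}H=0$). On $T^*[n]\mathcal M$, where $\mathcal M=T^*[n-1]E[1]$, let $$\widetilde\Theta=\xi_i\zeta^i+p_a\eta^a+(-1)^{\frac{n(n+1)}2}\frac1{(n+1)!}H_{i_1\dots i_{n+1}}(x)\zeta^{i_1}\cdots\zeta^{i_{n+1}},$$ and let $\phi=\phi_{\mathrm{Lie}}-\underline J$ with $$\phi_{\mathrm{Lie}}=\rho^i_a(x)z_iq^a+\frac{(-1)^{n-1}}2C^c_{ab}(x)q^aq^by_c,\qquad\underline J=\frac1{n!}J_{a_1\dots a_n}(x)q^{a_1}\cdots q^{a_n}.$$ Then $(E,\rho,[-,-])$ is a Lie algebroid and $J$ is a compatible $E$-$n$-form with respect to $H$ (i.e. ${}^E\mathrm{d}J=-\iota_\rho^{n+1}H$) if and only if $$\mathrm{pr}_*\,e^{\mathrm{ad}\,\phi}\,\widetilde\Theta=0,$$ i.e. if and only if $\mathcal M$ is a twisted QP-manifold with the function $\phi$.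
   Context: Local data: $x^i$ are coordinates on $M$ and $e_a$ is a local frame of $E$. On $\mathcal M=T^*[n-1]E[1]$ the coordinates are $(x^i,q^a,z_i,y_a)$ of degrees $(0,1,n-1,n-2)$, with $q^a$ the fibre coordinates of $E[1]$ and $z_i,y_a$ conjugate to $x^i,q^a$. On $T^*[n]\mathcal M$ there are additional fibre coordinates $(\xi_i,p_a,\zeta^i,\eta^a)$ of degrees $(n,n-1,1,2)$, conjugate to $(x^i,q^a,z_i,y_a)$. Functions are graded commutative, $fg=(-1)^{|f||g|}gf$, and repeated indices are summed. Structure functions: $\rho(e_a)=\rho^i_a\partial_i$, $[e_a,e_b]=C_{ab}^ce_c$, $J_{a_1\dots a_n}=J(e_{a_1},\dots,e_{a_n})$, $H=\frac1{(n+1)!}H_{i_1\dots i_{n+1}}\mathrm{d}x^{i_1}\wedge\cdots\wedge\mathrm{d}x^{i_{n+1}}$. The local formulas for $\widetilde\Theta,\phi_{\mathrm{Lie}},\underline J$ define global functions of degrees $n+1,n,n$ respectively. The graded Poisson bracket on $T^*[n]\mathcal M$ has degree $-n$ and satisfies $\{f,g\}=-(-1)^{(|f|-n)(|g|-n)}\{g,f\}$ and $\{f,gh\}=\{f,g\}h+(-1)^{(|f|-n)|g|}g\{f,h\}$. Its nonzero brackets of coordinates are $\{x^i,\xi_j\}=\delta^i_j$, $\{q^a,p_b\}=\delta^a_b$, $\{z_i,\zeta^j\}=\delta_i^j$, $\{y_a,\eta^b\}=\delta_a^b$ and those implied by graded antisymmetry. With $\mathrm{d}H=0$ one has $\{\widetilde\Theta,\widetilde\Theta\}=0$,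 so $T^*[n]\mathcal M$ is a QP-manifold. The twist by $\phi$ is $e^{\mathrm{ad}\,\phi}\alpha=\alpha+\{\alpha,\phi\}+\frac12\{\{\alpha,\phi\},\phi\}+\cdots$. The map $\mathrm{pr}_*$ sends a function on $T^*[n]\mathcal M$ to a function on $\mathcal M$ by setting $\xi_i=p_a=\zeta^i=\eta^a=0$. If $\phi$ has degree $n$ and $\mathrm{pr}_*e^{\mathrm{ad}\,\phi}\widetilde\Theta=0$, then $\mathcal M$ (with $\phi$ and the derived bracket $\{f,g\}_{\mathcal M}=\mathrm{pr}_*\{\{\mathrm{pr}^*f,\widetilde\Theta\},\mathrm{pr}^*g\}$) is called a twisted QP-manifold. $(E,\rho,[-,-])$ is a Lie algebroid if $[-,-]$ also satisfies the Jacobi identity. Its differential is $${}^E\mathrm{d}\alpha(e_1,\dots,e_{m+1})=\sum_i(-1)^{i-1}\rho(e_i)\alpha(\dots,\check e_i,\dots)+\sum_{i<j}(-1)^{i+j}\alpha([e_i,e_j],\dots,\check e_i,\dots,\check e_j,\dots).$$ $\iota_\rho^{n+1}H(e_1,\dots,e_{n+1})=\iota_{\rho(e_1)}\cdots\iota_{\rho(e_{n+1})}H=H(\rho(e_{n+1}),\dots,\rho(e_1))$. *)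

(* Defs.v *)
From HB Require Import structures.
From mathcomp Require Import all_boot all_order all_algebra.
From mathcomp Require Import all_classical all_reals all_analysis.

Set Implicit Arguments.
Unset Strict Implicit.
Unset Printing Implicit Defensive.

Import Order.TTheory GRing.Theory Num.Theory.
Import numFieldNormedType.Exports.

Local Open Scope classical_set_scope.
Local Open Scope ring_scope.

Definition partial (R : realType) (d : nat) (i : 'I_d) (f : 'rV[R]_d -> R)
    (u : 'rV[R]_d) : R :=
  'D_(delta_mx 0 i) f u.

(* For U open this is C^oo: every iterated partial derivative exists and is
   (Frechet) differentiable, hence continuous, on U. *)
Definition smooth_on (R : realType) (d : nat) (U : set 'rV[R]_d)
    (f : 'rV[R]_d -> R) : Prop :=
  forall (s : seq 'I_d) u, U u -> differentiable (foldr (@partial R d) f s) u.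

(* The maps [chart k] and [chart_inv k] are only meaningful on [chart_dom k] and
   on its image. [chart_at x] is a chosen chart around x; it is used to
   represent tangent vectors at x. *)
Record manifold (R : realType) (d : nat) : Type := Manifold {
  man_pt :> topologicalType;
  man_hausdorff : hausdorff_space man_pt;
  man_second_countable : @second_countable man_pt;
  chart_idx : Type;
  chart_dom : chart_idx -> set man_pt;
  chart : chart_idx -> man_pt -> 'rV[R]_d;
  chart_inv : chart_idx -> 'rV[R]_d -> man_pt;
  chart_dom_open : forall k, open (chart_dom k);
  chart_img_open : forall k, open (chart k @` chart_dom k);
  chartK : forall k x, chart_dom k x -> chart_inv k (chart k x) = x;
  chart_continuous : forall k x, chart_dom k x ->
    {for x, continuous (chart k)};
  chart_inv_continuous : forall k u, (chart k @` chart_dom k) u ->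
    {for u, continuous (chart_inv k)};
  chart_at : man_pt -> chart_idx;
  chart_atP : forall x, chart_dom (chart_at x) x;
  chart_compat : forall k l (j : 'I_d),
    smooth_on (chart k @` (chart_dom k `&` chart_dom l))
      (fun u => chart l (chart_inv k u) 0 j)
}.

Section Manifold.
Context {R : realType} {d : nat} {M : manifold R d}.

Definition msmooth_on (W : set M) (f : M -> R) : Prop :=
  forall k : chart_idx M, smooth_on (chart k @` (chart_dom k `&` W))
    (f \o chart_inv k).

Definition msmooth (f : M -> R) : Prop := msmooth_on setT f.

(* T_x M is R^d, a tangent vector being represented by its components in the
   chosen chart [chart_at x]; [tcoord k v] are the components of v in the chart
   k, and [dcoord k i x] is the coordinate vector d/dx^i of the chart k at x. *)
Definition tangent (x : M) : lmodType R := 'rV[R]_d.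

Definition tcoord (k : chart_idx M) (x : M) (v : tangent x) : 'rV[R]_d :=
  \row_j \sum_i (v : 'rV[R]_d) 0 i *
    partial i (fun u => chart k (chart_inv (chart_at x) u) 0 j)
      (chart (chart_at x) x).

Definition dcoord (k : chart_idx M) (i : 'I_d) (x : M) : tangent x :=
  \row_j partial i (fun u => chart (chart_at x) (chart_inv k u) 0 j)
    (chart k x).

Definition tderiv (x : M) (v : tangent x) (f : M -> R) : R :=
  \sum_i (v : 'rV[R]_d) 0 i *
    partial i (f \o chart_inv (chart_at x)) (chart (chart_at x) x).

End Manifold.

(* A vector bundle of rank r is a family of vector spaces with local frames
   [frame k] (and dual coordinates [fcoord k]) over an open cover, such that the
   transition functions are smooth. *)
Record vbundle (R : realType) (d : nat) (M : manifold R d) (r : nat) : Type :=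
    VBundle {
  fiber :> M -> lmodType R;
  frame_idx : Type;
  frame_dom : frame_idx -> set M;
  frame : frame_idx -> 'I_r -> forall x, fiber x;
  fcoord : frame_idx -> 'I_r -> forall x, {linear fiber x -> R^o};
  frame_dom_open : forall k, open (frame_dom k);
  frame_cover : forall x, exists k, frame_dom k x;
  fcoordK : forall k x (v : fiber x), frame_dom k x ->
    v = \sum_a fcoord k a x v *: frame k a x;
  fcoord_frame : forall k a b x, frame_dom k x ->
    fcoord k a x (frame k b x) = (a == b)%:R;
  frame_compat : forall k l a b,
    msmooth_on (frame_dom k `&` frame_dom l)
      (fun x => fcoord l b x (frame k a x))
}.

Definition multilinear (R : realType) (V : lmodType R) (m : nat)
    (f : ('I_m -> V) -> R) : Prop :=
  forall i (v : 'I_m -> V) (c : R) (x y : V),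
    f (dfwith v i (c *: x + y)) = c * f (dfwith v i x) + f (dfwith v i y).

Definition alternates (R : realType) (V : lmodType R) (m : nat)
    (f : ('I_m -> V) -> R) : Prop :=
  forall (v : 'I_m -> V) i j, i != j -> v i = v j -> f v = 0.

Section Forms.
Context {R : realType} {d : nat} {M : manifold R d}.

(* H_{i_1 ... i_m} in the chart k, as a function on M. *)
Definition form_coef m (H : forall x : M, ('I_m -> tangent x) -> R)
    (k : chart_idx M) (I : 'I_m -> 'I_d) (x : M) : R :=
  H x (fun l => dcoord k (I l) x).

Definition is_form m (H : forall x : M, ('I_m -> tangent x) -> R) : Prop :=
  [/\ forall x, multilinear (H x),
      forall x, alternates (H x) &
      forall k I, msmooth_on (chart_dom k) (form_coef H k I)].

(* dH is given by its coordinate formula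
   sum_l (-1)^l d/dx^{I_l} H_{I_0 ... (omit I_l) ... I_m}. *)
Definition closed_form m (H : forall x : M, ('I_m -> tangent x) -> R) : Prop :=
  forall (k : chart_idx M) (I : 'I_m.+1 -> 'I_d) x, chart_dom k x ->
    \sum_(l < m.+1) (-1) ^+ l *
      partial (I l)
        (form_coef H k (fun j => I (lift l j)) \o chart_inv k)
        (chart k x) = 0.

End Forms.

Section Algebroid.
Context {R : realType} {d : nat} {M : manifold R d} {r : nat}.
Variable E : vbundle M r.

Definition section_of : Type := forall x : M, E x.

Definition ssmooth (s : section_of) : Prop :=
  forall k a, msmooth_on (frame_dom k) (fun x => fcoord k a x (s x)).

Definition is_bundle_map (rho : forall x : M, {linear E x -> tangent x}) :
    Prop :=
  forall (k : chart_idx M) (l : frame_idx E) (i : 'I_d) (a : 'I_r),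
    msmooth_on (chart_dom k `&` frame_dom l)
      (fun x => tcoord k (rho x (frame l a x)) 0 i).

(* The bracket acts on smooth global sections; its values on other families
   [forall x, E x] are irrelevant. *)
Record is_bracket (rho : forall x : M, {linear E x -> tangent x})
    (br : section_of -> section_of -> section_of) : Prop := IsBracket {
  br_smooth : forall s t, ssmooth s -> ssmooth t -> ssmooth (br s t);
  br_linear_l : forall (c : R) s1 s2 t, ssmooth s1 -> ssmooth s2 -> ssmooth t ->
    forall x, br (fun y => c *: s1 y + s2 y) t x = c *: br s1 t x + br s2 t x;
  br_linear_r : forall (c : R) s t1 t2, ssmooth s -> ssmooth t1 -> ssmooth t2 ->
    forall x, br s (fun y => c *: t1 y + t2 y) x = c *: br s t1 x + br s t2 x;
  br_skew : forall s t, ssmooth s -> ssmooth t ->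
    forall x, br s t x = - br t s x;
  br_leibniz : forall (f : M -> R) s t, msmooth f -> ssmooth s -> ssmooth t ->
    forall x, br s (fun y => f y *: t y) x =
              f x *: br s t x + tderiv (rho x (s x)) f *: t x
}.

Definition jacobi (br : section_of -> section_of -> section_of) : Prop :=
  forall s t w, ssmooth s -> ssmooth t -> ssmooth w ->
    forall x, br s (br t w) x + br t (br w s) x + br w (br s t) x = 0.

Definition lie_algebroid (rho : forall x : M, {linear E x -> tangent x})
    (br : section_of -> section_of -> section_of) : Prop :=
  [/\ is_bundle_map rho, is_bracket rho br & jacobi br].

Definition is_Eform m (J : forall x : M, ('I_m -> E x) -> R) : Prop :=
  [/\ forall x, multilinear (J x),
      forall x, alternates (J x) &
      forall k (A : 'I_m -> 'I_r), msmooth_on (frame_dom k)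
        (fun x => J x (fun l => frame k (A l) x))].

Definition omit2 m (e : 'I_m.+1 -> section_of) (i j : 'I_m.+1) :
    seq section_of :=
  [seq e k | k <- enum 'I_m.+1 & (k != i) && (k != j)].

(* The slots are counted from 0, so (-1)^(i-1) becomes (-1)^i, while the parity
   of i + j does not change. *)
Definition Ed m (rho : forall x : M, {linear E x -> tangent x})
    (br : section_of -> section_of -> section_of)
    (J : forall x : M, ('I_m -> E x) -> R) (e : 'I_m.+1 -> section_of)
    (x : M) : R :=
  \sum_(i < m.+1) (-1) ^+ i *
     tderiv (rho x (e i x)) (fun y => J y (fun l => e (lift i l) y))
  + \sum_(i < m.+1) \sum_(j < m.+1 | (i < j)%N) (-1) ^+ (i + j) *
     J x (fun l => nth (fun=> 0) (br (e i) (e j) :: omit2 e i j) l x).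

(* EdJ = - iota_rho^{m+1} H, where
   iota_rho^{m+1} H (e_1, ..., e_{m+1}) = H(rho(e_{m+1}), ..., rho(e_1)). *)
Definition compatible_form m (rho : forall x : M, {linear E x -> tangent x})
    (br : section_of -> section_of -> section_of)
    (J : forall x : M, ('I_m -> E x) -> R)
    (H : forall x : M, ('I_m.+1 -> tangent x) -> R) : Prop :=
  forall e : 'I_m.+1 -> section_of, (forall i, ssmooth (e i)) ->
    forall x, Ed rho br J e x = - H x (fun l => rho x (e (rev_ord l) x)).

(* The bracket at x of sections defined near x, computed with any global smooth
   sections having the same germs; by the Leibniz rule the bracket is local, so
   the set below has exactly one element when s and t are smooth near x. *)
Definition local_bracket (br : section_of -> section_of -> section_of)
    (s t : section_of) (x : M) : E x :=
  xget 0 [set w : E x | exists s' t', [/\ ssmooth s', ssmooth t',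
    \forall y \near x, s' y = s y, \forall y \near x, t' y = t y
    & w = br s' t' x]].

End Algebroid.

Variant gen (d r : nat) : Type :=
  | Gq of 'I_r | Gz of 'I_d | Gy of 'I_r
  | Gxi of 'I_d | Gp of 'I_r | Gzeta of 'I_d | Geta of 'I_r.

Arguments Gq {d r}. Arguments Gz {d r}. Arguments Gy {d r}.
Arguments Gxi {d r}. Arguments Gp {d r}.
Arguments Gzeta {d r}. Arguments Geta {d r}.

Definition gen_sum (d r : nat) : Type :=
  ('I_r + ('I_d + ('I_r + ('I_d + ('I_r + ('I_d + 'I_r))))))%type.

Definition gen_to_sum d r (v : gen d r) : gen_sum d r :=
  match v with
  | Gq a => inl a
  | Gz i => inr (inl i)
  | Gy a => inr (inr (inl a))
  | Gxi i => inr (inr (inr (inl i)))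
  | Gp a => inr (inr (inr (inr (inl a))))
  | Gzeta i => inr (inr (inr (inr (inr (inl i)))))
  | Geta a => inr (inr (inr (inr (inr (inr a)))))
  end.

Definition gen_of_sum d r (v : gen_sum d r) : gen d r :=
  match v with
  | inl a => Gq a
  | inr (inl i) => Gz i
  | inr (inr (inl a)) => Gy a
  | inr (inr (inr (inl i))) => Gxi i
  | inr (inr (inr (inr (inl a)))) => Gp a
  | inr (inr (inr (inr (inr (inl i))))) => Gzeta i
  | inr (inr (inr (inr (inr (inr a))))) => Geta a
  end.

Lemma gen_to_sumK d r : cancel (@gen_to_sum d r) (@gen_of_sum d r).
Proof. by case. Qed.

HB.instance Definition _ d r := Finite.copy (gen d r)
  (can_type (@gen_to_sumK d r)).

(* [gfun d r] is the space of formal power series in the fibre coordinates whose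
   coefficients are functions of x; the coefficient of [f] at the exponent
   vector [m] multiplies the product of the coordinates v^(m v) taken in the
   increasing order of [enum_rank]. An exponent vector is admissible when the
   coordinates of odd degree have exponent at most 1; all the functions built
   below have zero coefficients at the other ones. *)
Definition expo (d r : nat) := {ffun gen d r -> nat}.

Section GradedFunctions.
Context {R : realType} {d r : nat}.
Variable n : nat.

Notation gen := (gen d r).
Notation expo := (expo d r).

Definition gfun : Type := 'rV[R]_d -> expo -> R.

Definition gdeg (v : gen) : int :=
  match v with
  | Gq _ => 1
  | Gz _ => n%:Z - 1
  | Gy _ => n%:Z - 2
  | Gxi _ => n%:Z
  | Gp _ => n%:Z - 1
  | Gzeta _ => 1
  | Geta _ => 2
  end.

Definition godd (v : gen) : bool := odd `|gdeg v|%N.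

Definition is_momentum (v : gen) : bool :=
  match v with Gxi _ | Gp _ | Gzeta _ | Geta _ => true | _ => false end.

Definition gbefore (v w : gen) : bool := (enum_rank v < enum_rank w)%N.

Definition admissible (m : expo) : bool := [forall v, godd v ==> (m v <= 1)%N].

Definition expo1 (v : gen) : expo := [ffun w => (w == v : nat)].

Definition expo_add (m1 m2 : expo) : expo := [ffun v => (m1 v + m2 v)%N].

Definition gcst (a : 'rV[R]_d -> R) : gfun :=
  fun u m => a u *+ [forall v, m v == 0%N].

Definition gvar (v : gen) : gfun := fun _ m => (m == expo1 v)%:R.

(* Koszul sign exponent of the product of the ordered monomials m1 and m2: the
   number of pairs of odd coordinates that have to be exchanged. *)
Definition koszul (m1 m2 : expo) : nat :=
  (\sum_(v | godd v) \sum_(w | godd w && gbefore w v) m1 v * m2 w)%N.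

Definition gmul (f g : gfun) : gfun := fun u m =>
  if admissible m then
    \sum_(h : {dffun forall v : gen, 'I_(m v).+1})
      let m1 : expo := [ffun v => h v : nat] in
      let m2 : expo := [ffun v => (m v - h v)%N] in
      (-1) ^+ koszul m1 m2 * f u m1 * g u m2
  else 0.

Definition gadd (f g : gfun) : gfun := fun u m => f u m + g u m.

Definition gscale (c : R) (f : gfun) : gfun := fun u m => c * f u m.

Definition g0 : gfun := fun _ _ => 0.

Notation "f +g g" := (gadd f g) (at level 50, left associativity).
Notation "f -g g" := (gadd f (gscale (-1) g)) (at level 50, left associativity).
Notation "f *g g" := (gmul f g) (at level 40, left associativity).
Notation "c *:g f" := (gscale c f) (at level 40).

(* [lder] is the left and [rder] the right derivative; for odd v the factor
   (m v).+1 is 1 whenever the other factor is nonzero. *)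
Definition lder (v : gen) (f : gfun) : gfun := fun u m =>
  (-1) ^+ (godd v * \sum_(w | godd w && gbefore w v) m w)%N *
  (m v).+1%:R * f u (expo_add m (expo1 v)).

Definition rder (v : gen) (f : gfun) : gfun := fun u m =>
  (-1) ^+ (godd v * \sum_(w | godd w && gbefore v w) m w)%N *
  (m v).+1%:R * f u (expo_add m (expo1 v)).

Definition xder (i : 'I_d) (f : gfun) : gfun := fun u m =>
  partial i (fun u' => f u' m) u.

(* The contribution of a conjugate pair (Q, P), with {Q, P} = 1; since
   |Q| + |P| = n, graded antisymmetry reads {P, Q} = - (-1)^(|Q||P|) {Q, P}.
   Writing f on the left with right derivatives and g on the right with left
   derivatives is what the graded Leibniz rule in each argument forces. *)
Definition gbr_pair (Q P : gen) (f g : gfun) : gfun :=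
  (rder Q f *g lder P g)
  -g ((-1) ^+ (godd Q && godd P) *:g (rder P f *g lder Q g)).

Definition gbr (f g : gfun) : gfun :=
  \big[gadd/g0]_(i < d) ((xder i f *g lder (Gxi i) g)
                         -g (rder (Gxi i) f *g xder i g))
  +g \big[gadd/g0]_(a < r) gbr_pair (Gq a) (Gp a) f g
  +g \big[gadd/g0]_(i < d) gbr_pair (Gz i) (Gzeta i) f g
  +g \big[gadd/g0]_(a < r) gbr_pair (Gy a) (Geta a) f g.

Definition gpr (f : gfun) : gfun := fun u m =>
  if [forall v, is_momentum v ==> (m v == 0%N)] then f u m else 0.

Definition homogeneous_on (W : set 'rV[R]_d) (k : int) (f : gfun) : Prop :=
  forall u m, W u -> f u m != 0 -> \sum_v gdeg v *+ m v = k.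

Definition zero_on (W : set 'rV[R]_d) (f : gfun) : Prop :=
  forall u m, W u -> f u m = 0.

(* beta = e^{ad phi} alpha on W: the series
   alpha + {alpha, phi} + 1/2 {{alpha, phi}, phi} + ...
   converges to beta coefficientwise. *)
Definition is_twist (W : set 'rV[R]_d) (phi alpha beta : gfun) : Prop :=
  forall u m, W u ->
    series (fun k => (k`!%:R)^-1 * iter k (gbr^~ phi) alpha u m) @ \oo
      --> beta u m.

Definition pr_twist_zero (W : set 'rV[R]_d) (phi alpha : gfun) : Prop :=
  exists2 beta, is_twist W phi alpha beta & zero_on W (gpr beta).

Definition gTheta (H : ('I_n.+1 -> 'I_d) -> 'rV[R]_d -> R) : gfun :=
  \big[gadd/g0]_(i < d) (gvar (Gxi i) *g gvar (Gzeta i))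
  +g \big[gadd/g0]_(a < r) (gvar (Gp a) *g gvar (Geta a))
  +g ((-1) ^+ (n * n.+1)./2 / (n.+1)`!%:R) *:g
     \big[gadd/g0]_(I : {ffun 'I_n.+1 -> 'I_d})
        (gcst (H I) *g
         \big[gmul/gcst (fun=> 1)]_(k < n.+1) gvar (Gzeta (I k))).

Definition gphi_Lie (rho : 'I_d -> 'I_r -> 'rV[R]_d -> R)
    (C : 'I_r -> 'I_r -> 'I_r -> 'rV[R]_d -> R) : gfun :=
  \big[gadd/g0]_(i < d) \big[gadd/g0]_(a < r)
     (gcst (rho i a) *g gvar (Gz i) *g gvar (Gq a))
  +g ((-1) ^+ n.-1 / 2) *:g
     \big[gadd/g0]_(a < r) \big[gadd/g0]_(b < r) \big[gadd/g0]_(c < r)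
        (gcst (C a b c) *g gvar (Gq a) *g gvar (Gq b) *g gvar (Gy c)).

Definition gJ (J : ('I_n -> 'I_r) -> 'rV[R]_d -> R) : gfun :=
  (n`!%:R)^-1 *:g
  \big[gadd/g0]_(A : {ffun 'I_n -> 'I_r})
     (gcst (J A) *g \big[gmul/gcst (fun=> 1)]_(k < n) gvar (Gq (A k))).

Definition gphi (rho : 'I_d -> 'I_r -> 'rV[R]_d -> R)
    (C : 'I_r -> 'I_r -> 'I_r -> 'rV[R]_d -> R)
    (J : ('I_n -> 'I_r) -> 'rV[R]_d -> R) : gfun :=
  gphi_Lie rho C -g gJ J.

End GradedFunctions.

Section Twisted.
Context {R : realType} {d : nat} {M : manifold R d} {r : nat}.
Context {E : vbundle M r}.
Variable n : nat.
Variable rho : forall x : M, {linear E x -> tangent x}.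
Variable br : section_of E -> section_of E -> section_of E.
Variable J : forall x : M, ('I_n -> E x) -> R.
Variable H : forall x : M, ('I_n.+1 -> tangent x) -> R.

Variables (k : chart_idx M) (l : frame_idx E).

Definition coord_dom : set 'rV[R]_d :=
  chart k @` (chart_dom k `&` frame_dom l).

Definition loc_rho (i : 'I_d) (a : 'I_r) (u : 'rV[R]_d) : R :=
  let x := chart_inv k u in
  tcoord k (rho x (frame l a x)) 0 i.

(* [loc_C a b c] is C_{ab}^c. *)
Definition loc_C (a b c : 'I_r) (u : 'rV[R]_d) : R :=
  let x := chart_inv k u in
  fcoord l c x (local_bracket br (frame l a) (frame l b) x).

Definition loc_J (A : 'I_n -> 'I_r) (u : 'rV[R]_d) : R :=
  let x := chart_inv k u in
  J (fun j => frame l (A j) x).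

Definition loc_H (I : 'I_n.+1 -> 'I_d) (u : 'rV[R]_d) : R :=
  form_coef H k I (chart_inv k u).

Definition loc_Theta : gfun := gTheta (R := R) (r := r) loc_H.

Definition loc_phi : gfun := gphi loc_rho loc_C loc_J.

End Twisted.

(* A global function vanishes (is homogeneous) if and only if its expressions in
   all the coordinate systems of a covering family do. *)
Definition twist_vanishes (R : realType) (d : nat) (M : manifold R d) (r : nat)
    (E : vbundle M r) (n : nat)
    (rho : forall x : M, {linear E x -> tangent x})
    (br : section_of E -> section_of E -> section_of E)
    (J : forall x : M, ('I_n -> E x) -> R)
    (H : forall x : M, ('I_n.+1 -> tangent x) -> R) : Prop :=
  forall (k : chart_idx M) (l : frame_idx E),
    pr_twist_zero n (coord_dom k l) (loc_phi rho br J k l)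
      (@loc_Theta R d M r n H k).

Definition twisted_QP (R : realType) (d : nat) (M : manifold R d) (r : nat)
    (E : vbundle M r) (n : nat)
    (rho : forall x : M, {linear E x -> tangent x})
    (br : section_of E -> section_of E -> section_of E)
    (J : forall x : M, ('I_n -> E x) -> R)
    (H : forall x : M, ('I_n.+1 -> tangent x) -> R) : Prop :=
  (forall (k : chart_idx M) (l : frame_idx E),
     homogeneous_on n (coord_dom k l) n%:Z (loc_phi rho br J k l)) /\
  twist_vanishes rho br J H.

(* Main.v *)
Require Import Defs.
From HB Require Import structures.
From mathcomp Require Import all_boot all_order all_algebra.
From mathcomp Require Import all_classical all_reals all_analysis.
From mathcomp Require Import ring lra zify.

Set Implicit Arguments.
Unset Strict Implicit.
Unset Printing Implicit Defensive.

Import Order.TTheory GRing.Theory Num.Theory.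
Import numFieldNormedType.Exports.

Local Open Scope classical_set_scope.
Local Open Scope ring_scope.

(** Since [phi] contains no momenta, the bracket with it is a derivation that kills
    the coordinates of $\mathcal M$ and sends each momentum to a function without
    momenta. On a product of [k] momenta the [k]-th power of this derivation is
    $k!$ times the product of their images, the higher powers vanish, and the
    lower ones leave terms that vanish at zero momenta ([gproj_iter_word]). So the
    twist of [Theta] exists, is unique, and at zero momenta it is [Theta] with
    every momentum replaced by its bracket with [phi] ([pr_twist_zeroP]).

    Up to sign, $\zeta^i$ becomes the [i]-th component of the anchor, a one-form on
    [E], and $\eta^c$ the [c]-th component of the bracket, a two-form; $\xi_i$ and
    $p_a$ become derivatives of [phi]. The first two terms of [Theta] therefore
    become the vector field $\rho^i_aq^a\partial_i-\frac12C^c_{ab}q^aq^b\partial_{q^c}$ applied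
    to [phi], and the third one the pullback of [H] along the anchor
    ([twist_baseE_forms]). As [phi] is linear in [z] and [y] up to the form [J],
    the result has three independent components: the differentials of the
    components of the anchor, those of the components of the bracket, and the
    differential of [J] corrected by [H]. Evaluated on vectors they say that
    the anchor respects brackets ([dform_anchor]), that the Jacobi identity holds
    for sections with constant coordinates ([dform_jacobi]), and that the
    coordinate expression of the differential of [J] is the contraction of [H]
    ([twist_local]). The sign $(-1)^{n(n+1)/2}$ in [Theta] is the one by which
    reversing its arguments changes [H] ([altform_rev]).

    It remains to compare these equations in all charts with the global axioms.
    The bracket acts on global sections only; bump functions make it local
    ([br_local_r]) and realize local coordinates by global sections
    ([section_extend]). In coordinates, the second derivatives in the Jacobiator
    cancel by symmetry, and it becomes the Jacobiator of constant sections plus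
    anchor defects that differentiate the coordinates ([lbr_jacobi]); constant
    sections detect the first, a section with a linear coordinate the second
    ([equations_of_algebroid]). In the differential of [J], the derivatives of the
    coordinates of the sections cancel ([Ed_loc]).

    Finally, [phi] is always homogeneous of degree [n] ([Phi_deg]), so a twisted
    QP-manifold is the same as the vanishing of the twist at zero momenta. *)

(** * Partial derivatives and smooth functions on $R^d$ *)

Section SmoothRd.
Context {R : realType}.

Lemma partialE d (f : 'rV[R]_d -> R) i u :
  differentiable f u -> partial i f u = 'd f u (delta_mx 0 i).
Proof. by move=> df; rewrite /partial deriveE. Qed.

Lemma diff_partial d (f : 'rV[R]_d -> R) u (w : 'rV[R]_d) :
  differentiable f u -> 'd f u w = \sum_j w 0 j * partial j f u.
Proof.
move=> df; rewrite {1}[w]row_sum_delta linear_sum; apply: eq_bigr => j _.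
by rewrite linearZ partialE.
Qed.

Lemma partial_cst d i (c : R) (u : 'rV[R]_d) : partial i (fun=> c) u = 0.
Proof. exact: derive_cst. Qed.

Lemma partialD d i (f g : 'rV[R]_d -> R) u :
  differentiable f u -> differentiable g u ->
  partial i (fun v => f v + g v) u = partial i f u + partial i g u.
Proof.
by move=> df dg; rewrite /partial -deriveD //; exact: diff_derivable.
Qed.

Lemma partialM d i (f g : 'rV[R]_d -> R) u :
  differentiable f u -> differentiable g u ->
  partial i (fun v => f v * g v) u = partial i f u * g u + f u * partial i g u.
Proof.
move=> df dg; rewrite /partial.
have -> : (fun v => f v * g v) = f * g by [].
rewrite deriveM; [|exact: diff_derivable..].
by rewrite addrC [_ *: _]mulrC.
Qed.

Lemma differentiable_bigsum d (I : Type) (s : seq I) (P : pred I)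
    (f : I -> 'rV[R]_d -> R) u :
  (forall k, P k -> differentiable (f k) u) ->
  differentiable (fun v => \sum_(k <- s | P k) f k v) u.
Proof.
move=> df; elim: s => [|k s IH].
  have -> : (fun v => \sum_(k <- [::] | P k) f k v) = cst 0.
    by apply/funext => v; rewrite big_nil.
  exact: differentiable_cst.
have -> : (fun v => \sum_(k <- k :: s | P k) f k v) =
  (if P k then f k else cst 0) + (fun v => \sum_(k <- s | P k) f k v).
  apply/funext => v; rewrite big_cons; case: ifP => // _.
  by rewrite [RHS]add0r.
apply: differentiableD => //; case: ifP => // Pk.
exact: df.
Qed.

Lemma partial_sum d i (I : Type) (s : seq I) (P : pred I)
    (f : I -> 'rV[R]_d -> R) u :
  (forall k, P k -> differentiable (f k) u) ->
  partial i (fun v => \sum_(k <- s | P k) f k v) u =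
  \sum_(k <- s | P k) partial i (f k) u.
Proof.
move=> df; elim: s => [|k s IH].
  rewrite big_nil; transitivity (partial i (fun=> 0 : R) u); last exact: partial_cst.
  by congr (partial _ _ _); apply/funext => v; rewrite big_nil.
rewrite big_cons; case: ifP => Pk.
  rewrite -IH -partialD; [|exact: df|exact: differentiable_bigsum].
  by congr (partial _ _ _); apply/funext => v; rewrite big_cons Pk.
rewrite -IH.
by congr (partial _ _ _); apply/funext => v; rewrite big_cons Pk.
Qed.

Lemma partial_near d i (f g : 'rV[R]_d -> R) u :
  (\forall v \near u, f v = g v) -> partial i f u = partial i g u.
Proof. exact: near_eq_derive. Qed.

(** Differentiability is a statement about the germ: the difference quotients
    agree near zero, so the two functions have the same expansion. *)
Lemma differentiable_near d (f g : 'rV[R]_d -> R) u :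
  (\forall v \near u, f v = g v) -> differentiable f u -> differentiable g u.
Proof.
move=> fg df; have fgu : f u = g u := nbhs_singleton fg.
have df0 := diff_locally df.
have fg0 : \forall h \near 0, f (h + u) = g (h + u).
  by move: fg; rewrite (near_shift 0) subr0.
have dg0 : g \o shift u = cst (g u) + 'd f u +o_ (0 : 'rV[R]_d) id.
  apply/eqaddoP => eps eps0.
  have /eqaddoP /(_ eps eps0) := df0.
  apply: filter_app; near=> h.
  have E : f (h + u) = g (h + u) by near: h.
  by rewrite /= /shift /= /cst !fctE E fgu.
have E : 'd g u = 'd f u :> ('rV[R]_d -> R).
  by apply: diff_unique => //; exact: diff_continuous.
apply/diff_locallyP; rewrite E; split => //; exact: diff_continuous.
Unshelve. all: by end_near. Qed.

End SmoothRd.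

Section SmoothOn.
Context {R : realType}.

Lemma foldr_partial_near d (f g : 'rV[R]_d -> R) s (u : 'rV[R]_d) :
  (\forall v \near u, f v = g v) ->
  \forall v \near u, foldr (@partial R d) f s v = foldr (@partial R d) g s v.
Proof.
move=> fg; elim: s => [//|i s IH] /=.
by move/nbhs_interior: IH; apply: filterS => v; exact: partial_near.
Qed.

Lemma smooth_on_eq d (U : set 'rV[R]_d) f g :
  open U -> (forall u, U u -> f u = g u) -> smooth_on U f -> smooth_on U g.
Proof.
move=> oU fg sf s u Uu; apply: (differentiable_near _ (sf s u Uu)).
apply: foldr_partial_near; apply: filterS (open_nbhs_nbhs (conj oU Uu)).
by move=> v /fg.
Qed.

Lemma smooth_onW d (U V : set 'rV[R]_d) f :
  U `<=` V -> smooth_on V f -> smooth_on U f.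
Proof. by move=> UV sf s u /UV; exact: sf. Qed.

Lemma smooth_on_differentiable d (U : set 'rV[R]_d) f u :
  smooth_on U f -> U u -> differentiable f u.
Proof. by move=> sf Uu; exact: (sf [::]). Qed.

Lemma smooth_on_partial d (U : set 'rV[R]_d) f i :
  smooth_on U f -> smooth_on U (partial i f).
Proof. by move=> sf s u Uu; have := sf (rcons s i) u Uu; rewrite foldr_rcons. Qed.

(** Smoothness quantifies over all iterated derivatives at once, and a derivative
    of a product or a composite is a sum of products that the induction
    hypothesis has to cover. Bounding the order of differentiability makes this
    an induction on [k]. *)
Definition diff_upto d (U : set 'rV[R]_d) (k : nat) (f : 'rV[R]_d -> R) :=
  forall s u, (size s <= k)%N -> U u -> differentiable (foldr (@partial R d) f s) u.

Lemma diff_uptoP d (U : set 'rV[R]_d) f :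
  smooth_on U f <-> forall k, diff_upto U k f.
Proof.
by split=> [sf k s u _|sf s u]; [exact: sf|exact: (sf (size s))].
Qed.

Lemma smooth_diff_upto d (U : set 'rV[R]_d) f k : smooth_on U f -> diff_upto U k f.
Proof. by move=> sf s u _; exact: sf. Qed.

Lemma diff_uptoS d (U : set 'rV[R]_d) k f :
  (forall u, U u -> differentiable f u) ->
  (forall i, diff_upto U k (partial i f)) -> diff_upto U k.+1 f.
Proof.
move=> df dp s u; elim/last_ind: s => [_ Uu|s i _]; first exact: df.
by rewrite size_rcons ltnS foldr_rcons => sk Uu; exact: dp.
Qed.

Lemma diff_upto_eq d (U : set 'rV[R]_d) k f g :
  open U -> (forall u, U u -> f u = g u) -> diff_upto U k f -> diff_upto U k g.
Proof.
move=> oU fg sf s u sk Uu; apply: (differentiable_near _ (sf s u sk Uu)).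
apply: foldr_partial_near; apply: filterS (open_nbhs_nbhs (conj oU Uu)).
by move=> v /fg.
Qed.

Lemma diff_uptoW d (U : set 'rV[R]_d) k f : diff_upto U k.+1 f -> diff_upto U k f.
Proof. by move=> df s u sk; apply: df; exact: leqW. Qed.

Lemma diff_upto0 d (U : set 'rV[R]_d) k f u : diff_upto U k f -> U u -> differentiable f u.
Proof. by move=> df Uu; exact: (df [::]). Qed.

Lemma diff_upto_partial d (U : set 'rV[R]_d) k f i :
  diff_upto U k.+1 f -> diff_upto U k (partial i f).
Proof.
by move=> df s u sk Uu; have := df (rcons s i) u; rewrite foldr_rcons size_rcons; exact.
Qed.

Lemma diff_upto_base d (U : set 'rV[R]_d) f :
  (forall u, U u -> differentiable f u) -> diff_upto U 0 f.
Proof. by move=> df [|//] u _; exact: df. Qed.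

Lemma diff_upto_cst d (U : set 'rV[R]_d) k (c : R) : diff_upto U k (fun=> c).
Proof.
have H s : exists c', foldr (@partial R d) (fun=> c) s = fun=> c'.
  elim: s => [|i s [c' IH]] /=; first by exists c.
  by exists 0; rewrite IH; apply/funext => u; rewrite partial_cst.
move=> s u _ _; have [c' ->] := H s; exact: differentiable_cst.
Qed.

Lemma diff_upto_sum d (U : set 'rV[R]_d) k (I : Type) (s : seq I) (P : pred I) f :
  open U -> (forall i, P i -> diff_upto U k (f i)) ->
  diff_upto U k (fun u => \sum_(i <- s | P i) f i u).
Proof.
move=> oU; elim: k => [|k IH] in f *.
  move=> df; apply: diff_upto_base => u Uu.
  by apply: differentiable_bigsum => i Pi; exact: (diff_upto0 (df i Pi)).
move=> df; have dd u i : U u -> P i -> differentiable (f i) u.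
  by move=> Uu Pi; exact: (diff_upto0 (df i Pi)).
apply: diff_uptoS => [u Uu|j].
  by apply: differentiable_bigsum => i; exact: dd.
apply: (@diff_upto_eq _ _ _ (fun u => \sum_(i <- s | P i) partial j (f i) u)) => //.
  by move=> u Uu; rewrite partial_sum // => i; exact: dd.
by apply: IH => i Pi; apply: diff_upto_partial; exact: df.
Qed.

Lemma diff_uptoD d (U : set 'rV[R]_d) k f g :
  open U -> diff_upto U k f -> diff_upto U k g -> diff_upto U k (fun u => f u + g u).
Proof.
move=> oU df dg.
apply: (@diff_upto_eq _ _ _
  (fun u => \sum_(b <- [:: true; false]) (if b then f else g) u)) => //.
  by move=> u _; rewrite !big_cons big_nil addr0.
by apply: diff_upto_sum => // -[].
Qed.

Lemma diff_uptoM d (U : set 'rV[R]_d) k f g :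
  open U -> diff_upto U k f -> diff_upto U k g -> diff_upto U k (fun u => f u * g u).
Proof.
move=> oU; elim: k => [|k IH] in f g * => df dg.
  apply: diff_upto_base => u Uu.
  by apply: differentiableM; [exact: (diff_upto0 df)|exact: (diff_upto0 dg)].
apply: diff_uptoS => [u Uu|j].
  by apply: differentiableM; [exact: (diff_upto0 df)|exact: (diff_upto0 dg)].
apply: (@diff_upto_eq _ _ _ (fun u => partial j f u * g u + f u * partial j g u)) => //.
  by move=> u Uu; rewrite partialM //; [exact: (diff_upto0 df)|exact: (diff_upto0 dg)].
by apply: diff_uptoD => //; apply: IH => //; do ?[exact: diff_upto_partial|exact: diff_uptoW].
Qed.

Lemma smooth_on_cst d (U : set 'rV[R]_d) (c : R) : smooth_on U (fun=> c).
Proof. by apply/diff_uptoP => k; exact: diff_upto_cst. Qed.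

Lemma smooth_on_sum d (U : set 'rV[R]_d) (I : Type) (s : seq I) (P : pred I) f :
  open U -> (forall i, P i -> smooth_on U (f i)) ->
  smooth_on U (fun u => \sum_(i <- s | P i) f i u).
Proof.
move=> oU sf; apply/diff_uptoP => k; apply: diff_upto_sum => // i Pi.
exact/smooth_diff_upto/sf.
Qed.

Lemma smooth_onD d (U : set 'rV[R]_d) f g :
  open U -> smooth_on U f -> smooth_on U g -> smooth_on U (fun u => f u + g u).
Proof.
by move=> oU sf sg; apply/diff_uptoP => k; apply: diff_uptoD => //; exact: smooth_diff_upto.
Qed.

Lemma smooth_onM d (U : set 'rV[R]_d) f g :
  open U -> smooth_on U f -> smooth_on U g -> smooth_on U (fun u => f u * g u).
Proof.
by move=> oU sf sg; apply/diff_uptoP => k; apply: diff_uptoM => //; exact: smooth_diff_upto.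
Qed.

(** The derivative of $1/f$ is $-f^{-2}\partial f$, again built from $1/f$, so the
    induction on the order closes up. *)
Lemma smooth_onV d (U : set 'rV[R]_d) f :
  open U -> (forall u, U u -> f u != 0) -> smooth_on U f ->
  smooth_on U (fun u => (f u)^-1).
Proof.
move=> oU f0 sf; apply/diff_uptoP; elim=> [|k IH].
  apply: diff_upto_base => u Uu; apply: differentiableV (f0 u Uu).
  exact: (smooth_on_differentiable sf).
apply: diff_uptoS => [u Uu|j].
  apply: differentiableV (f0 u Uu); exact: (smooth_on_differentiable sf).
apply: (@diff_upto_eq _ _ _ (fun u => -1 * (((f u)^-1 * (f u)^-1) * partial j f u))) => //.
  move=> u Uu; have df := smooth_on_differentiable sf Uu.
  rewrite [RHS]partialE; last by apply: differentiableV (f0 u Uu).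
  rewrite (diffV df (f0 u Uu)) partialE // mulN1r /=.
  by rewrite expr2 invfM scaleNr.
apply: diff_uptoM => //; first exact: diff_upto_cst.
apply: diff_uptoM => //; first exact: diff_uptoM.
exact/smooth_diff_upto/smooth_on_partial.
Qed.

Lemma differentiable_rowfun d e (g : 'rV[R]_d -> 'rV[R]_e) u :
  (forall j, differentiable (fun v => g v 0 j) u) -> differentiable g u.
Proof.
move=> dg; have -> : g = \sum_(j < e) (fun v => g v 0 j *: delta_mx 0 j).
  by apply/funext => v; rewrite fct_sumE -row_sum_delta.
by apply: differentiable_sum => j; exact: differentiableZl.
Qed.

Lemma partial_comp d e (f : 'rV[R]_e -> R) (g : 'rV[R]_d -> 'rV[R]_e) i u :
  (forall j, differentiable (fun v => g v 0 j) u) -> differentiable f (g u) ->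
  partial i (f \o g) u =
  \sum_j partial i (fun v => g v 0 j) u * partial j f (g u).
Proof.
move=> dg df; have dgu := differentiable_rowfun dg.
rewrite partialE; last exact: differentiable_comp.
rewrite diff_comp //= diff_partial //; apply: eq_bigr => j _; congr (_ * _).
by rewrite -deriveE // derive_mx ?mxE //; exact: diff_derivable.
Qed.

Lemma smooth_on_comp d e (U : set 'rV[R]_d) (V : set 'rV[R]_e) f
    (g : 'rV[R]_d -> 'rV[R]_e) :
  open U -> open V -> (forall u, U u -> V (g u)) ->
  (forall j, smooth_on U (fun u => g u 0 j)) -> smooth_on V f ->
  smooth_on U (f \o g).
Proof.
move=> oU oV gUV sg sf; apply/diff_uptoP => k; elim: k => [|k IH] in f sf *.
  apply: diff_upto_base => u Uu; apply: differentiable_comp.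
    by apply: differentiable_rowfun => j; exact: (smooth_on_differentiable (sg j)).
  exact: (smooth_on_differentiable sf (gUV u Uu)).
have dg u : U u -> differentiable g u.
  by move=> Uu; apply: differentiable_rowfun => j; exact: (smooth_on_differentiable (sg j)).
apply: diff_uptoS => [u Uu|i].
  by apply: differentiable_comp; [exact: dg|exact: (smooth_on_differentiable sf (gUV u Uu))].
apply: (@diff_upto_eq _ _ _
  (fun u => \sum_j partial i (fun v => g v 0 j) u * (partial j f \o g) u)) => //.
  move=> u Uu; rewrite partial_comp //.
    by move=> j; exact: (smooth_on_differentiable (sg j)).
  exact: (smooth_on_differentiable sf (gUV u Uu)).
apply: diff_upto_sum => // j _; apply: diff_uptoM => //.
  exact/smooth_diff_upto/smooth_on_partial.
by apply: IH; exact: smooth_on_partial.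
Qed.

Lemma partial_coord d (i j : 'I_d) (u : 'rV[R]_d) :
  partial i (fun u => u 0 j) u = (i == j)%:R.
Proof.
have := @derive_mx R _ 1 d id u (delta_mx 0 i) (@derivable_id _ _ _ _).
move=> /matrixP/(_ 0 j); rewrite derive_id !mxE /= => H.
by rewrite /partial -H eq_sym; case: eqP.
Qed.

Lemma smooth_on_coord d (U : set 'rV[R]_d) (j : 'I_d) :
  open U -> smooth_on U (fun u => u 0 j).
Proof.
move=> oU; apply/diff_uptoP; case=> [|k].
  apply: diff_upto_base => u _; exact: differentiable_coord.
apply: diff_uptoS => [u _|i]; first exact: differentiable_coord.
apply: (@diff_upto_eq _ _ _ (fun=> (i == j)%:R)) => //; last exact: diff_upto_cst.
by move=> u _; rewrite partial_coord.
Qed.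

End SmoothOn.

(** * Symmetry of second derivatives *)

Section Schwarz.
Context {R : realType} {d : nat}.
Implicit Types (f : 'rV[R]_d -> R) (u p v : 'rV[R]_d).

Lemma is_derive_line f p v (t : R) : differentiable f (p + t *: v) ->
  is_derive t (1 : R) (fun s : R => f (p + s *: v)) ('D_v f (p + t *: v)).
Proof.
move=> df.
have dg : is_diff t (fun s : R => p + s *: v) (fun s => s *: v).
  have -> : (fun s : R => p + s *: v) = cst p + *:%R^~ v by [].
  rewrite -[X in is_diff _ _ X]add0r.
  exact: (is_diffD (is_diff_cst p t) (is_diff_scalel t v)).
have dc : differentiable (f \o (fun s : R => p + s *: v)) t.
  by apply: differentiable_comp => //; exact: ex_diff.
apply: DeriveDef; first exact: diff_derivable.
rewrite !deriveE // diff_comp //= ?diff_val ?scale1r //; exact: ex_diff.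
Qed.

Lemma norm_delta_le (i : 'I_d) : `|(delta_mx 0 i : 'rV[R]_d)| <= 1.
Proof.
rewrite [leLHS]/Num.Def.normr/= mx_normrE; apply: bigmax_le => // -[a b] _ /=.
by rewrite mxE; case: (_ && _); rewrite ?normr1 ?normr0.
Qed.

Definition second_diff f u i j (h : R) :=
  f (u + h *: delta_mx 0 i + h *: delta_mx 0 j) - f (u + h *: delta_mx 0 i)
  - f (u + h *: delta_mx 0 j) + f u.

Lemma second_diffC f u i j h : second_diff f u i j h = second_diff f u j i h.
Proof.
rewrite /second_diff [u + _ + h *: delta_mx 0 j]addrAC -!addrA; congr (_ + _).
by rewrite addrCA.
Qed.

(** The mean value theorem in direction [i] turns the second difference into a
    difference of values of the partial derivative, whose differentiability at
    [u] then gives the second derivative up to an error of smaller order. *)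
Lemma second_diffP (U : set 'rV[R]_d) f u i j (eps : R) :
  open U -> U u -> (forall v, U v -> differentiable f v) ->
  differentiable (partial i f) u -> 0 < eps ->
  exists2 del : R, 0 < del & forall h, 0 < h < del ->
    `|second_diff f u i j h - h ^+ 2 * partial j (partial i f) u| <= eps * h ^+ 2.
Proof.
move=> oU Uu df dg eps0; set g := partial i f in dg *.
have [r1 /= r10 HU] : exists2 r : R, 0 < r & forall w, `|w| < r -> U (u + w).
  have /nbhs_ballP[r r0 Hr] := open_nbhs_nbhs (conj oU Uu).
  exists r => // w wr; apply: Hr; rewrite -ball_normE /= opprD addNKr.
  by rewrite normrN.
have e3 : 0 < eps / 3 by rewrite divr_gt0.
have [r2 /= r20 Hg] : exists2 r : R, 0 < r & forall w, `|w| < r ->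
    `|g (w + u) - g u - 'd g u w| <= eps / 3 * `|w|.
  have /eqaddoP/(_ _ e3) := diff_locally dg.
  move=> /nbhs_ballP[r r0 Hr]; exists r => // w wr.
  have := Hr w; rewrite -ball_normE /= sub0r normrN => /(_ wr).
  by rewrite /shift /= !fctE /cst opprD addrA.
pose del := Num.min r1 r2 / 2.
exists del; first by rewrite divr_gt0 // lt_min r10.
move=> h /andP[h0 hdel].
have h2 : 2 * h < Num.min r1 r2 by rewrite mulrC -ltr_pdivlMr.
have nw (c k : R) : 0 <= c <= h -> 0 <= k <= h ->
    `|c *: delta_mx 0 i + k *: delta_mx 0 j : 'rV[R]_d| <= 2 * h.
  move=> /andP[c0 ch] /andP[k0 kh].
  rewrite (le_trans (ler_normD _ _)) // mulr2n mulrDl mul1r lerD //.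
    rewrite normrZ ger0_norm // -[leRHS]mulr1 ler_pM // ?norm_delta_le //.
  rewrite normrZ ger0_norm // -[leRHS]mulr1 ler_pM // ?norm_delta_le //.
have nw1 (c k : R) : 0 <= c <= h -> 0 <= k <= h ->
    U (u + (c *: delta_mx 0 i + k *: delta_mx 0 j)).
  move=> ch kh; apply: HU; apply: le_lt_trans (nw _ _ ch kh) _.
  by apply: lt_le_trans h2 _; rewrite ge_min lexx.
(* The second difference is the increment of [phi] between [0] and [h]. *)
pose phi t := f (u + h *: delta_mx 0 j + t *: delta_mx 0 i) - f (u + t *: delta_mx 0 i).
have dphi t : 0 <= t <= h ->
    is_derive t (1 : R) phi (g (u + h *: delta_mx 0 j + t *: delta_mx 0 i) - g (u + t *: delta_mx 0 i)).
  move=> th; apply: is_deriveB; apply: is_derive_line; apply: df.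
    by rewrite -addrA [h *: _ + _]addrC; apply: nw1 => //; rewrite (ltW h0) lexx.
  by rewrite -[t *: _]addr0 -(scale0r (delta_mx 0 j)); apply: nw1 => //; rewrite lexx (ltW h0).
have [||c cI E] := MVT h0 (f := phi)
   (df := fun t => g (u + h *: delta_mx 0 j + t *: delta_mx 0 i) - g (u + t *: delta_mx 0 i)).
- move=> t; rewrite in_itv /= => /andP[/ltW t0 /ltW th]; apply: dphi.
  by rewrite t0.
- apply: derivable_within_continuous => t; rewrite in_itv /= => tI.
  by case: (dphi t tI).
move: cI; rewrite in_itv /= => /andP[/ltW c0 /ltW ch].
have -> : second_diff f u i j h = phi h - phi 0.
  rewrite /phi /second_diff !scale0r !addr0 [u + _ + h *: delta_mx 0 i]addrAC.
  ring.
rewrite E subr0.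
have lin : 'd g u (h *: delta_mx 0 j) = h * partial j g u.
  by rewrite linearZ -partialE.
pose w1 : 'rV[R]_d := c *: delta_mx 0 i + h *: delta_mx 0 j.
pose w2 : 'rV[R]_d := c *: delta_mx 0 i.
have w2E : w2 = c *: delta_mx 0 i + 0 *: delta_mx 0 j by rewrite scale0r addr0.
have hh : 0 <= h <= h by rewrite lexx (ltW h0).
have cc : 0 <= c <= h by rewrite c0 ch.
have h00 : 0 <= (0 : R) <= h by rewrite lexx (ltW h0).
have n1 : `|w1| <= 2 * h by exact: nw.
have n2 : `|w2| <= h.
  rewrite normrZ ger0_norm // -[leRHS]mulr1 ler_pM // ?norm_delta_le //.
have lt2 : 2 * h < r2 by apply: lt_le_trans h2 _; rewrite ge_min lexx orbT.
have G1 := Hg w1 (le_lt_trans n1 lt2).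
have G2 : `|g (w2 + u) - g u - 'd g u w2| <= eps / 3 * `|w2|.
  apply: Hg; apply: le_lt_trans n2 (le_lt_trans _ lt2).
  by rewrite mulr2n mulrDl mul1r lerDl ltW.
have lin2 : 'd g u w1 = 'd g u w2 + h * partial j g u.
  by rewrite /w1 linearD lin.
have -> : (g (u + h *: delta_mx 0 j + c *: delta_mx 0 i) - g (u + c *: delta_mx 0 i)) * h
   - h ^+ 2 * partial j g u =
  ((g (w1 + u) - g u - 'd g u w1) - (g (w2 + u) - g u - 'd g u w2)) * h.
  rewrite lin2 [w1 + u]addrC /w1 [c *: _ + _]addrC addrA [w2 + u]addrC -/w2.
  ring.
rewrite normrM (ger0_norm (ltW h0)) expr2 mulrA ler_pM // ?(ltW h0) //.
apply: le_trans (ler_normB _ _) _.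
apply: le_trans (lerD G1 G2) _.
rewrite -mulrDr.
have -> : eps * h = eps / 3 * (2 * h + h) by field.
by rewrite ler_pM2l // lerD.
Qed.

(** Both sides are limits of the same symmetric second difference quotient. *)
Lemma partialC (U : set 'rV[R]_d) f u i j : open U -> U u -> smooth_on U f ->
  partial i (partial j f) u = partial j (partial i f) u.
Proof.
move=> oU Uu sf.
have df v : U v -> differentiable f v by exact: smooth_on_differentiable.
have dp k : differentiable (partial k f) u.
  by apply: (smooth_on_differentiable (smooth_on_partial k sf)).
apply/eqP; rewrite -subr_eq0; apply/eqP/normr0_eq0/le_anti.
rewrite normr_ge0 andbT; apply/ler_addgt0Pl => eps eps0; rewrite addr0.
have e2 : 0 < eps / 2 by rewrite divr_gt0.
have [d1 d10 H1] := second_diffP j oU Uu df (dp i) e2.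
have [d2 d20 H2] := second_diffP i oU Uu df (dp j) e2.
pose h := Num.min d1 d2 / 2.
have m0 : 0 < Num.min d1 d2 by rewrite lt_min d10.
have h0 : 0 < h by rewrite divr_gt0.
have hm : h < Num.min d1 d2.
  by rewrite /h ltr_pdivrMr // mulr_natr mulr2n ltrDl.
clearbody h; have hh0 : 0 < h ^+ 2 by rewrite exprn_gt0.
have {}H1 := H1 h; have {}H2 := H2 h.
rewrite h0 (lt_le_trans hm) /= ?ge_min ?lexx // in H1.
rewrite h0 (lt_le_trans hm) /= ?ge_min ?lexx ?orbT // second_diffC in H2.
have := lerD (H1 isT) (H2 isT); rewrite -mulrDl -splitr.
rewrite -[X in X + _ <= _]normrN => /(le_trans (ler_normD _ _)).
set D := second_diff _ _ _ _ _.
set A := partial i _ u; set B := partial j _ u; clearbody A B D.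
have -> : - (D - h ^+ 2 * B) + (D - h ^+ 2 * A) = h ^+ 2 * (B - A) by ring.
rewrite normrM (gtr0_norm hh0) mulrC (ler_pM2r hh0).
by rewrite distrC.
Qed.

End Schwarz.

(** * Bump functions *)

Section Flat.
Context {R : realType}.
Implicit Types (p : {poly R}) (t h : R).

(** The functions $p(1/t)e^{-1/t}$, extended by zero to $t\le 0$. Allowing all
    polynomials [p] makes this family closed under differentiation, which is how
    its smoothness at zero is proved. *)
Definition flat p (t : R) : R := if 0 < t then p.[t^-1] * expR (- t^-1) else 0.

(** The exponential beats every power of $1/t$. A linear bound suffices for the
    derivative at zero. *)
Lemma flat_bound p :
  exists2 K : R, 0 <= K & forall t, 0 < t <= 1 -> `|flat p t| <= K * t.
Proof.
pose N := size p; pose c := \sum_(i < N) `|p`_i|.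
have c0 : 0 <= c by apply: sumr_ge0 => i _.
exists (c * N.+1%:R ^+ N.+1); first by rewrite mulr_ge0 // exprn_ge0.
move=> t /andP[t0 t1]; rewrite /flat t0; set s := t^-1.
have s1 : 1 <= s by rewrite invr_ge1 ?unitf_gt0 // t0.
have s0 : 0 < s by rewrite invr_gt0.
have ps : `|p.[s]| <= c * s ^+ N.
  rewrite horner_coef (le_trans (ler_norm_sum _ _ _)) // mulr_suml ler_sum // => i _.
  rewrite normrM ler_wpM2l // normrX gtr0_norm // ler_weXn2l //; exact: ltnW.
have es : s ^+ N.+1 <= N.+1%:R ^+ N.+1 * expR s.
  have -> : expR s = expR (s / N.+1%:R) ^+ N.+1.
    by rewrite -expRM_natr divfK.
  rewrite -exprMn ler_pXn2r ?nnegrE ?(ltW s0) // ?mulr_ge0 ?expR_ge0 //.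
  rewrite mulrC -ler_pdivrMr // (le_trans _ (expR_ge1Dx _)) // lerDr //.
rewrite normrM (gtr0_norm (expR_gt0 _)) expRN.
rewrite -ler_pdivlMr ?invr_gt0 ?expR_gt0 // invrK (le_trans ps) //.
have -> : c * N.+1%:R ^+ N.+1 * t * expR s = c * (N.+1%:R ^+ N.+1 * expR s / s).
  by rewrite /s invrK; ring.
by rewrite ler_wpM2l // ler_pdivlMr // -exprSr.
Qed.

Lemma flat_mulX p t : 0 < t -> flat ('X * p) t = t^-1 * flat p t.
Proof. by move=> t0; rewrite /flat t0 hornerM hornerX mulrA. Qed.

Lemma is_derive_flat p t :
  is_derive t (1 : R) (flat p) (flat ('X ^+ 2 * (p - p^`())) t).
Proof.
have [t0|t0|<-] := ltgtP 0 t.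
- apply: (@near_eq_is_derive R R R (fun s : R => p.[s^-1] * expR (- s^-1))).
    have : \forall s \near t, 0 < s by exact: lt_nbhsr.
    by apply: filterS => s s0; rewrite /flat s0.
  have tn0 : t != 0 by rewrite gt_eqF.
  have dV : is_derive t (1 : R) (fun s : R => s^-1) (- t ^- 2).
    apply: DeriveDef; first by apply: derivableV.
    by rewrite deriveV // derive_id /GRing.scale /= mulr1.
  have dp : is_derive t (1 : R) (fun s : R => p.[s^-1]) (p^`().[t^-1] * (- t ^- 2)).
    exact: (@is_derive1_comp R (horner p) _ t _ _ (is_derive_poly p t^-1) dV).
  have dW : is_derive t (1 : R) (fun s : R => - s^-1) (- - t ^- 2) by exact: is_deriveN.
  have de : is_derive t (1 : R) (fun s : R => expR (- s^-1)) (expR (- t^-1) * (- - t ^- 2)).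
    exact: (@is_derive1_comp R expR _ t _ _ (is_derive_expR _) dW).
  suff -> : flat ('X ^+ 2 * (p - p^`())) t =
      p.[t^-1] *: (expR (- t^-1) * (- - t ^- 2)) +
      expR (- t^-1) *: (p^`().[t^-1] * (- t ^- 2)) by exact: is_deriveM.
  rewrite /flat t0 hornerM hornerXn hornerD hornerN exprVn /GRing.scale /=; ring.
- apply: (@near_eq_is_derive R R R (fun=> 0)).
    have : \forall s \near t, s < 0 by exact: lt_nbhsl.
    by apply: filterS => s s0; rewrite /flat ltNge ltW.
  rewrite /flat ltNge ltW //=; exact: is_derive_cst.
- have [K K0 HK] := flat_bound ('X * p).
  rewrite [X in is_derive _ _ _ X](_ : _ = 0); last by rewrite /flat ltxx.
  have C : h^-1 *: ((flat p \o shift (0 : R)) (h *: (1 : R)) - flat p 0) @[h --> 0^'] --> (0 : R).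
    apply/cvgrPdist_le => eps eps0.
    rewrite /= near_withinE.
    have r0 : 0 < Num.min 1 (eps / (K + 1)) by rewrite lt_min ltr01 divr_gt0 // ltr_wpDl.
    apply/nbhs_ballP; exists (Num.min 1 (eps / (K + 1))) => // h.
    rewrite -ball_normE /= sub0r normrN lt_min => /andP[h1 h2] _.
    have p0 : flat p 0 = 0 by rewrite /flat ltxx.
    rewrite sub0r normrN p0 subr0 addr0 [h *: 1]mulr1.
    have [h0|h0] := ltP 0 h; last first.
      by rewrite /flat ltNge h0 /= scaler0 normr0 ltW.
    rewrite (_ : h^-1 *: flat p h = flat ('X * p) h); last by rewrite flat_mulX.
    rewrite gtr0_norm // in h1 h2.
    apply: le_trans (HK h _) _; first by rewrite h0 ltW.
    apply: (@le_trans _ _ ((K + 1) * h)); first by rewrite ler_wpM2r ?(ltW h0) // lerDl.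
    by rewrite mulrC -ler_pdivlMr ?ltW // ltr_wpDl.
  by apply: DeriveDef; [apply/cvg_ex; exists 0|exact: cvg_lim].
Qed.

Lemma smooth_on_flat d (U : set 'rV[R]_d) p g :
  open U -> smooth_on U g -> smooth_on U (flat p \o g).
Proof.
move=> oU sg; apply/diff_uptoP => k; elim: k => [|k IH] in p *.
  apply: diff_upto_base => u Uu; apply: differentiable_comp.
    exact: (smooth_on_differentiable sg).
  by apply/derivable1_diffP; case: (is_derive_flat p (g u)).
have dg u : U u -> differentiable g u by exact: smooth_on_differentiable.
have df u : differentiable (flat p) (g u).
  by apply/derivable1_diffP; case: (is_derive_flat p (g u)).
apply: diff_uptoS => [u Uu|i]; first by apply: differentiable_comp => //; exact: dg.
apply: (@diff_upto_eq _ _ _ _ (fun u => (flat ('X ^+ 2 * (p - p^`())) \o g) u * partial i g u)) => //.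
  move=> u Uu; rewrite [RHS]partialE; last by apply: differentiable_comp => //; exact: dg.
  rewrite diff_comp //=; last exact: dg.
  rewrite -partialE; last exact: dg.
  rewrite -[partial i g u in RHS]mulr1 linearZ /= -deriveE //.
  by rewrite (@derive_val _ _ _ _ _ _ _ (is_derive_flat p (g u))) mulrC.
by apply: diff_uptoM => //; exact/smooth_diff_upto/smooth_on_partial.
Qed.

End Flat.

Section Bump.
Context {R : realType} {d : nat}.

Lemma flat1_gt0 (t : R) : 0 < t -> 0 < flat 1 t.
Proof. by move=> t0; rewrite /flat t0 hornerC mul1r expR_gt0. Qed.

Lemma flat1_ge0 (t : R) : 0 <= flat 1 t.
Proof. by rewrite /flat; case: ifP => // _; rewrite hornerC mul1r expR_ge0. Qed.

(** The quotient of values of [flat 1] goes from [1] to [0] as the rescaled squared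
    distance [g] goes from [1] to [2]; its denominator never vanishes because
    [2 - g] and [g - 1] are never both negative. *)
Lemma bump_exists (c : 'rV[R]_d) (e : R) : 0 < e ->
  exists b : 'rV[R]_d -> R,
    [/\ forall U, open U -> smooth_on U b, \forall u \near c, b u = 1 &
        forall u, b u != 0 -> `|u - c| <= e].
Proof.
move=> e0; pose a := 2 / e.
have a0 : 0 < a by rewrite divr_gt0.
pose g (u : 'rV[R]_d) : R := \sum_j (a * (u 0 j - c 0 j)) ^+ 2.
have g0 u : 0 <= g u by apply: sumr_ge0 => j _; exact: sqr_ge0.
pose den u := flat 1 (2 - g u) + flat 1 (g u - 1).
have den0 u : den u != 0.
  rewrite gt_eqF // /den; have [gu|gu] := ltP (g u) 2.
    by rewrite ltr_pwDl ?flat1_ge0 // flat1_gt0 // subr_gt0.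
  by rewrite ltr_wpDl ?flat1_ge0 // flat1_gt0 // subr_gt0 (lt_le_trans _ gu) // ltr1n.
have sg U : open U -> smooth_on U g.
  move=> oU; apply: smooth_on_sum => // j _.
  have sl : smooth_on U (fun u : 'rV[R]_d => a * (u 0 j + - c 0 j)).
    apply: smooth_onM => //; first exact: smooth_on_cst.
    apply: smooth_onD => //; [exact: smooth_on_coord|exact: smooth_on_cst].
  exact: (smooth_onM oU sl sl).
exists (fun u => flat 1 (2 - g u) * (den u)^-1); split.
- move=> U oU; have {}sg := sg U oU.
  have s1 : smooth_on U (fun u => flat 1 (2 - g u)).
    apply: (@smooth_on_flat _ _ _ 1 (fun u => 2 - g u)) => //.
    apply: smooth_onD => //; first exact: smooth_on_cst.
    have := smooth_onM oU (@smooth_on_cst _ _ U (-1)) sg.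
    by apply: smooth_on_eq => // u _; rewrite mulN1r.
  have s2 : smooth_on U (fun u => flat 1 (g u - 1)).
    apply: (@smooth_on_flat _ _ _ 1 (fun u => g u - 1)) => //.
    by apply: smooth_onD => //; exact: smooth_on_cst.
  apply: smooth_onM => //; apply: smooth_onV => //; exact: smooth_onD.
- have : \forall u \near c, g u < 1.
    have cg : {for c, continuous g}.
      by apply: differentiable_continuous; exact: (smooth_on_differentiable (sg _ openT)).
    have gc : g c = 0 by rewrite /g big1 // => j _; rewrite subrr mulr0 expr0n.
    apply: (cg [set t | t < 1]); rewrite gc /=.
    exact: lt_nbhsl.
  apply: filterS => u gu.
  have z : flat 1 (g u - 1) = 0 by rewrite /flat subr_gt0 ltNge (ltW gu).
  have := den0 u; rewrite /den z addr0 => H; exact: divff.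
- move=> u; rewrite mulf_eq0 negb_or => /andP[+ _].
  rewrite {1}/flat; case: ifP; rewrite ?eqxx // subr_gt0 => gu _.
  rewrite [leLHS]/Num.Def.normr/= mx_normrE; apply: bigmax_le => [|[i j] _ /=]; first exact: ltW.
  rewrite (ord1 i) !mxE.
  have : (a * (u 0 j - c 0 j)) ^+ 2 <= 2 ^+ 2.
    apply: (@le_trans _ _ (g u)).
      rewrite /g (bigD1 j) //= lerDl; apply: sumr_ge0 => k _; exact: sqr_ge0.
    by apply: ltW; apply: lt_trans gu _; rewrite expr2 -natrM ltr_nat.
  rewrite -real_normK ?num_real // ler_pXn2r ?nnegrE // normrM gtr0_norm // /a.
  rewrite mulrAC ler_pdivrMr // ler_pM2l //.
Qed.

End Bump.

(** * Smooth functions and tangent vectors on a manifold *)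

Section ManifoldFunctions.
Context {R : realType} {d : nat} {M : manifold R d}.
Implicit Types (k : chart_idx M) (W V : set M) (x : M) (f g : M -> R).

Definition chart_img k W : set 'rV[R]_d := chart k @` (chart_dom k `&` W).

Lemma chart_imgP k W u : chart_img k W u ->
  [/\ chart_dom k (chart_inv k u), W (chart_inv k u) & chart k (chart_inv k u) = u].
Proof. by move=> [x [kx Wx] <-]; rewrite chartK. Qed.

Lemma chart_img_in k W x : chart_dom k x -> W x -> chart_img k W (chart k x).
Proof. by move=> kx Wx; exists x. Qed.

Lemma chart_imgS k W V : W `<=` V -> chart_img k W `<=` chart_img k V.
Proof. by move=> WV u [x [kx /WV Vx] <-]; exists x. Qed.

Lemma open_chart_img k W : open W -> open (chart_img k W).
Proof.
move=> oW; rewrite openE => u [x [kx Wx] <-].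
have ku : (chart k @` chart_dom k) (chart k x) by exists x.
have c := @chart_inv_continuous _ _ M k _ ku.
have H1 : \forall v \near chart k x, (chart_dom k `&` W) (chart_inv k v).
  apply: c; rewrite chartK //; apply: filterI.
    by apply: open_nbhs_nbhs; split => //; exact: chart_dom_open.
  exact: open_nbhs_nbhs.
have H2 : \forall v \near chart k x, (chart k @` chart_dom k) v.
  by apply: open_nbhs_nbhs; split => //; exact: chart_img_open.
apply: filterS2 H1 H2 => v [h1 h2] [y ky yv].
by exists (chart_inv k v); [split|rewrite -yv chartK].
Qed.

Arguments open_chart_img k {W} _.

Lemma msmooth_onW W V f : W `<=` V -> msmooth_on V f -> msmooth_on W f.
Proof. by move=> WV sf k; apply: smooth_onW (sf k); exact: chart_imgS. Qed.

Lemma msmooth_on_eq W f g : open W -> (forall x, W x -> f x = g x) ->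
  msmooth_on W f -> msmooth_on W g.
Proof.
move=> oW fg sf k; apply: smooth_on_eq (sf k); first exact: open_chart_img.
by move=> u /chart_imgP[_ Wu _]; exact: fg.
Qed.

Lemma msmooth_on_cst W (c : R) : msmooth_on W (fun=> c).
Proof. by move=> k; exact: smooth_on_cst. Qed.

Lemma msmooth_onD W f g : open W -> msmooth_on W f -> msmooth_on W g ->
  msmooth_on W (fun x => f x + g x).
Proof. by move=> oW sf sg k; apply: smooth_onD (sf k) (sg k); exact: open_chart_img. Qed.

Lemma msmooth_onM W f g : open W -> msmooth_on W f -> msmooth_on W g ->
  msmooth_on W (fun x => f x * g x).
Proof. by move=> oW sf sg k; apply: smooth_onM (sf k) (sg k); exact: open_chart_img. Qed.

Lemma msmooth_on_local W f :
  (forall x, W x -> exists2 V, open V /\ V x & msmooth_on V f) -> msmooth_on W f.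
Proof.
move=> H k s u [x [kx Wx] <-]; have [V [oV Vx] sf] := H x Wx.
by apply: (sf k); exact: chart_img_in.
Qed.

(** Smoothness can be checked in one chart around each point, by the chain rule
    and the smoothness of the transition maps. *)
Lemma msmooth_on_chart W f k : open W -> W `<=` chart_dom k ->
  smooth_on (chart_img k W) (f \o chart_inv k) -> msmooth_on W f.
Proof.
move=> oW Wk sf k'.
have oO := open_chart_img k' oW.
apply: (@smooth_on_eq _ _ _ ((f \o chart_inv k) \o (chart k \o chart_inv k'))) => //.
  by move=> u /chart_imgP[_ Wu _] /=; rewrite chartK //; exact: Wk.
apply: (@smooth_on_comp _ _ _ _ (chart_img k W)) => //.
- exact: open_chart_img.
- by move=> u /chart_imgP[_ Wu _] /=; apply: chart_img_in => //; exact: Wk.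
- move=> j; apply: smooth_onW (@chart_compat _ _ M k' k j).
  exact: chart_imgS.
Qed.

Lemma msmooth_on_coord k j : msmooth_on (chart_dom k) (fun x => chart k x 0 j).
Proof.
apply: (@msmooth_on_chart _ _ k) => //; first exact: chart_dom_open.
have oU := open_chart_img k (@chart_dom_open _ _ M k).
apply: smooth_on_eq (smooth_on_coord j oU) => // u /chart_imgP[_ _ /= ->] //.
Qed.

(** The bump function of a chart, extended by zero. Its support is the image of a
    compact cube, hence closed because the manifold is Hausdorff; this makes the
    extension smooth. *)
Lemma mbump W x : open W -> W x ->
  exists chi : M -> R, [/\ msmooth chi, \forall y \near x, chi y = 1 &
    exists K, [/\ closed K, K `<=` W & forall y, chi y != 0 -> K y]].
Proof.
move=> oW Wx; pose k := chart_at x; pose u0 := chart k x.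
have kx : chart_dom k x := chart_atP x.
pose O := chart_img k W.
have oO : open O by exact: open_chart_img.
have Ou0 : O u0 by exact: chart_img_in.
have /nbhs_ballP[e0 /= e00 He0] := open_nbhs_nbhs (conj oO Ou0).
pose e := e0 / 2.
have e1 : 0 < e by rewrite divr_gt0.
have [b [sb b1 b0]] := bump_exists u0 e1.
pose B : set 'rV[R]_d := [set u | `|u - u0| <= e].
have BO : B `<=` O.
  move=> u; rewrite /B /= => ue; apply: He0; rewrite -ball_normE /= distrC.
  by rewrite (le_lt_trans ue) // /e ltr_pdivrMr // mulr_natr mulr2n ltrDl.
have cB : compact B.
  apply: bounded_closed_compact.
    exists (`|u0| + e); split; first exact: num_real.
    move=> y yb u /= ue; rewrite -(subrK u0 u) (le_trans (ler_normD _ _)) //.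
    by rewrite addrC (le_trans _ (ltW yb)) // lerD2l.
  rewrite /B (_ : [set u | _] = closed_ball_ Num.norm u0 e).
    exact: closed_closed_ball_.
  by apply/seteqP; split => u; rewrite /closed_ball_ /= distrC.
pose K := chart_inv k @` B.
have cK : compact K.
  apply: continuous_compact => //; apply: continuous_in_subspaceT => u.
  rewrite inE => /BO/chart_imgP[ku _ uE]; apply: chart_inv_continuous.
  by exists (chart_inv k u).
have clK : closed K by apply: compact_closed cK; exact: man_hausdorff.
have KW : K `<=` W by move=> y [u /BO/chart_imgP[_ Wu _] <-].
have Kk : K `<=` chart_dom k by move=> y [u /BO/chart_imgP[ku _ _] <-].
pose chi y := if `[< chart_dom k y >] then b (chart k y) else 0.
have chik y : chart_dom k y -> chi y = b (chart k y) by rewrite /chi; case: asboolP.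
have chiK y : chi y != 0 -> K y.
  rewrite /chi; case: asboolP => [ky /b0 be|]; last by rewrite eqxx.
  by exists (chart k y); rewrite ?chartK.
exists chi; split; last by exists K.
- apply: msmooth_on_local => y _; have [Ky|nKy] := pselect (K y).
    exists (chart_dom k); first by split; [exact: chart_dom_open|exact: Kk].
    apply: (@msmooth_on_chart _ _ k) => //; first exact: chart_dom_open.
    have oU := open_chart_img k (@chart_dom_open _ _ M k).
    apply: smooth_on_eq (sb _ oU) => // u /chart_imgP[ku _ uE] /=.
    by rewrite chik // uE.
  exists (~` K); first by split => //; exact: closed_openC.
  apply: msmooth_on_eq (@msmooth_on_cst _ 0); first exact: closed_openC.
  by move=> z nKz; apply/esym/eqP; apply: contrapT => /negP/chiK.
- have H1 : \forall y \near x, b (chart k y) = 1.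
    exact: (@chart_continuous _ _ M k x kx (fun u => b u = 1) b1).
  have H2 : \forall y \near x, chart_dom k y.
    by apply: open_nbhs_nbhs; split => //; exact: chart_dom_open.
  by apply: filterS2 H1 H2 => y yb ky; rewrite chik.
Qed.

(** Around a point of [K] both factors are smooth; around any other point the
    product vanishes. *)
Lemma msmooth_cutoff W (K : set M) (chi g : M -> R) : open W -> msmooth chi -> closed K ->
  K `<=` W -> (forall y, chi y != 0 -> K y) -> msmooth_on W g ->
  msmooth (fun y => chi y * g y).
Proof.
move=> oW sc cK KW chiK sg; apply: msmooth_on_local => y _.
have [Ky|nKy] := pselect (K y).
  exists W; first by split => //; exact: KW.
  by apply: msmooth_onM => //; exact: msmooth_onW sc.
exists (~` K); first by split => //; exact: closed_openC.
apply: msmooth_on_eq (@msmooth_on_cst _ 0); first exact: closed_openC.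
move=> z nKz; have -> : chi z = 0 by apply/eqP; apply: contrapT => /negP/chiK.
by rewrite mul0r.
Qed.

(** Brackets and forms are only defined on global sections, so every local datum
    enters them through a global function with the same germ. *)
Lemma msmooth_extend W x g : open W -> W x -> msmooth_on W g ->
  exists2 f, msmooth f & \forall y \near x, f y = g y.
Proof.
move=> oW Wx sg; have [chi [sc c1 [K [cK KW cK']]]] := mbump oW Wx.
exists (fun y => chi y * g y); first exact: (msmooth_cutoff oW sc cK KW cK' sg).
by apply: filterS c1 => y ->; rewrite mul1r.
Qed.

Lemma near_chart k x (P : set M) : chart_dom k x -> (\forall y \near x, P y) ->
  \forall u \near chart k x, P (chart_inv k u).
Proof.
move=> kx Px.
have ku : (chart k @` chart_dom k) (chart k x) by exists x.
by apply: (@chart_inv_continuous _ _ M k _ ku); rewrite chartK.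
Qed.

Lemma msmooth_on_differentiable W f k x : chart_dom k x -> W x -> msmooth_on W f ->
  differentiable (f \o chart_inv k) (chart k x).
Proof.
by move=> kx Wx sf; apply: (smooth_on_differentiable (sf k)); exact: chart_img_in.
Qed.

End ManifoldFunctions.

Arguments open_chart_img {R d M} k {W} _.

Section Tangent.
Context {R : realType} {d : nat} {M : manifold R d}.
Implicit Types (k : chart_idx M) (x : M).

Lemma transition_differentiable k l x j : chart_dom k x -> chart_dom l x ->
  differentiable (fun u => chart l (chart_inv k u) 0 j) (chart k x).
Proof.
move=> kx lx; apply: (smooth_on_differentiable (@chart_compat _ _ M k l j)).
by exists x.
Qed.

Lemma tcoord_is_linear k x : linear (@tcoord R d M k x).
Proof.
move=> c v w; apply/rowP => j; rewrite !mxE mulr_sumr -big_split /=.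
by apply: eq_bigr => i _; rewrite !mxE mulrDl mulrA.
Qed.

HB.instance Definition _ k x := GRing.isLinear.Build R (@tangent R d M x) 'rV[R]_d
  *:%R (@tcoord R d M k x) (@tcoord_is_linear k x).

(** By the chain rule, a tangent vector may be differentiated along in any chart
    around its base point, with its components in that chart. *)
Lemma tderivE k x (v : tangent x) (f : M -> R) :
  chart_dom k x -> differentiable (f \o chart_inv k) (chart k x) ->
  tderiv v f = \sum_j tcoord k v 0 j * partial j (f \o chart_inv k) (chart k x).
Proof.
move=> kx df; pose k0 := chart_at x; have k0x : chart_dom k0 x := chart_atP x.
rewrite /tderiv -/k0.
have E i : partial i (f \o chart_inv k0) (chart k0 x) =
    \sum_j partial i (fun u => chart k (chart_inv k0 u) 0 j) (chart k0 x)
      * partial j (f \o chart_inv k) (chart k x).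
  have := @partial_comp _ _ _ (f \o chart_inv k) (chart k \o chart_inv k0) i (chart k0 x).
  rewrite /= chartK // => <- //; last by move=> j; exact: transition_differentiable.
  apply: partial_near.
  have : \forall y \near x, chart_dom k y.
    by apply: open_nbhs_nbhs; split => //; exact: chart_dom_open.
  by move/(near_chart k0x); apply: filterS => u ku /=; rewrite chartK.
under eq_bigr => i _ do rewrite E mulr_sumr.
rewrite exchange_big /=; apply: eq_bigr => j _.
by rewrite mxE mulr_suml; apply: eq_bigr => i _; rewrite mulrA.
Qed.

(** Both sides are recovered from the derivatives of the coordinate functions of
    the chart that represents tangent vectors at [x]. *)
Lemma tcoordK k x (v : tangent x) : chart_dom k x ->
  v = \sum_i tcoord k v 0 i *: dcoord k i x.
Proof.
move=> kx; apply/rowP => j; pose k0 := chart_at x.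
have k0x : chart_dom k0 x := chart_atP x.
rewrite summxE.
have pE i : partial i (fun u => chart k0 (chart_inv k0 u) 0 j) (chart k0 x) = (i == j)%:R.
  rewrite -(partial_coord i j (chart k0 x)); apply: partial_near.
  have : (chart_img k0 setT) (chart k0 x) by exact: chart_img_in.
  move=> /(conj (open_chart_img k0 openT))/open_nbhs_nbhs.
  by apply: filterS => u /chart_imgP[_ _ /= ->].
have -> : v 0 j = tderiv v (fun y => chart k0 y 0 j).
  rewrite /tderiv (bigD1 j) //= [X in _ + X]big1 ?addr0.
    by rewrite [partial _ _ _]pE eqxx mulr1.
  by move=> i ij; rewrite [partial _ _ _]pE (negbTE ij) mulr0.
rewrite (tderivE (k := k)) //; last exact: transition_differentiable.
by apply: eq_bigr => i _; rewrite !mxE.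
Qed.

End Tangent.

(** * Sections of a vector bundle and locality of the bracket *)

Section Sections.
Context {R : realType} {d : nat} {M : manifold R d} {r : nat} {E : vbundle M r}.
Implicit Types (s t w : section_of E) (f : M -> R) (x : M) (l : frame_idx E).

Lemma msmooth_onT W f : msmooth f -> msmooth_on W f.
Proof. exact: msmooth_onW. Qed.

Lemma fcoord0 l a x : fcoord l a x (0 : E x) = 0.
Proof. exact: linear0. Qed.

Lemma ssmooth0 : ssmooth (fun x => 0 : E x).
Proof.
move=> k a; apply: msmooth_on_eq (@msmooth_on_cst _ _ _ _ 0) => [|x _].
  exact: frame_dom_open.
by rewrite fcoord0.
Qed.

Lemma ssmooth_scale f s : msmooth f -> ssmooth s -> ssmooth (fun x => f x *: s x).
Proof.
move=> sf ss k a; have oW := @frame_dom_open _ _ _ _ E k.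
apply: msmooth_on_eq (msmooth_onM oW (msmooth_onT sf) (ss k a)) => // x _.
by rewrite linearZ.
Qed.

Lemma ssmooth_lin (c : R) s t : ssmooth s -> ssmooth t ->
  ssmooth (fun x => c *: s x + t x).
Proof.
move=> ss st k a; have oW := @frame_dom_open _ _ _ _ E k.
have sc := msmooth_onM oW (@msmooth_on_cst _ _ _ _ c) (ss k a).
apply: msmooth_on_eq (msmooth_onD oW sc (st k a)) => // x _.
by rewrite linearP.
Qed.

Lemma ssmooth_sum (I : Type) (v : seq I) (t : I -> section_of E) :
  (forall b, ssmooth (t b)) -> ssmooth (fun x => \sum_(b <- v) t b x).
Proof.
move=> st; elim: v => [|b v IH].
  rewrite (_ : (fun x => _) = (fun x => 0 : E x)); first exact: ssmooth0.
  by apply: functional_extensionality_dep => x; rewrite big_nil.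
rewrite (_ : (fun x => _) = (fun x => 1 *: t b x + \sum_(b' <- v) t b' x)).
  exact: ssmooth_lin.
by apply: functional_extensionality_dep => x; rewrite big_cons scale1r.
Qed.

Lemma frame_extend l a x : frame_dom l x ->
  exists2 s, ssmooth s & \forall y \near x, s y = frame l a y.
Proof.
move=> lx; have oW := @frame_dom_open _ _ _ _ E l.
have [chi [sc c1 [K [cK KW chiK]]]] := mbump oW lx.
exists (fun y => chi y *: frame l a y); last first.
  by apply: filterS c1 => y ->; rewrite scale1r.
move=> k b; have oW' := @frame_dom_open _ _ _ _ E k.
apply: msmooth_on_local => y ky; have [Ky|nKy] := pselect (K y).
  have o2 : open (frame_dom l `&` frame_dom k) by exact: openI.
  exists (frame_dom l `&` frame_dom k); first by split => //; split => //; exact: KW.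
  have := msmooth_onM o2 (msmooth_onT sc) (@frame_compat _ _ _ _ E l k a b).
  by apply: msmooth_on_eq => // z _; rewrite linearZ.
have o2 : open (~` K `&` frame_dom k) by apply: openI => //; exact: closed_openC.
exists (~` K `&` frame_dom k) => //.
apply: msmooth_on_eq (@msmooth_on_cst _ _ _ _ 0) => // z [nKz _].
have -> : chi z = 0 by apply/eqP; apply: contrapT => /negP/chiK.
by rewrite scale0r fcoord0.
Qed.

(** Global functions and global sections are substituted for the coordinates and
    for the frame, germ by germ. *)
Lemma section_extend l x (g : 'I_r -> M -> R) : frame_dom l x ->
  (forall a, msmooth_on (frame_dom l) (g a)) ->
  exists2 s, ssmooth s & \forall y \near x, s y = \sum_a g a y *: frame l a y.
Proof.
move=> lx sg; have oW := @frame_dom_open _ _ _ _ E l.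
have /choice[F HF] : forall a, exists F : (M -> R) * section_of E,
    [/\ msmooth F.1, ssmooth F.2, \forall y \near x, F.1 y = g a y &
      \forall y \near x, F.2 y = frame l a y].
  move=> a; have [f sf fg] := msmooth_extend oW lx (sg a).
  by have [s ss se] := frame_extend a lx; exists (f, s).
exists (fun y => \sum_a (F a).1 y *: (F a).2 y).
  apply: ssmooth_sum => a; have [? ? _ _] := HF a; exact: ssmooth_scale.
have H a : \forall y \near x, (F a).1 y *: (F a).2 y = g a y *: frame l a y.
  by have [_ _ h1 h2] := HF a; apply: filterS2 h1 h2 => y -> ->.
have : \forall y \near x, forall a, (F a).1 y *: (F a).2 y = g a y *: frame l a y.
  exact: filter_forall.
apply: filterS => y Hy.
by apply: eq_bigr => a _; exact: Hy.
Qed.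

Lemma near_frame_sum l s x : frame_dom l x ->
  \forall y \near x, s y = \sum_a fcoord l a y (s y) *: frame l a y.
Proof.
move=> lx; have := open_nbhs_nbhs (conj (@frame_dom_open _ _ _ _ E l) lx).
by apply: filterS => y; exact: fcoordK.
Qed.

Lemma tderivD x (v w : tangent x) f : tderiv (v + w) f = tderiv v f + tderiv w f.
Proof. by rewrite /tderiv -big_split; apply: eq_bigr => i _; rewrite mxE mulrDl. Qed.

Section Bracket.
Variables (rho : forall x : M, {linear E x -> tangent x}).
Variables (br : section_of E -> section_of E -> section_of E).
Hypothesis brP : is_bracket rho br.

Lemma br0r s x : ssmooth s -> br s (fun y => 0 : E y) x = 0.
Proof.
move=> ss; have := @br_linear_r _ _ _ _ _ _ _ brP (-1) s _ _ ss ssmooth0 ssmooth0 x.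
rewrite scaleN1r addNr => <-; congr (br _ _ x).
by apply: functional_extensionality_dep => y; rewrite scaler0 addr0.
Qed.

(** Locality: a section vanishing near [x] is a function vanishing at [x]
    times itself, so the Leibniz rule kills its bracket. *)
Lemma br_local_r s t t' x : ssmooth s -> ssmooth t -> ssmooth t' ->
  (\forall y \near x, t y = t' y) -> br s t x = br s t' x.
Proof.
move=> ss st st' tt'; pose w : section_of E := fun y => -1 *: t' y + t y.
have sw : ssmooth w by exact: ssmooth_lin.
suff : br s w x = 0.
  rewrite (br_linear_r brP (-1)) // scaleN1r => /eqP.
  by rewrite addrC subr_eq0 => /eqP.
have [W [oW Wx] W0] : exists2 W : set M, open W /\ W x & forall y, W y -> w y = 0.
  exists ((fun y => t y = t' y)°).
    by split; [exact: open_interior|exact: tt'].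
  by move=> y /interior_subset; rewrite /w scaleN1r => ->; rewrite addNr.
have [chi [sc c1 [K [cK KW chiK]]]] := mbump oW Wx.
pose f y := 1 + -1 * chi y.
have sf : msmooth f.
  apply: msmooth_onD; [exact: openT|exact: msmooth_on_cst|].
  apply: msmooth_onM => //; [exact: openT|exact: msmooth_on_cst].
have -> : br s w x = br s (fun y => f y *: w y) x.
  congr (br _ _ x); apply: functional_extensionality_dep => y.
  have [Wy|nWy] := pselect (W y); first by rewrite (W0 y Wy) scaler0.
  have cy : chi y = 0 by apply/eqP; apply: contrapT => /negP/chiK/KW.
  by rewrite /f cy mulr0 addr0 scale1r.
rewrite (br_leibniz brP) // (W0 x Wx) scaler0 addr0.
by rewrite /f (nbhs_singleton c1) mulr1 subrr scale0r.
Qed.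

Lemma br_local_l s s' t x : ssmooth s -> ssmooth s' -> ssmooth t ->
  (\forall y \near x, s y = s' y) -> br s t x = br s' t x.
Proof.
move=> ss ss' st h; rewrite (br_skew brP) // [RHS](br_skew brP) //.
by congr (- _); exact: br_local_r.
Qed.

Lemma br_sum_r (I : Type) (v : seq I) (g : I -> M -> R) (t : I -> section_of E) s x :
  (forall b, msmooth (g b)) -> (forall b, ssmooth (t b)) -> ssmooth s ->
  br s (fun y => \sum_(b <- v) g b y *: t b y) x =
  \sum_(b <- v) (g b x *: br s (t b) x + tderiv (rho x (s x)) (g b) *: t b x).
Proof.
move=> sg st ss; elim: v => [|b v IH].
  rewrite big_nil -[RHS](br0r x ss); congr (br _ _ x).
  by apply: functional_extensionality_dep => y; rewrite big_nil.
rewrite big_cons -IH -(br_leibniz brP) // -[X in X + _]scale1r -(br_linear_r brP) //.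
- congr (br _ _ x); apply: functional_extensionality_dep => y.
  by rewrite big_cons scale1r.
- exact: ssmooth_scale.
- by apply: ssmooth_sum => b'; exact: ssmooth_scale.
Qed.

(** The Leibniz rule in the first argument follows by skew-symmetry, which changes
    the sign of the anchor term. *)
Lemma br_sum_l (I : Type) (v : seq I) (g : I -> M -> R) (t : I -> section_of E) s x :
  (forall b, msmooth (g b)) -> (forall b, ssmooth (t b)) -> ssmooth s ->
  br (fun y => \sum_(b <- v) g b y *: t b y) s x =
  \sum_(b <- v) (g b x *: br (t b) s x - tderiv (rho x (s x)) (g b) *: t b x).
Proof.
move=> sg st ss; rewrite (br_skew brP) //; last first.
  by apply: ssmooth_sum => b; exact: ssmooth_scale.
rewrite br_sum_r // -sumrN; apply: eq_bigr => b _.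
by rewrite opprD (br_skew brP (s := t b)) // scalerN.
Qed.

(** The defining set of [local_bracket] has one element, by locality. *)
Lemma local_bracketE s t s' t' x : ssmooth s' -> ssmooth t' ->
  (\forall y \near x, s' y = s y) -> (\forall y \near x, t' y = t y) ->
  local_bracket br s t x = br s' t' x.
Proof.
move=> ss' st' hs ht; rewrite /local_bracket.
case: xgetP => [w -> [s2 [t2 [ss2 st2 hs2 ht2 ->]]]|]; last first.
  by move=> /(_ (br s' t' x)) []; exists s', t'.
rewrite (br_local_l (s' := s') ) //; last by apply: filterS2 hs hs2 => y -> ->.
by apply: br_local_r => //; apply: filterS2 ht ht2 => y -> ->.
Qed.

End Bracket.
End Sections.

(** * The Jacobiator in local coordinates *)

Section Pointwise.
Context {R : realType} {d r : nat}.
Implicit Types (rho : 'I_d -> 'I_r -> R) (C : 'I_r -> 'I_r -> 'I_r -> R).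
Implicit Types (v w : 'rV[R]_r) (z : 'rV[R]_d).

Definition anchor rho v : 'rV[R]_d := \row_i \sum_a v 0 a * rho i a.

Definition cbr C v w : 'rV[R]_r := \row_c \sum_a \sum_b v 0 a * w 0 b * C a b c.

Definition along_rho (drho : 'I_d -> 'I_d -> 'I_r -> R) z i a : R :=
  \sum_j z 0 j * drho j i a.

Definition along_C (dC : 'I_d -> 'I_r -> 'I_r -> 'I_r -> R) z a b c : R :=
  \sum_j z 0 j * dC j a b c.

Lemma anchorD rho v w : anchor rho (v + w) = anchor rho v + anchor rho w.
Proof.
apply/rowP => i; rewrite !mxE -big_split; apply: eq_bigr => a _.
by rewrite mxE mulrDl.
Qed.

Lemma anchorZ rho (k : R) v : anchor rho (k *: v) = k *: anchor rho v.
Proof.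
apply/rowP => i; rewrite !mxE mulr_sumr; apply: eq_bigr => a _.
by rewrite mxE mulrA.
Qed.

Lemma anchorN rho v : anchor rho (- v) = - anchor rho v.
Proof. by rewrite -scaleN1r anchorZ scaleN1r. Qed.

Lemma cbrDl C v v' w : cbr C (v + v') w = cbr C v w + cbr C v' w.
Proof.
apply/rowP => c; rewrite !mxE -big_split; apply: eq_bigr => a _ /=.
by rewrite -big_split; apply: eq_bigr => b _; rewrite mxE !mulrDl.
Qed.

Lemma cbrDr C v w w' : cbr C v (w + w') = cbr C v w + cbr C v w'.
Proof.
apply/rowP => c; rewrite !mxE -big_split; apply: eq_bigr => a _ /=.
by rewrite -big_split; apply: eq_bigr => b _; rewrite mxE mulrDr mulrDl.
Qed.

Lemma cbrZl C (k : R) v w : cbr C (k *: v) w = k *: cbr C v w.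
Proof.
apply/rowP => c; rewrite !mxE mulr_sumr; apply: eq_bigr => a _ /=.
by rewrite mulr_sumr; apply: eq_bigr => b _; rewrite mxE -!mulrA.
Qed.

Lemma cbrZr C (k : R) v w : cbr C v (k *: w) = k *: cbr C v w.
Proof.
apply/rowP => c; rewrite !mxE mulr_sumr; apply: eq_bigr => a _ /=.
by rewrite mulr_sumr; apply: eq_bigr => b _; rewrite mxE mulrCA -!mulrA.
Qed.

Lemma cbrNr C v w : cbr C v (- w) = - cbr C v w.
Proof. by rewrite -scaleN1r cbrZr scaleN1r. Qed.

Lemma cbrNl C v w : cbr C (- v) w = - cbr C v w.
Proof. by rewrite -scaleN1r cbrZl scaleN1r. Qed.

Lemma cbr_skew C v w : (forall a b c, C a b c = - C b a c) ->
  cbr C v w = - cbr C w v.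
Proof.
move=> sC; apply/rowP => c; rewrite !mxE exchange_big -sumrN; apply: eq_bigr => a _.
rewrite -sumrN; apply: eq_bigr => b _.
by rewrite [in LHS]sC mulrN [w 0 a * _]mulrC.
Qed.

(** The failure of the anchor to be a morphism of brackets, and (below) the
    Jacobiator of sections with constant coordinates, at one point. The arrays
    [drho] and [dC] stand for the partial derivatives of the structure
    functions; keeping them independent makes the algebra pointwise. *)
Definition anchor_defect rho drho C v w : 'rV[R]_d :=
  anchor (along_rho drho (anchor rho v)) w - anchor (along_rho drho (anchor rho w)) v
  - anchor rho (cbr C v w).

Definition jacobi_term rho C dC v1 v2 v3 : 'rV[R]_r :=
  cbr C v1 (cbr C v2 v3) + cbr (along_C dC (anchor rho v1)) v2 v3.

Definition jacobi_defect rho C dC v1 v2 v3 : 'rV[R]_r :=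
  jacobi_term rho C dC v1 v2 v3 + jacobi_term rho C dC v2 v3 v1
  + jacobi_term rho C dC v3 v1 v2.

Lemma anchorE rho v i : anchor rho v 0 i = \sum_a v 0 a * rho i a.
Proof. exact: mxE. Qed.

Lemma cbrE C v w c : cbr C v w 0 c = \sum_a \sum_b v 0 a * w 0 b * C a b c.
Proof. exact: mxE. Qed.

Lemma rowDE v w c : (v + w) 0 c = v 0 c + w 0 c. Proof. exact: mxE. Qed.

Lemma rowNE v c : (- v) 0 c = - v 0 c. Proof. exact: mxE. Qed.

End Pointwise.

Section Directional.
Context {R : realType} {d : nat}.
Implicit Types (z : 'rV[R]_d) (f g : 'rV[R]_d -> R).

Definition dird z f (u : 'rV[R]_d) : R := \sum_i z 0 i * partial i f u.

Lemma dirdDz z z' f u : dird (z + z') f u = dird z f u + dird z' f u.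
Proof. by rewrite /dird -big_split; apply: eq_bigr => i _; rewrite mxE mulrDl. Qed.

Lemma dirdNz z f u : dird (- z) f u = - dird z f u.
Proof. by rewrite /dird -sumrN; apply: eq_bigr => i _; rewrite mxE mulNr. Qed.

Lemma dird_near z f g u : (\forall v \near u, f v = g v) -> dird z f u = dird z g u.
Proof. by move=> fg; apply: eq_bigr => i _; rewrite (partial_near i fg). Qed.

Lemma dird_eq z f g u : (forall v, f v = g v) -> dird z f u = dird z g u.
Proof. by move=> /funext ->. Qed.

Lemma differentiable_eq f g u : (forall v, f v = g v) ->
  differentiable f u -> differentiable g u.
Proof. by move=> /funext->. Qed.

Lemma dird_cst z (c : R) u : dird z (fun=> c) u = 0.
Proof. by rewrite /dird big1 // => i _; rewrite partial_cst mulr0. Qed.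

Lemma dirdD z f g u : differentiable f u -> differentiable g u ->
  dird z (fun v => f v + g v) u = dird z f u + dird z g u.
Proof.
move=> df dg; rewrite /dird -big_split; apply: eq_bigr => i _ /=.
by rewrite partialD // mulrDr.
Qed.

Lemma dirdM z f g u : differentiable f u -> differentiable g u ->
  dird z (fun v => f v * g v) u = dird z f u * g u + f u * dird z g u.
Proof.
move=> df dg; rewrite /dird mulr_suml mulr_sumr -big_split; apply: eq_bigr => i _ /=.
by rewrite partialM // mulrDr mulrA mulrCA.
Qed.

Lemma dirdN z f u : differentiable f u -> dird z (fun v => - f v) u = - dird z f u.
Proof.
move=> df; have -> : (fun v => - f v) = (fun v => -1 * f v).
  by apply/funext => v; rewrite mulN1r.
rewrite dirdM ?dird_cst ?mul0r ?add0r ?mulN1r //.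
Qed.

Lemma dird_sum z (I : Type) (s : seq I) (f : I -> 'rV[R]_d -> R) u :
  (forall k, differentiable (f k) u) ->
  dird z (fun v => \sum_(k <- s) f k v) u = \sum_(k <- s) dird z (f k) u.
Proof.
move=> df; rewrite /dird exchange_big; apply: eq_bigr => i _ /=.
by rewrite partial_sum // mulr_sumr.
Qed.

End Directional.

(** Turns matrix entries into variables, so that [ring] does not compare their
    bodies, which involve derivatives. *)
Ltac generalize_entries :=
  repeat match goal with
  | |- context [fun_of_matrix ?A ?i ?j] => generalize (fun_of_matrix A i j); intro
  end.

Section LocalJacobi.
Context {R : realType} {d r : nat}.
Variables (U : set 'rV[R]_d) (rho : 'I_d -> 'I_r -> 'rV[R]_d -> R).
Variables (C : 'I_r -> 'I_r -> 'I_r -> 'rV[R]_d -> R).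
Hypothesis oU : open U.
Hypothesis rho_smooth : forall i a, smooth_on U (rho i a).
Hypothesis C_smooth : forall a b c, smooth_on U (C a b c).
Hypothesis C_skew : forall a b c u, U u -> C a b c u = - C b a c u.
Implicit Types (S T W : 'rV[R]_d -> 'rV[R]_r) (u : 'rV[R]_d) (z : 'rV[R]_d).
Local Opaque anchor cbr.

Definition vsmooth S := forall a, smooth_on U (fun u => S u 0 a).

Definition rho_at u i a := rho i a u.
Definition drho_at u j i a := partial j (rho i a) u.
Definition C_at u a b c := C a b c u.
Definition dC_at u j a b c := partial j (C a b c) u.

Definition vdird z S u : 'rV[R]_r := \row_a dird z (fun u' => S u' 0 a) u.

(** The bracket of an anchored bundle in a local frame, as forced by the Leibniz
    rule: structure functions plus the anchors acting on the coordinates. *)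
Definition lbr S T u : 'rV[R]_r :=
  cbr (C_at u) (S u) (T u) + vdird (anchor (rho_at u) (S u)) T u
  - vdird (anchor (rho_at u) (T u)) S u.

Lemma vdirdE z S u a : vdird z S u 0 a = dird z (fun u' => S u' 0 a) u.
Proof. exact: mxE. Qed.

Lemma vdirdDz z z' S u : vdird (z + z') S u = vdird z S u + vdird z' S u.
Proof. by apply/rowP => a; rewrite !mxE dirdDz. Qed.

Lemma vdirdNz z S u : vdird (- z) S u = - vdird z S u.
Proof. by apply/rowP => a; rewrite !mxE dirdNz. Qed.

Let smd f u : smooth_on U f -> U u -> differentiable f u.
Proof. exact: smooth_on_differentiable. Qed.

Lemma dird_cbr z T W c u : vsmooth T -> vsmooth W -> U u ->
  dird z (fun u' => cbr (C_at u') (T u') (W u') 0 c) u =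
  (cbr (along_C (dC_at u) z) (T u) (W u) + cbr (C_at u) (vdird z T u) (W u)
   + cbr (C_at u) (T u) (vdird z W u)) 0 c.
Proof.
move=> sT sW Uu.
have dT a : differentiable (fun u' => T u' 0 a) u by apply: smd.
have dW a : differentiable (fun u' => W u' 0 a) u by apply: smd.
have dC a b : differentiable (C a b c) u by apply: smd.
have dTW a b : differentiable (fun u' => T u' 0 a * W u' 0 b) u.
  exact: (differentiableM (dT a) (dW b)).
have dTWC a b : differentiable (fun u' => T u' 0 a * W u' 0 b * C a b c u') u.
  exact: (differentiableM (dTW a b) (dC a b)).
rewrite (@dird_eq _ _ _ _ (fun u' => \sum_a \sum_b T u' 0 a * W u' 0 b * C a b c u')); last first.
  by move=> v; rewrite cbrE.
rewrite dird_sum; last by move=> a; apply: differentiable_bigsum.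
rewrite !rowDE !cbrE -!big_split; apply: eq_bigr => a _ /=.
rewrite dird_sum // -!big_split; apply: eq_bigr => b _ /=.
rewrite dirdM // dirdM // !vdirdE.
have -> : along_C (dC_at u) z a b c = dird z (C a b c) u by [].
rewrite /C_at; move: (dird _ _ _) (dird _ _ _) (dird _ _ _) => x1 x2 x3; ring.
Qed.

(** The second derivative of [f] along [z] and [z'], with constant coefficients. *)
Definition hess z z' (f : 'rV[R]_d -> R) u : R :=
  \sum_i \sum_j z 0 j * z' 0 i * partial j (partial i f) u.

Definition vhess z z' S u : 'rV[R]_r := \row_c hess z z' (fun u' => S u' 0 c) u.

Lemma vhessC z z' S u : vsmooth S -> U u -> vhess z z' S u = vhess z' z S u.
Proof.
move=> sS Uu; apply/rowP => c; rewrite !mxE /hess exchange_big; apply: eq_bigr => i _.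
by apply: eq_bigr => j _; rewrite [z 0 i * _]mulrC (partialC i j oU Uu (sS c)).
Qed.

(** Differentiating the derivative along an anchored section: the coefficients are
    differentiated once, and a symmetric second-order term is left over. *)
Lemma dird_dird z T f u : vsmooth T -> smooth_on U f -> U u ->
  dird z (fun u' => dird (anchor (rho_at u') (T u')) f u') u =
  dird (anchor (along_rho (drho_at u) z) (T u) + anchor (rho_at u) (vdird z T u)) f u
  + hess z (anchor (rho_at u) (T u)) f u.
Proof.
move=> sT sf Uu.
have dT a : differentiable (fun u' => T u' 0 a) u by apply: smd.
have dr i a : differentiable (rho i a) u by apply: smd.
have df i : differentiable (partial i f) u by apply: smd => //; exact: smooth_on_partial.
have dTr i a : differentiable (fun u' => T u' 0 a * rho i a u') u.
  exact: (differentiableM (dT a) (dr i a)).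
have dA i : differentiable (fun u' => \sum_a T u' 0 a * rho i a u') u.
  exact: differentiable_bigsum.
rewrite (@dird_eq _ _ _ _ (fun u' => \sum_i (\sum_a T u' 0 a * rho i a u') * partial i f u')); last first.
  by move=> v; apply: eq_bigr => i _; rewrite anchorE.
rewrite dird_sum; last by move=> i; exact: (differentiableM (dA i) (df i)).
rewrite {2}/dird /hess -big_split; apply: eq_bigr => i _ /=.
rewrite dirdM //; congr (_ * _ + _).
  rewrite dird_sum // rowDE !anchorE -big_split; apply: eq_bigr => a _ /=.
  by rewrite dirdM // vdirdE addrC.
rewrite /dird mulr_sumr; apply: eq_bigr => j _.
by rewrite anchorE mulrA [_ * z 0 j]mulrC.
Qed.

Lemma vsmooth_dird_differentiable T f u : vsmooth T -> smooth_on U f -> U u ->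
  differentiable (fun u' => dird (anchor (rho_at u') (T u')) f u') u.
Proof.
move=> sT sf Uu.
have dT a : differentiable (fun u' => T u' 0 a) u by apply: smd.
have dr i a : differentiable (rho i a) u by apply: smd.
have df i : differentiable (partial i f) u by apply: smd => //; exact: smooth_on_partial.
have dTr i a : differentiable (fun u' => T u' 0 a * rho i a u') u.
  exact: (differentiableM (dT a) (dr i a)).
have dA i : differentiable (fun u' => \sum_a T u' 0 a * rho i a u') u.
  exact: differentiable_bigsum.
have : differentiable (fun u' => \sum_i (\sum_a T u' 0 a * rho i a u') * partial i f u') u.
  by apply: differentiable_bigsum => i _; exact: (differentiableM (dA i) (df i)).
apply: differentiable_eq; move=> v.
by apply: eq_bigr => i _; rewrite anchorE.
Qed.

Local Opaque vdird vhess dird.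

Lemma vdird_lbr z T W u : vsmooth T -> vsmooth W -> U u ->
  vdird z (lbr T W) u =
  cbr (along_C (dC_at u) z) (T u) (W u) + cbr (C_at u) (vdird z T u) (W u)
  + cbr (C_at u) (T u) (vdird z W u)
  + vdird (anchor (along_rho (drho_at u) z) (T u) + anchor (rho_at u) (vdird z T u)) W u
  - vdird (anchor (along_rho (drho_at u) z) (W u) + anchor (rho_at u) (vdird z W u)) T u
  + (vhess z (anchor (rho_at u) (T u)) W u - vhess z (anchor (rho_at u) (W u)) T u).
Proof.
move=> sT sW Uu; apply/rowP => c; rewrite vdirdE.
rewrite (@dird_eq _ _ _ _ (fun u' => cbr (C_at u') (T u') (W u') 0 c +
   (dird (anchor (rho_at u') (T u')) (fun u' => W u' 0 c) u'
   + - dird (anchor (rho_at u') (W u')) (fun u' => T u' 0 c) u'))); last first.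
  by move=> v; rewrite /lbr !rowDE rowNE !vdirdE addrA.
have d1 := vsmooth_dird_differentiable sT (sW c) Uu.
have d2 := vsmooth_dird_differentiable sW (sT c) Uu.
have d2N : differentiable (fun u' => - dird (anchor (rho_at u') (W u')) (fun u' => T u' 0 c) u') u.
  exact: differentiableN.
have d3 : differentiable (fun u' => cbr (C_at u') (T u') (W u') 0 c) u.
  have : differentiable (fun u' => \sum_a \sum_b T u' 0 a * W u' 0 b * C a b c u') u.
    apply: differentiable_bigsum => a _; apply: differentiable_bigsum => b _.
    apply: (@differentiableM _ _ (fun u' => T u' 0 a * W u' 0 b)); last exact: smd.
    by apply: (@differentiableM _ _ (fun u' => T u' 0 a)); exact: smd.
  by apply: differentiable_eq; move=> v; rewrite cbrE.
have d12 := differentiableD d1 d2N.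
rewrite dirdD // dirdD // dirdN // dird_cbr // !dird_dird //.
have HE z1 z2 S : vhess z1 z2 S u 0 c = hess z1 z2 (fun u' => S u' 0 c) u.
  exact: mxE.
rewrite -!vdirdE -!HE !(rowDE, rowNE).
by generalize_entries; ring.
Qed.

(** The second derivatives of the coordinates cancel by symmetry, which leaves the Jacobiator of constant
    sections and the anchor defects acting on the coordinates. *)
Lemma lbr_jacobi S T W u : vsmooth S -> vsmooth T -> vsmooth W -> U u ->
  lbr S (lbr T W) u + lbr T (lbr W S) u + lbr W (lbr S T) u =
  jacobi_defect (rho_at u) (C_at u) (dC_at u) (S u) (T u) (W u)
  + vdird (anchor_defect (rho_at u) (drho_at u) (C_at u) (S u) (T u)) W u
  + vdird (anchor_defect (rho_at u) (drho_at u) (C_at u) (T u) (W u)) S u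
  + vdird (anchor_defect (rho_at u) (drho_at u) (C_at u) (W u) (S u)) T u.
Proof.
move=> sS sT sW Uu; rewrite {1 3 5}/lbr !vdird_lbr //.
rewrite {1 2 3}/lbr {1 2 3}/lbr /jacobi_defect /jacobi_term /anchor_defect.
have sk v w : cbr (C_at u) v w = - cbr (C_at u) w v.
  by apply: cbr_skew => a b c; exact: C_skew.
rewrite (vhessC (anchor (rho_at u) (T u)) (anchor (rho_at u) (S u)) sW Uu).
rewrite (vhessC (anchor (rho_at u) (W u)) (anchor (rho_at u) (T u)) sS Uu).
rewrite (vhessC (anchor (rho_at u) (S u)) (anchor (rho_at u) (W u)) sT Uu).
generalize (vdird (anchor (rho_at u) (S u)) T u) (vdird (anchor (rho_at u) (S u)) W u)
  (vdird (anchor (rho_at u) (T u)) S u) (vdird (anchor (rho_at u) (T u)) W u)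
  (vdird (anchor (rho_at u) (W u)) S u) (vdird (anchor (rho_at u) (W u)) T u).
move=> DST DSW DTS DTW DWS DWT.
rewrite !anchorD !anchorN !cbrDr !cbrNr.
rewrite (sk DST (W u)) (sk DTW (S u)) (sk DWS (T u)).
repeat match goal with
  | |- context [anchor ?A ?v] => generalize (anchor A v); intro
  end.
rewrite !vdirdDz !vdirdNz.
apply/rowP => c; rewrite !(rowDE, rowNE).
by generalize_entries; ring.
Qed.

End LocalJacobi.

(** * Alternating forms on lists of vectors *)

Section Deletion.
Context {T : Type}.
Implicit Types (s : seq T) (i j m : nat).

(** Lists without one entry encode the arguments of a form with one slot omitted. *)
Definition del i s := take i s ++ drop i.+1 s.

Lemma size_del i s : (i < size s)%N -> size (del i s) = (size s).-1.
Proof. by move=> h; rewrite size_cat size_drop size_takel ?(ltnW h) //; lia. Qed.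

Lemma nth_del x0 i s m : (i <= size s)%N -> nth x0 (del i s) m = nth x0 s (bump i m).
Proof.
move=> h; rewrite nth_cat size_takel // /bump; have [im|im] := leqP i m.
  by rewrite nth_drop; congr nth; lia.
by rewrite nth_take.
Qed.

Lemma del_cons i x s : del i.+1 (x :: s) = x :: del i s.
Proof. by []. Qed.

Lemma del0 x s : del 0 (x :: s) = s.
Proof. by rewrite /del /= drop0. Qed.

Lemma del_del i j s : (i < j)%N -> del j.-1 (del i s) = del i (del j s).
Proof.
elim: s i j => [|x s IH] i [|j] //.
case: i => [|i] ij; first by rewrite del_cons !del0.
case: j ij => // j ij; rewrite !del_cons; congr cons; exact: (IH i j.+1).
Qed.

End Deletion.

Lemma map_del (T T' : Type) (f : T -> T') i s : map f (del i s) = del i (map f s).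
Proof. by rewrite /del map_cat map_take map_drop. Qed.

(** Symmetric in the two positions, unlike two nested deletions, where the first
    one shifts the indices of the second. *)
Definition del2 (T : Type) i j (s : seq T) :=
  if (i < j)%N then del i (del j s) else del j (del i s).

Lemma del2C (T : Type) i j (s : seq T) : i != j -> del2 i j s = del2 j i s.
Proof. by rewrite /del2; case: ltngtP. Qed.

Lemma del_bump (T : Type) i m (s : seq T) : del m (del i s) = del2 i (bump i m) s.
Proof.
rewrite /del2 /bump; have [im|im] := leqP i m.
  by rewrite add1n ltnS im -(@del_del _ i m.+1).
by rewrite add0n ltnNge (ltnW im).
Qed.

Section Pairs.
Context {R : comRingType}.

(** Deleting one position and then a second one meets every pair of positions
    twice, with opposite signs. *)
Lemma sum_lift_pairs n (G : nat -> nat -> R) :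
  \sum_(i < n.+1) \sum_(m < n) (-1) ^+ (i + m) * G i (bump i m) =
  \sum_(i < n.+1) \sum_(j < n.+1 | (i < j)%N) (-1) ^+ (i + j) * (G j i - G i j).
Proof.
pose S (i j : nat) : R := if (i < j)%N then - (-1) ^+ (i + j) * G i j
  else if (j < i)%N then (-1) ^+ (i + j) * G i j else 0.
have -> : \sum_(i < n.+1) \sum_(m < n) (-1) ^+ (i + m) * G i (bump i m) =
    \sum_(i < n.+1) \sum_(j < n.+1) S i j.
  apply: eq_bigr => i _; rewrite (bigD1_ord i) //= /S ltnn add0r.
  apply: eq_bigr => m _; rewrite /bump; have [im|im] := leqP i m.
    by rewrite add1n ltnS im addnS exprS mulN1r opprK.
  by rewrite add0n ltnNge (ltnW im) /= im.
under eq_bigr => i _ do rewrite (bigID (fun j : 'I_n.+1 => (i < j)%N)) /=.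
rewrite big_split /= [X in _ + X](exchange_big_dep xpredT) //= -big_split /=.
apply: eq_bigr => i _; rewrite [RHS](eq_bigr (fun j : 'I_n.+1 =>
   - (-1) ^+ (i + j) * G i j + (-1) ^+ (i + j) * G j i)); last first.
  by move=> j _; rewrite mulrBr addrC mulNr.
rewrite big_split /=; congr (_ + _).
  by apply: eq_bigr => j ij; rewrite /S ij.
rewrite (bigID (fun j : 'I_n.+1 => (i < j)%N)) /= [X in _ + X]big1 ?addr0.
  apply: eq_big => [j|j]; first by rewrite -leqNgt andb_idl // => /ltnW.
  by move=> /andP[ji ij]; rewrite /S ltnNge ltnW //= ij addnC.
move=> j; rewrite -!leqNgt => /andP[ij ji].
have e : i = j :> nat by apply/eqP; rewrite eqn_leq ij ji.
by rewrite /S e ltnn.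
Qed.

End Pairs.

Section AlternatingForms.
Context {R : realFieldType} {V : lmodType R}.
Implicit Types (F : seq V -> R) (s : seq V) (x y : V).

(** Alternating forms of degree [n], as functions of lists, on which only their
    values at lists of length [n] carry meaning. Vanishing when two neighbouring
    arguments coincide is equivalent to alternation and easier to verify. *)
Definition mlinear n F := forall s1 s2 (c : R) x y, (size s1 + size s2).+1 = n ->
  F (s1 ++ (c *: x + y) :: s2) = c * F (s1 ++ x :: s2) + F (s1 ++ y :: s2).

Definition altform n F := mlinear n F /\
  forall s1 s2 x, (size s1 + size s2).+2 = n -> F (s1 ++ x :: x :: s2) = 0.

Lemma mlinearD n F s1 s2 x y : mlinear n F -> (size s1 + size s2).+1 = n ->
  F (s1 ++ (x + y) :: s2) = F (s1 ++ x :: s2) + F (s1 ++ y :: s2).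
Proof. by move=> lF h; have := lF s1 s2 1 x y h; rewrite scale1r mul1r. Qed.

Lemma mlinear0 n F s1 s2 : mlinear n F -> (size s1 + size s2).+1 = n ->
  F (s1 ++ 0 :: s2) = 0.
Proof.
move=> lF h; have := mlinearD 0 0 lF h; rewrite addr0 => /eqP.
by rewrite -subr_eq0 opprD addNKr oppr_eq0 => /eqP.
Qed.

Lemma mlinearZ n F s1 s2 (c : R) x : mlinear n F -> (size s1 + size s2).+1 = n ->
  F (s1 ++ (c *: x) :: s2) = c * F (s1 ++ x :: s2).
Proof.
by move=> lF h; have := lF s1 s2 c x 0 h; rewrite addr0 (mlinear0 lF h) addr0.
Qed.

Lemma mlinear_sum n F s1 s2 (I : Type) (t : seq I) (c : I -> R) (x : I -> V) :
  mlinear n F -> (size s1 + size s2).+1 = n ->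
  F (s1 ++ (\sum_(i <- t) c i *: x i) :: s2) = \sum_(i <- t) c i * F (s1 ++ x i :: s2).
Proof.
move=> lF h; elim: t => [|i t IH]; first by rewrite !big_nil (mlinear0 lF h).
by rewrite !big_cons (lF _ _ _ _ _ h) IH.
Qed.

Lemma mlinear_cons n F x : mlinear n.+1 F -> mlinear n (fun s => F (x :: s)).
Proof. by move=> lF s1 s2 c y z h; apply: (lF (x :: s1)); rewrite /= addSn h. Qed.

Lemma altform_cons n F x : altform n.+1 F -> altform n (fun s => F (x :: s)).
Proof.
move=> [lF aF]; split; first exact: mlinear_cons.
by move=> s1 s2 y h; apply: (aF (x :: s1)); rewrite /= addSn h.
Qed.

Lemma altform_swap n F s1 s2 x y : altform n F -> (size s1 + size s2).+2 = n ->
  F (s1 ++ x :: y :: s2) = - F (s1 ++ y :: x :: s2).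
Proof.
move=> [lF aF] h; have := aF s1 s2 (x + y) h.
have h1 : (size s1 + size ((x + y) :: s2)).+1 = n by rewrite /= addnS.
have h2 z : (size (rcons s1 z) + size s2).+1 = n by rewrite size_rcons addSn.
rewrite (mlinearD _ _ lF h1) -2!cat_rcons.
rewrite !(mlinearD _ _ lF (h2 _)) !cat_rcons !aF // add0r addr0.
by move/eqP; rewrite addr_eq0 => /eqP.
Qed.

Lemma altform_move n F s1 s2 x : altform n F -> (size s1 + size s2).+1 = n ->
  F (x :: s1 ++ s2) = (-1) ^+ size s1 * F (s1 ++ x :: s2).
Proof.
elim: s1 n F => [|y s1 IH] n F aF /=; first by rewrite mul1r.
case: n aF => [//|n] aF [] h.
have -> : F (x :: y :: s1 ++ s2) = - F (y :: x :: s1 ++ s2).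
  have := @altform_swap _ _ [::] (s1 ++ s2) x y aF; apply => /=.
  by rewrite size_cat add0n -h addSn.
rewrite addSn in h.
have -> := IH n (fun s => F (y :: s)) (altform_cons y aF) h.
by rewrite exprS mulN1r mulNr.
Qed.

(** Moving the first argument to the end costs [n.-1] transpositions; the signs add
    up to the number of pairs. *)
Lemma altform_rev n F s : altform n F -> size s = n ->
  F (rev s) = (-1) ^+ (n * n.-1)./2 * F s.
Proof.
elim: s n F => [|x s IH] n F aF /= sn; first by rewrite -sn mul1r.
case: n => [//|n] in aF sn *; case: sn => sn.
rewrite rev_cons -cats1.
have := @altform_move _ _ (rev s) [::] x aF.
rewrite cats0 size_rev addn0 sn => /(_ erefl) E.
have -> : F (rev s ++ [:: x]) = (-1) ^+ n * F (x :: rev s).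
  by rewrite E mulrA -exprMn mulrNN mulr1 expr1n mul1r.
rewrite (IH n (fun s => F (x :: s)) (altform_cons x aF) sn) mulrA -exprD.
congr (_ ^+ _ * _); rewrite -!bin2; case: n {aF sn E} => // n.
by rewrite [in RHS]binS bin1 addnC.
Qed.

End AlternatingForms.

(** * The bracket in local coordinates *)

Section LocalBracket.
Context {R : realType} {d : nat} {M : manifold R d} {r : nat} {E : vbundle M r}.
Variables (rho : forall x : M, {linear E x -> tangent x}).
Hypothesis rho_map : is_bundle_map rho.
Variables (br : section_of E -> section_of E -> section_of E).
Hypothesis brP : is_bracket rho br.
Variables (k : chart_idx M) (l : frame_idx E).
Implicit Types (s t w : section_of E) (u : 'rV[R]_d).

Notation U := (coord_dom k l).
Notation lrho := (loc_rho rho k l).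
Notation lC := (loc_C br k l).

Definition scoord s u : 'rV[R]_r :=
  \row_a fcoord l a (chart_inv k u) (s (chart_inv k u)).

Lemma coord_domP u : U u -> [/\ chart_dom k (chart_inv k u),
  frame_dom l (chart_inv k u) & chart k (chart_inv k u) = u].
Proof. exact: chart_imgP. Qed.

Lemma open_coord_dom : open U.
Proof. by apply: open_chart_img; exact: frame_dom_open. Qed.

Lemma near_coord_dom u : U u -> \forall u' \near u, U u'.
Proof. by move=> Uu; apply: open_nbhs_nbhs; split => //; exact: open_coord_dom. Qed.

Lemma near_chart_inv u (P : set M) : U u -> (\forall y \near chart_inv k u, P y) ->
  \forall u' \near u, P (chart_inv k u').
Proof.
move=> /coord_domP[ku _ uE] /(near_chart ku); by rewrite uE.
Qed.

Lemma scoordE s u a : scoord s u 0 a = fcoord l a (chart_inv k u) (s (chart_inv k u)).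
Proof. exact: mxE. Qed.

Lemma scoordK s u : U u ->
  s (chart_inv k u) = \sum_a scoord s u 0 a *: frame l a (chart_inv k u).
Proof.
move=> /coord_domP[_ lu _]; rewrite {1}(fcoordK (s _) lu).
by apply: eq_bigr => a _; rewrite scoordE.
Qed.

Lemma vsmooth_scoord s : ssmooth s -> vsmooth U (scoord s).
Proof.
move=> ss a; apply: smooth_on_eq (ss l a k); first exact: open_coord_dom.
by move=> u _; rewrite scoordE.
Qed.

Lemma loc_rho_smooth i a : smooth_on U (lrho i a).
Proof.
have H : smooth_on (chart_img k (chart_dom k `&` frame_dom l)) (lrho i a).
  exact: (@rho_map k l i a k).
by apply: smooth_onW H => u [x [kx lx] <-]; exists x.
Qed.

Lemma smooth_on_near (f : 'rV[R]_d -> R) :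
  (forall u, U u -> exists2 g, smooth_on U g & \forall u' \near u, g u' = f u') ->
  smooth_on U f.
Proof.
move=> H s u Uu; have [g sg gf] := H u Uu.
exact: differentiable_near (foldr_partial_near s gf) (sg s u Uu).
Qed.

Lemma frames_extend u : U u -> exists F : 'I_r -> section_of E,
  forall a, ssmooth (F a) /\ \forall y \near chart_inv k u, F a y = frame l a y.
Proof.
move=> /coord_domP[_ lu _].
have /choice[F HF] : forall a, exists s : section_of E, ssmooth s /\
    \forall y \near chart_inv k u, s y = frame l a y.
  by move=> a; have [s] := frame_extend a lu; exists s.
by exists F.
Qed.

(** The structure functions come from [local_bracket], which depends on the point;
    near [u], one choice [F] of global sections computes them all. *)
Lemma loc_C_near u (F : 'I_r -> section_of E) a b c : U u ->
  (forall a, ssmooth (F a) /\ \forall y \near chart_inv k u, F a y = frame l a y) ->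
  \forall u' \near u, scoord (br (F a) (F b)) u' 0 c = lC a b c u'.
Proof.
move=> Uu HF; have [sa /nbhs_interior Fa] := HF a; have [sb /nbhs_interior Fb] := HF b.
have H : \forall y \near chart_inv k u,
   local_bracket br (frame l a) (frame l b) y = br (F a) (F b) y.
  by apply: filterS2 Fa Fb => y Fay Fby; exact: (local_bracketE brP sa sb Fay Fby).
have := near_chart_inv Uu H; apply: filterS => u' Hu'.
by rewrite scoordE /loc_C Hu'.
Qed.

Lemma loc_C_smooth a b c : smooth_on U (lC a b c).
Proof.
apply: smooth_on_near => u Uu; have [F HF] := frames_extend Uu.
exists (fun u' => scoord (br (F a) (F b)) u' 0 c); last exact: loc_C_near.
have [sa _] := HF a; have [sb _] := HF b.
by apply: vsmooth_scoord; exact: (br_smooth brP).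
Qed.

Lemma loc_C_skew a b c u : U u -> lC a b c u = - lC b a c u.
Proof.
move=> Uu; have [F HF] := frames_extend Uu.
rewrite -(nbhs_singleton (loc_C_near a b c Uu HF)) -(nbhs_singleton (loc_C_near b a c Uu HF)).
have [sa _] := HF a; have [sb _] := HF b.
by rewrite !scoordE (br_skew brP) // linearN.
Qed.

Lemma tcoord_rho u (e : E (chart_inv k u)) : U u ->
  tcoord k (rho (chart_inv k u) e) =
  anchor (rho_at lrho u) (\row_a fcoord l a (chart_inv k u) e).
Proof.
move=> /coord_domP[ku lu uE]; rewrite {1}(fcoordK e lu) !linear_sum /=.
apply/rowP => i; rewrite anchorE summxE; apply: eq_bigr => a _.
by rewrite !linearZ /= [LHS]mxE [X in _ = X * _]mxE.
Qed.

Lemma tderiv_loc s f u : U u -> differentiable (f \o chart_inv k) u ->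
  tderiv (rho (chart_inv k u) (s (chart_inv k u))) f =
  dird (anchor (rho_at lrho u) (scoord s u)) (f \o chart_inv k) u.
Proof.
move=> Uu df; have [ku lu uE] := coord_domP Uu.
by rewrite (tderivE _ ku) uE // tcoord_rho.
Qed.

Lemma tderiv_sum x (I : Type) (v : seq I) (c : I -> R) (z : I -> tangent x) (f : M -> R) :
  tderiv (\sum_(i <- v) c i *: z i) f = \sum_(i <- v) c i * tderiv (z i) f.
Proof.
elim: v => [|i v IH].
  by rewrite !big_nil /tderiv big1 // => j _; rewrite mxE mul0r.
rewrite !big_cons tderivD IH; congr (_ + _).
by rewrite /tderiv mulr_sumr; apply: eq_bigr => j _; rewrite mxE mulrA.
Qed.

(** By locality the sections can be replaced by combinations of extended frame
    sections, on which the Leibniz rule determines the bracket. *)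
Lemma scoord_br s t u : ssmooth s -> ssmooth t -> U u ->
  scoord (br s t) u = lbr lrho lC (scoord s) (scoord t) u.
Proof.
move=> ss st Uu; have [ku lu uE] := coord_domP Uu.
set x := chart_inv k u in ku lu uE *.
have [F HF] := frames_extend Uu.
have sF a : ssmooth (F a) by have [] := HF a.
have nF a : \forall y \near x, F a y = frame l a y by have [] := HF a.
have ext (v : section_of E) : ssmooth v -> exists c : 'I_r -> M -> R, forall a,
    msmooth (c a) /\ \forall y \near x, c a y = fcoord l a y (v y).
  move=> sv; have /choice[c Hc] : forall a, exists c : M -> R, msmooth c /\
      \forall y \near x, c y = fcoord l a y (v y).
    move=> a; have [c sc] := msmooth_extend (@frame_dom_open _ _ _ _ E l) lu (sv l a).
    by exists c.
  by exists c.
have near_sum (v : section_of E) (c : 'I_r -> M -> R) :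
    (forall a, msmooth (c a) /\ \forall y \near x, c a y = fcoord l a y (v y)) ->
    \forall y \near x, v y = \sum_a c a y *: F a y.
  move=> Hc.
  have H a : \forall y \near x, c a y *: F a y = fcoord l a y (v y) *: frame l a y.
    by have [_ h] := Hc a; apply: filterS2 h (nF a) => y -> ->.
  have H' : \forall y \near x, forall a, c a y *: F a y = fcoord l a y (v y) *: frame l a y.
    exact: filter_forall.
  apply: filterS2 (near_frame_sum v lu) H' => y e h.
  by rewrite e; apply: eq_bigr => a _; rewrite h.
have [S HS] := ext s ss; have [T HT] := ext t st.
have sS a : msmooth (S a) by have [] := HS a.
have sT a : msmooth (T a) by have [] := HT a.
pose s' : section_of E := fun y => \sum_a S a y *: F a y.
pose t' : section_of E := fun y => \sum_a T a y *: F a y.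
have ss' : ssmooth s' by apply: ssmooth_sum => a; exact: ssmooth_scale.
have st' : ssmooth t' by apply: ssmooth_sum => a; exact: ssmooth_scale.
have ns := near_sum s S HS; have nt := near_sum t T HT.
apply/rowP => c; rewrite scoordE -/x.
have -> : br s t x = br s' t' x.
  by rewrite (br_local_l brP (s' := s')) //; exact: (br_local_r brP).
rewrite (br_sum_r brP) // linear_sum /=.
have Fx a : F a x = frame l a x := nbhs_singleton (nF a).
have fE a : fcoord l c x (F a x) = (c == a)%:R by rewrite Fx fcoord_frame.
have Ex b : fcoord l c x (br s' (F b) x) =
   \sum_a S a x * lC a b c u - tderiv (rho x (F b x)) (S c).
  rewrite (br_sum_l brP) // linear_sum /=.
  rewrite (eq_bigr (fun a => S a x * lC a b c u -
      tderiv (rho x (F b x)) (S a) * (c == a)%:R)); last first.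
    move=> a _; rewrite linearB !linearZ /= fE scalerN.
    rewrite -[LHS]/(S a x * _ - tderiv (rho x (F b x)) (S a) * _); congr (_ * _ - _).
    by rewrite -(nbhs_singleton (loc_C_near a b c Uu HF)) scoordE.
  rewrite sumrB; congr (_ - _); rewrite (bigD1 c) //= eqxx mulr1 big1 ?addr0 //.
  by move=> a /negbTE ac; rewrite eq_sym ac mulr0.
have near_tderiv (v w : section_of E) (f : 'I_r -> M -> R) :
    (forall a, msmooth (f a) /\ \forall y \near x, f a y = fcoord l a y (w y)) ->
    tderiv (rho x (v x)) (f c) =
    dird (anchor (rho_at lrho u) (scoord v u)) (fun u' => scoord w u' 0 c) u.
  move=> Hf; have [sf hf] := Hf c; rewrite tderiv_loc //.
    apply: dird_near; have := near_chart_inv Uu hf.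
    by apply: filterS => u' /= ->; rewrite scoordE.
  by rewrite -uE; exact: (msmooth_on_differentiable ku _ sf).
have cE (v : section_of E) (f : 'I_r -> M -> R) a :
    (forall a, msmooth (f a) /\ \forall y \near x, f a y = fcoord l a y (v y)) ->
    f a x = scoord v u 0 a.
  by move=> Hf; have [_ hf] := Hf a; rewrite (nbhs_singleton hf) scoordE.
have sx : s' x = s x by rewrite (nbhs_singleton ns).
have tx : t' x = t x by rewrite (nbhs_singleton nt).
rewrite (eq_bigr (fun b => \sum_a S a x * T b x * lC a b c u
    - T b x * tderiv (rho x (F b x)) (S c)
    + tderiv (rho x (s x)) (T b) * (c == b)%:R)); last first.
  move=> b _; rewrite linearD !linearZ /= fE sx Ex.
  rewrite -[LHS]/(T b x * _ + tderiv (rho x (s x)) (T b) * _); congr (_ + _).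
  rewrite mulrBr; congr (_ + _); last by rewrite -mulrN.
  by rewrite mulr_sumr; apply: eq_bigr => a _; rewrite mulrCA mulrA.
rewrite big_split sumrB /= -tderiv_sum /lbr rowDE rowDE rowNE !vdirdE cbrE.
rewrite addrAC; congr (_ + _ - _).
- rewrite exchange_big; apply: eq_bigr => a _; apply: eq_bigr => b _.
  by rewrite (cE s S a HS) (cE t T b HT).
- rewrite (bigD1 c) //= eqxx mulr1 big1 ?addr0; first exact: near_tderiv.
  by move=> b /negbTE bc; rewrite eq_sym bc mulr0.
- rewrite -(near_tderiv t s S HS) -tx /t' linear_sum /=.
  by congr tderiv; apply: eq_bigr => b _; rewrite linearZ.
Qed.

Lemma lbr_near rh C S T T' u : (\forall u' \near u, T u' = T' u') ->
  @lbr R d r rh C S T u = lbr rh C S T' u.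
Proof.
move=> TT'; have Tu : T u = T' u := nbhs_singleton TT'.
rewrite /lbr Tu; congr (_ + _ - _); apply/rowP => a; rewrite !vdirdE.
by apply: dird_near; apply: filterS TT' => u' ->.
Qed.

(** The inner brackets have coordinates [lbr] in a neighbourhood, which is what the
    outer bracket needs to differentiate them. *)
Lemma scoord_jacobi s t w u : ssmooth s -> ssmooth t -> ssmooth w -> U u ->
  scoord (fun x => br s (br t w) x + br t (br w s) x + br w (br s t) x) u =
  lbr lrho lC (scoord s) (lbr lrho lC (scoord t) (scoord w)) u
  + lbr lrho lC (scoord t) (lbr lrho lC (scoord w) (scoord s)) u
  + lbr lrho lC (scoord w) (lbr lrho lC (scoord s) (scoord t)) u.
Proof.
move=> ss st sw Uu.
have H (v1 v2 v3 : section_of E) : ssmooth v1 -> ssmooth v2 -> ssmooth v3 ->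
    scoord (br v1 (br v2 v3)) u =
    lbr lrho lC (scoord v1) (lbr lrho lC (scoord v2) (scoord v3)) u.
  move=> s1 s2 s3; rewrite scoord_br //; last exact: (br_smooth brP).
  apply: lbr_near; have := near_coord_dom Uu.
  by apply: filterS => u' Uu'; exact: scoord_br.
rewrite -!H //; apply/rowP => a; rewrite !(rowDE, scoordE) !linearD.
by [].
Qed.

End LocalBracket.

(** * The exterior derivative in local coordinates *)

Section FormsOnLists.
Context {R : realType}.

Lemma altform_fun (V W : lmodType R) (g : {linear V -> W}) n (f : ('I_n -> W) -> R) :
  multilinear f -> alternates f -> altform n (fun s => f (fun j => g (nth 0 s j))).
Proof.
move=> lf af; split=> [s1 s2 c x y h|s1 s2 x h].
  have i0 : (size s1 < n)%N by lia.
  pose v (j : 'I_n) := g (nth 0 (s1 ++ x :: s2) j).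
  have E z : (fun j : 'I_n => g (nth 0 (s1 ++ z :: s2) j)) = dfwith (T := fun=> W) v (Ordinal i0) (g z).
    apply/funext => j; have [->|ji] := eqVneq j (Ordinal i0).
      by rewrite dfwithin /= nth_cat ltnn subnn.
    rewrite dfwithout 1?eq_sym // /v !nth_cat; case: ltnP => // sj.
    have js : j != size s1 :> nat by apply: contra_neq ji => e; apply/val_inj.
    have -> : (j - size s1 = (j - size s1).-1.+1)%N by rewrite prednK // subn_gt0 ltn_neqAle eq_sym js.
    by [].
  by rewrite !E linearP lf.
have i0 : (size s1 < n)%N by lia.
have i1 : ((size s1).+1 < n)%N by lia.
apply: (af _ (Ordinal i0) (Ordinal i1)); first by apply/eqP => -[]; lia.
by rewrite /= !nth_cat ltnn subnn ltnNge leqnSn /= subSnn.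
Qed.

End FormsOnLists.

Section ExteriorDerivative.
Context {R : realType} {d r : nat}.
Local Notation V := 'rV[R]_r.

(** The coordinate expression of the exterior derivative at one point, where
    [dJ] stands for the partial derivatives of the coefficients of [J]. *)
Definition dform n (rho : 'I_d -> 'I_r -> R) (C : 'I_r -> 'I_r -> 'I_r -> R)
    (J : seq V -> R) (dJ : 'I_d -> seq V -> R) (v : seq V) : R :=
  \sum_(i < n.+1) (-1) ^+ i *
     \sum_j anchor rho (nth 0 v i) 0 j * dJ j (del i v)
  + \sum_(i < n.+1) \sum_(j < n.+1 | (i < j)%N)
     (-1) ^+ (i + j) * J (cbr C (nth 0 v i) (nth 0 v j) :: del i (del j v)).

(** The Leibniz rule for a form with varying coefficients applied to varying
    vectors. The induction peels off the first vector by expanding it in the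
    standard basis, whose elements accumulate in the prefix [s0]. *)
Lemma dird_mlinear (F : 'rV[R]_d -> seq V -> R) n z u (Xs : seq ('rV[R]_d -> V)) s0 :
  (forall u', mlinear n (F u')) ->
  (forall v, size v = n -> differentiable (fun u' => F u' v) u) ->
  (forall m a, (m < size Xs)%N -> differentiable (fun u' => nth (fun=> 0) Xs m u' 0 a) u) ->
  (size s0 + size Xs)%N = n ->
  let vals u' := [seq X u' | X <- Xs] in
  differentiable (fun u' => F u' (s0 ++ vals u')) u /\
  dird z (fun u' => F u' (s0 ++ vals u')) u =
  dird z (fun u' => F u' (s0 ++ vals u)) u +
  \sum_(m < size Xs) F u (s0 ++ take m (vals u)
     ++ vdird z (nth (fun=> 0) Xs m) u :: drop m.+1 (vals u)).
Proof.
move=> lF dF; elim: Xs s0 => [|X Xs IH] s0 dS h /=.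
  rewrite big_ord0 addr0; split=> //; apply: dF.
  by rewrite size_cat.
have h1 x : (size s0 + size [seq X' x | X' <- Xs]).+1 = n by rewrite size_map -addnS.
have dSa a : differentiable (fun u' => X u' 0 a) u by exact: (dS 0%N).
have IHa a := IH (rcons s0 (delta_mx 0 a)).
have {IHa}IHa a : let vals u' := [seq X u' | X <- Xs] in
  differentiable (fun u' => F u' (s0 ++ delta_mx 0 a :: vals u')) u /\
  dird z (fun u' => F u' (s0 ++ delta_mx 0 a :: vals u')) u =
  dird z (fun u' => F u' (s0 ++ delta_mx 0 a :: vals u)) u +
  \sum_(m < size Xs) F u (s0 ++ delta_mx 0 a :: take m (vals u)
     ++ vdird z (nth (fun=> 0) Xs m) u :: drop m.+1 (vals u)).
  have [||D1 D2] := IHa a.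
  - by move=> m b hm; exact: (dS m.+1).
  - by rewrite size_rcons addSnnS.
  move=> vals; split.
    by apply: differentiable_eq D1 => u'; rewrite cat_rcons.
  rewrite [LHS](_ : _ = dird z (fun u' => F u' (rcons s0 (delta_mx 0 a) ++ vals u')) u).
    rewrite D2; congr (_ + _).
      by apply: dird_eq => u'; rewrite cat_rcons.
    by apply: eq_bigr => m _; rewrite cat_rcons.
  by apply: dird_eq => u'; rewrite cat_rcons.
have split_row s1 s2 u' (x : V) : (size s1 + size s2).+1 = n ->
    F u' (s1 ++ x :: s2) = \sum_a x 0 a * F u' (s1 ++ delta_mx 0 a :: s2).
  by move=> hs; rewrite {1}[x]row_sum_delta (mlinear_sum _ _ _ (lF u') hs).
set rest := fun u' => [seq X' u' | X' <- Xs].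
have E u' : F u' (s0 ++ X u' :: rest u') =
    \sum_a X u' 0 a * F u' (s0 ++ delta_mx 0 a :: rest u').
  exact: split_row (h1 u').
have dT a : differentiable (fun u' => X u' 0 a * F u' (s0 ++ delta_mx 0 a :: rest u')) u.
  by have [D _] := IHa a; exact: (differentiableM (dSa a) D).
split.
  have : differentiable (fun u' => \sum_a X u' 0 a * F u' (s0 ++ delta_mx 0 a :: rest u')) u.
    exact: differentiable_bigsum.
  by apply: differentiable_eq => u'; rewrite E.
rewrite (dird_eq _ _ E) dird_sum // big_ord_recl /= drop0.
rewrite (eq_bigr (fun a => vdird z X u 0 a * F u (s0 ++ delta_mx 0 a :: rest u)
  + (X u 0 a * dird z (fun u' => F u' (s0 ++ delta_mx 0 a :: rest u)) u
  + X u 0 a * \sum_(m < size Xs) F u (s0 ++ delta_mx 0 a :: take m (rest u)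
     ++ vdird z (nth (fun=> 0) Xs m) u :: drop m.+1 (rest u))))); last first.
  move=> a _; have [D1 D2] := IHa a; rewrite dirdM //.
  by rewrite vdirdE -mulrDr -D2.
rewrite big_split big_split /= -(split_row s0 (rest u) u (vdird z X u) (h1 u)) addrCA; congr (_ + (_ + _)).
  have c1 a : differentiable (fun u' => F u' (s0 ++ delta_mx 0 a :: rest u)) u.
    by apply: dF; rewrite size_cat /= addnS; exact: (h1 u).
  rewrite (dird_eq _ _ (fun u' => split_row s0 (rest u) u' (X u) (h1 u))) dird_sum.
    by apply: eq_bigr => a _; rewrite dirdM // dird_cst mul0r add0r.
  by move=> a; apply: (@differentiableM _ _ (fun=> X u 0 a)).
under eq_bigr => a _ do rewrite mulr_sumr.
rewrite exchange_big /=; apply: eq_bigr => m _; rewrite -split_row //.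
have hm : (m < size Xs)%N := ltn_ord m.
rewrite -h /rest size_cat /= size_take size_drop !size_map hm; lia.
Qed.

End ExteriorDerivative.

Section OrdEnum.

Lemma nth_map_ord (T : Type) x0 n (f : 'I_n -> T) (i : 'I_n) :
  nth x0 [seq f j | j <- enum 'I_n] i = f i.
Proof. by rewrite (nth_map i) ?size_enum_ord // nth_ord_enum. Qed.

Lemma del_enum n (i : 'I_n.+1) : del i (enum 'I_n.+1) = [seq lift i m | m <- enum 'I_n].
Proof.
apply: (@eq_from_nth _ i) => [|m].
  by rewrite size_map size_del !size_enum_ord.
rewrite size_del !size_enum_ord //= => mn.
rewrite nth_del ?size_enum_ord 1?ltnW // (nth_map_ord _ _ (Ordinal mn)).
exact: (@nth_ord_enum _ i (lift i (Ordinal mn))).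
Qed.

Lemma filter_neq (T : eqType) (s : seq T) x : uniq s ->
  [seq y <- s | y != x] = del (index x s) s.
Proof. by move=> us; rewrite /del -remE rem_filter. Qed.

Lemma omit2E (T : Type) n (e : 'I_n.+1 -> T) (i j : 'I_n.+1) : (i < j)%N ->
  [seq e m | m <- enum 'I_n.+1 & (m != i) && (m != j)] =
  del i (del j [seq e m | m <- enum 'I_n.+1]).
Proof.
move=> ij; rewrite -(map_del e j) -(map_del e i); congr map.
rewrite (eq_filter (a2 := predI (fun m => m != i) (fun m => m != j))) //.
have fj : [seq m <- enum 'I_n.+1 | m != j] = del j (enum 'I_n.+1).
  by rewrite -[X in del X _](index_enum_ord j) filter_neq // enum_uniq.
have us : uniq (del j (enum 'I_n.+1)) by rewrite -fj filter_uniq // enum_uniq.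
rewrite filter_predI fj; set s := del j _ in us *.
rewrite filter_neq //.
have ss : size s = n by rewrite size_del size_enum_ord.
have si : nth i s i = i.
  by rewrite nth_del ?size_enum_ord 1?ltnW // /bump leqNgt ij nth_ord_enum.
have -> : index i s = i; last by [].
have hi : (i < size s)%N by rewrite ss; have := ltn_ord j; lia.
by have := index_uniq i hi us; rewrite si.
Qed.

End OrdEnum.

Section ConnectionTerms.
Context {R : realFieldType} {V : lmodType R}.

(** Moving an argument to its place: the derivatives of the arguments in the
    first sum of the exterior derivative cancel those in the brackets. *)
Lemma altform_connection n (F : seq V -> R) (v : seq V) (N : nat -> nat -> V) :
  altform n F -> size v = n.+1 ->
  \sum_(i < n.+1) (-1) ^+ i * \sum_(m < n)
     F (take m (del i v) ++ N i (bump i m) :: drop m.+1 (del i v))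
  + \sum_(i < n.+1) \sum_(j < n.+1 | (i < j)%N)
     (-1) ^+ (i + j) * F ((N i j - N j i) :: del i (del j v)) = 0.
Proof.
move=> aF sv; pose G i j := F (N i j :: del2 i j v).
have E1 (i : 'I_n.+1) (m : 'I_n) :
    F (take m (del i v) ++ N i (bump i m) :: drop m.+1 (del i v)) =
    (-1) ^+ m * G i (bump i m).
  rewrite /G -del_bump; set w := del i v.
  have sw : size w = n by rewrite size_del sv.
  rewrite /del -/w (altform_move _ aF) ?size_takel ?sw 1?ltnW //.
    by rewrite mulrA -exprMn mulrNN mulr1 expr1n mul1r.
  by rewrite size_drop sw; have := ltn_ord m; lia.
under eq_bigr => i _ do rewrite mulr_sumr.
under eq_bigr => i _ do under eq_bigr => m _ do rewrite E1 mulrA -exprD.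
rewrite (sum_lift_pairs n G) -big_split /= big1 // => i _.
rewrite -big_split /= big1 // => j ij; rewrite -mulrDr.
have sd : size (del2 i j v) = n.-1.
  by rewrite /del2 ij size_del size_del sv //=; have := ltn_ord j; lia.
have hn : (size (@nil V) + size (del2 i j v)).+1 = n.
  by rewrite sd add0n prednK //; have := ltn_ord j; lia.
have -> : del i (del j v) = del2 i j v by rewrite /del2 ij.
have := @mlinearD _ _ _ _ [::] (del2 i j v) (N i j) (- N j i) aF.1 hn => /= ->.
have := @mlinearZ _ _ _ _ [::] (del2 i j v) (-1) (N j i) aF.1 hn => /=.
rewrite scaleN1r mulN1r => ->; rewrite /G (@del2C _ j i) 1?eq_sym ?ltn_eqF //.
by rewrite [X in _ * X](_ : _ = 0) ?mulr0 //; ring.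
Qed.

End ConnectionTerms.

Section LocalForms.
Context {R : realType} {d : nat} {M : manifold R d} {r : nat} {E : vbundle M r}.
Variable n : nat.
Variables (rho : forall x : M, {linear E x -> tangent x}).
Hypothesis rho_map : is_bundle_map rho.
Variables (br : section_of E -> section_of E -> section_of E).
Hypothesis brP : is_bracket rho br.
Variable J : forall x : M, ('I_n -> E x) -> R.
Hypothesis J_form : is_Eform J.
Variable H : forall x : M, ('I_n.+1 -> tangent x) -> R.
Hypothesis H_form : is_form H.
Variables (k : chart_idx M) (l : frame_idx E).

Notation U := (coord_dom k l).
Notation lrho := (loc_rho rho k l).
Notation lC := (loc_C br k l).

(** Written as linear maps from coordinates, so that local expressions of forms are
    again multilinear functions of lists of coordinate vectors. *)
Definition frame_vec x (w : 'rV[R]_r) : E x := \sum_a w 0 a *: frame l a x.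

Lemma frame_vec_is_linear x : linear (frame_vec x).
Proof.
move=> c v w; rewrite /frame_vec scaler_sumr -big_split; apply: eq_bigr => a _.
by rewrite !mxE scalerDl scalerA.
Qed.

HB.instance Definition _ x := GRing.isLinear.Build R 'rV[R]_r (E x) *:%R
  (frame_vec x) (@frame_vec_is_linear x).

Definition coord_vec x (w : 'rV[R]_d) : tangent x := \sum_i w 0 i *: dcoord k i x.

Lemma coord_vec_is_linear x : linear (@coord_vec x).
Proof.
move=> c v w; rewrite /coord_vec scaler_sumr -big_split; apply: eq_bigr => a _.
by rewrite !mxE scalerDl scalerA.
Qed.

HB.instance Definition _ x := GRing.isLinear.Build R 'rV[R]_d (tangent x) *:%R
  (@coord_vec x) (@coord_vec_is_linear x).

Definition Jloc u (v : seq 'rV[R]_r) : R :=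
  J (fun j : 'I_n => frame_vec (chart_inv k u) (nth 0 v j)).

Definition dJloc u (j : 'I_d) (v : seq 'rV[R]_r) : R :=
  partial j (fun u' => Jloc u' v) u.

Definition Hloc u (w : seq 'rV[R]_d) : R :=
  H (fun j : 'I_n.+1 => coord_vec (chart_inv k u) (nth 0 w j)).

Lemma altform_Jloc u : altform n (Jloc u).
Proof. by have [lJ aJ _] := J_form; exact: altform_fun. Qed.

Lemma altform_Hloc u : altform n.+1 (Hloc u).
Proof. by have [lH aH _] := H_form; exact: altform_fun. Qed.

Lemma frame_vec_delta x a : frame_vec x (delta_mx 0 a) = frame l a x.
Proof.
rewrite /frame_vec (bigD1 a) //= mxE !eqxx scale1r big1 ?addr0 // => b ba.
by rewrite mxE eqxx (negbTE ba) scale0r.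
Qed.

Lemma coord_vec_delta x i : coord_vec x (delta_mx 0 i) = dcoord k i x.
Proof.
rewrite /coord_vec (bigD1 i) //= mxE !eqxx scale1r big1 ?addr0 // => b ba.
by rewrite mxE eqxx (negbTE ba) scale0r.
Qed.

Lemma loc_JE u (A : 'I_n -> 'I_r) :
  loc_J J k l A u = Jloc u [seq delta_mx 0 (A j) | j <- enum 'I_n].
Proof.
rewrite /loc_J /Jloc; congr (J _); apply: functional_extensionality_dep => j.
by rewrite (nth_map_ord 0 (fun j => delta_mx 0 (A j))) frame_vec_delta.
Qed.

Lemma loc_HE u (I : 'I_n.+1 -> 'I_d) :
  loc_H H k I u = Hloc u [seq delta_mx 0 (I j) | j <- enum 'I_n.+1].
Proof.
rewrite /loc_H /form_coef /Hloc; congr (H _); apply: functional_extensionality_dep => j.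
by rewrite (nth_map_ord 0 (fun j => delta_mx 0 (I j))) coord_vec_delta.
Qed.

(** The hypothesis on [J] only speaks of frame vectors; the general case follows
    by expanding the vectors one after the other. *)
Lemma Jloc_smooth v : size v = n -> smooth_on U (fun u => Jloc u v).
Proof.
have oU : open U by exact: open_coord_dom.
suff H0 : forall w A, (size A + size w)%N = n ->
    smooth_on U (fun u => Jloc u ([seq delta_mx 0 a | a <- A] ++ w)).
  by move=> sv; exact: (H0 v [::] sv).
elim=> [|x w IH] A /=; rewrite ?addn0 => h.
  have [_ _ sJ] := J_form; rewrite cats0.
  have hA : size A == n by apply/eqP.
  have := sJ l (tnth (Tuple hA)) k; apply: smooth_on_eq => // u _ /=.
  rewrite /Jloc; congr (J _); apply: functional_extensionality_dep => j.
  have a0 : 'I_r by case: A h hA j => [|a A] //=; move=> <- _ [].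
  by rewrite (nth_map a0) ?h // frame_vec_delta (tnth_nth a0).
have sm a : smooth_on U (fun u => x 0 a * Jloc u ([seq delta_mx 0 a | a <- rcons A a] ++ w)).
  by apply: smooth_onM => //; [exact: smooth_on_cst|apply: IH; rewrite size_rcons addSnnS].
have := @smooth_on_sum _ _ _ _ (index_enum 'I_r) xpredT _ oU (fun a _ => sm a).
apply: smooth_on_eq => // u _.
have hs : (size [seq (delta_mx 0 a : 'rV[R]_r) | a <- A] + size w).+1 = n by rewrite size_map -addnS.
rewrite {2}[x]row_sum_delta (mlinear_sum _ _ _ (altform_Jloc u).1 hs).
by apply: eq_bigr => a _; rewrite map_rcons cat_rcons.
Qed.

Lemma altform_dJloc u j : U u -> altform n (dJloc u j).
Proof.
move=> Uu; have D v : size v = n -> differentiable (fun u' => Jloc u' v) u.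
  by move=> sv; exact: (smooth_on_differentiable (Jloc_smooth sv)).
split=> [s1 s2 c x y h|s1 s2 x h].
  have hh z : size (s1 ++ z :: s2) = n by rewrite size_cat /= addnS.
  rewrite /dJloc (_ : (fun u' => _) = (fun u' => c * Jloc u' (s1 ++ x :: s2) + Jloc u' (s1 ++ y :: s2))).
    rewrite partialD; [|apply: (@differentiableM _ _ (fun=> c)) => //|]; try exact: D.
    by rewrite partialM ?partial_cst ?mul0r ?add0r //; exact: D.
  by apply/funext => u'; rewrite ((altform_Jloc u').1 _ _ _ _ _ h).
rewrite /dJloc (_ : (fun u' => _) = (fun=> 0)) ?partial_cst //.
by apply/funext => u'; rewrite ((altform_Jloc u').2 _ _ _ h).
Qed.

Lemma frame_vec_scoord s u : U u ->
  frame_vec (chart_inv k u) (scoord k l s u) = s (chart_inv k u).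
Proof. by move=> Uu; rewrite [RHS](scoordK (k := k) (l := l)). Qed.

Lemma Jloc_sections u (ss : seq (section_of E)) : U u -> size ss = n ->
  Jloc u [seq scoord k l s u | s <- ss] =
  J (fun q : 'I_n => nth (fun=> 0) ss q (chart_inv k u)).
Proof.
move=> Uu hs; rewrite /Jloc; congr (J _); apply: functional_extensionality_dep => q.
by rewrite (nth_map (fun=> 0)) ?hs // frame_vec_scoord.
Qed.

(** The contraction with the anchor plugs the vectors in from the right, so they
    appear in reverse order. *)
Lemma Hloc_sections u (e : 'I_n.+1 -> section_of E) : U u ->
  H (fun q => rho (chart_inv k u) (e (rev_ord q) (chart_inv k u))) =
  Hloc u (rev [seq anchor (rho_at lrho u) w | w <-
    [seq scoord k l (e i) u | i <- enum 'I_n.+1]]).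
Proof.
move=> Uu; have [ku lu _] := coord_domP Uu.
rewrite /Hloc; congr (H _); apply: functional_extensionality_dep => q.
set v := [seq _ | _ <- _].
have sv : size v = n.+1 by rewrite 2!size_map size_enum_ord.
rewrite nth_rev ?sv // (nth_map 0); last by rewrite size_map size_enum_ord rev_ord_proof.
rewrite (nth_map_ord 0 (fun i => scoord k l (e i) u) (rev_ord q)) [LHS](tcoordK _ ku).
by rewrite (tcoord_rho _ _ Uu).
Qed.

(** The anchor differentiates the coefficients of [J] and the coordinates of the
    sections. The latter terms cancel those that the brackets contribute, by
    [altform_connection]; what is left depends on the values at one point only. *)
Lemma Ed_loc (e : 'I_n.+1 -> section_of E) u : U u -> (forall i, ssmooth (e i)) ->
  Ed rho br J e (chart_inv k u) =
  dform n (rho_at lrho u) (C_at lC u) (Jloc u) (dJloc u)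
    [seq scoord k l (e i) u | i <- enum 'I_n.+1].
Proof.
move=> Uu se; set v := [seq _ | _ <- _].
have sv : size v = n.+1 by rewrite size_map size_enum_ord.
have vE (i : 'I_n.+1) : nth 0 v i = scoord k l (e i) u.
  by rewrite (nth_map_ord 0 (fun i => scoord k l (e i) u)).
pose Xs := [seq scoord k l (e i) | i <- enum 'I_n.+1].
pose X (j : nat) := nth (fun=> 0) Xs j.
have XE (i : 'I_n.+1) : X i = scoord k l (e i).
  by rewrite /X (nth_map_ord _ (fun i => scoord k l (e i))).
pose N (i j : nat) := vdird (anchor (rho_at lrho u) (nth 0 v i)) (X j) u.
have first (i : 'I_n.+1) :
    tderiv (rho _ (e i (chart_inv k u))) (fun y => J (fun q => e (lift i q) y)) =
    \sum_j anchor (rho_at lrho u) (nth 0 v i) 0 j * dJloc u j (del i v)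
    + \sum_(m < n) Jloc u (take m (del i v) ++ N i (bump i m) :: drop m.+1 (del i v)).
  pose Xi := [seq scoord k l (e (lift i m)) | m <- enum 'I_n].
  have Xi_del : Xi = del i Xs by rewrite /Xi /Xs -map_del del_enum -map_comp.
  have sXi : size Xi = n by rewrite size_map size_enum_ord.
  have XiE m : (m < n)%N -> nth (fun=> 0) Xi m = X (bump i m).
    by move=> mn; rewrite Xi_del nth_del // /Xs size_map size_enum_ord ltnW.
  have valsE : [seq Y u | Y <- Xi] = del i v.
    by rewrite Xi_del map_del /Xs -map_comp.
  have dX m a : (m < size Xi)%N -> differentiable (fun u' => nth (fun=> 0) Xi m u' 0 a) u.
    rewrite sXi => mn; rewrite XiE //.
    have -> : bump i m = lift i (Ordinal mn) by [].
    by rewrite XE; exact: (smooth_on_differentiable (vsmooth_scoord (k := k) (l := l) (se _) a)).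
  have DJ w : size w = n -> differentiable (fun u' => Jloc u' w) u.
    by move=> sw; exact: (smooth_on_differentiable (Jloc_smooth sw)).
  have [D1 D2] := dird_mlinear (anchor (rho_at lrho u) (nth 0 v i))
    (fun u' => (altform_Jloc u').1) DJ dX (s0 := [::]) sXi.
  have nearE : \forall u' \near u, Jloc u' [seq Y u' | Y <- Xi] =
      ((fun y => J (fun q => e (lift i q) y)) \o chart_inv k) u'.
    have := near_coord_dom Uu; apply: filterS => u' Uu' /=.
    rewrite /Jloc; congr (J _); apply: functional_extensionality_dep => q.
    rewrite /Xi -map_comp (nth_map_ord 0 (fun m => scoord k l (e (lift i m)) u')).
    exact: frame_vec_scoord.
  rewrite (@tderiv_loc _ _ _ _ _ rho k l (e i)) //; last exact: differentiable_near nearE D1.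
  rewrite -vE -(dird_near _ nearE) D2 valsE /= sXi; congr (_ + _).
  by apply: eq_bigr => m _; rewrite XiE.
rewrite /Ed; under [X in X + _ = _]eq_bigr => i _ do rewrite first mulrDr.
rewrite big_split /= -addrA /dform; congr (_ + _).
have second (i j : 'I_n.+1) : (i < j)%N ->
   J (fun q : 'I_n => nth (fun=> 0) (br (e i) (e j) :: omit2 e i j) q (chart_inv k u)) =
   Jloc u (cbr (C_at lC u) (nth 0 v i) (nth 0 v j) :: del i (del j v))
   + Jloc u ((N i j - N j i) :: del i (del j v)).
  move=> ij; have hd : size (del i (del j v)) = n.-1.
    by rewrite size_del size_del sv //=; have := ltn_ord j; lia.
  have hn : (n.-1.+1 = n)%N by have := ltn_ord j; lia.
  have hm : (size (@nil 'rV[R]_r) + size (del i (del j v))).+1 = n by rewrite hd.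
  rewrite -(@mlinearD _ _ _ _ [::] _ _ _ (altform_Jloc u).1 hm) /=.
  rewrite -Jloc_sections //; last first.
    have he : size [seq e m | m <- enum 'I_n.+1] = n.+1 by rewrite size_map size_enum_ord.
    have hj : (j < n.+1)%N := ltn_ord j.
    by rewrite /= /omit2 omit2E // size_del ?size_del ?he //=; lia.
  congr (Jloc u _); rewrite /= /omit2 omit2E // (map_del _ i) (map_del _ j).
  rewrite -(map_comp (fun s => scoord k l s u) e).
  congr (_ :: _); rewrite (scoord_br brP) // /lbr /N !vE !XE.
  by rewrite addrA.
under [X in _ + X = _]eq_bigr => i _ do
  under eq_bigr => j ij do rewrite (second _ _ ij) mulrDr.
under [X in _ + X = _]eq_bigr => i _ do rewrite big_split.
by rewrite big_split /= addrCA (altform_connection N (altform_Jloc u) sv) addr0.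
Qed.

End LocalForms.

(** * The graded algebra at a point *)

Section Exponents.
Context {d r : nat}.
Variable n : nat.
Notation gen := (gen d r).
Notation expo := (expo d r).
Implicit Types (a b c m : expo) (v w : gen).

Definition expo0 : expo := [ffun=> 0%N].

Lemma expo_addC : commutative (@expo_add d r).
Proof. by move=> a b; apply/ffunP => v; rewrite !ffunE addnC. Qed.

Lemma expo_addA : associative (@expo_add d r).
Proof. by move=> a b c; apply/ffunP => v; rewrite !ffunE addnA. Qed.

Lemma expo_add0 a : expo_add expo0 a = a.
Proof. by apply/ffunP => v; rewrite !ffunE. Qed.

Lemma expo_addI a : injective (expo_add a).
Proof.
by move=> b c /ffunP e; apply/ffunP => v; have := e v; rewrite !ffunE => /addnI.
Qed.

(** Enumerated as in [gmul], so that products of formal functions are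
    convolutions. *)
Definition splits m : seq (expo * expo) :=
  [seq ([ffun v => h v : nat], [ffun v => (m v - h v)%N])
    | h : {dffun forall v : gen, 'I_(m v).+1}].

Lemma mem_splits m a b : ((a, b) \in splits m) = (expo_add a b == m).
Proof.
apply/idP/eqP => [/mapP[h _ [-> ->]]|<-].
  by apply/ffunP => v; rewrite !ffunE subnKC // -ltnS.
have lt v : (a v < (expo_add a b v).+1)%N by rewrite ffunE ltnS leq_addr.
apply/mapP; exists [ffun v => Ordinal (lt v)]; first by rewrite mem_enum.
have hv v : ([ffun v => Ordinal (lt v)] : {dffun forall v : gen, 'I_((expo_add a b) v).+1}) v = a v :> nat.
  exact: (congr1 val (ffunE (fun v => Ordinal (lt v)) v)).
congr (_, _); apply/ffunP => v; rewrite ffunE hv //.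
by rewrite ffunE addKn.
Qed.

Lemma splits_uniq m : uniq (splits m).
Proof.
rewrite map_inj_uniq ?enum_uniq // => h h' [] /ffunP e _.
by apply/ffunP => v; apply/val_inj; have := e v; rewrite !ffunE.
Qed.

Lemma admissible_addl a b : admissible n (expo_add a b) -> admissible n a.
Proof.
move=> /forallP h; apply/forallP => v; apply/implyP => ov.
by have /implyP/(_ ov) := h v; rewrite ffunE; apply: leq_trans; rewrite leq_addr.
Qed.

Lemma admissible_addr a b : admissible n (expo_add a b) -> admissible n b.
Proof. by rewrite expo_addC; exact: admissible_addl. Qed.

Lemma admissible0 : admissible n expo0.
Proof. by apply/forallP => v; rewrite ffunE implybT. Qed.

Lemma koszulDl a b c : koszul n (expo_add a b) c = (koszul n a c + koszul n b c)%N.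
Proof.
rewrite /koszul -big_split; apply: eq_bigr => v _ /=; rewrite -big_split.
by apply: eq_bigr => w _; rewrite ffunE mulnDl.
Qed.

Lemma koszulDr a b c : koszul n a (expo_add b c) = (koszul n a b + koszul n a c)%N.
Proof.
rewrite /koszul -big_split; apply: eq_bigr => v _ /=; rewrite -big_split.
by apply: eq_bigr => w _; rewrite ffunE mulnDr.
Qed.

(** For odd [v], these count the transpositions needed to move [v] to one end of a
    monomial or to the other; modulo two, [parity] is its degree. *)
Definition parity m := (\sum_(v | godd n v) m v)%N.
Definition before v m := (\sum_(w | godd n w && gbefore w v) m w)%N.
Definition after v m := (\sum_(w | godd n w && gbefore v w) m w)%N.

Lemma beforeD v a b : before v (expo_add a b) = (before v a + before v b)%N.
Proof. by rewrite /before -big_split; apply: eq_bigr => w _; rewrite ffunE. Qed.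

Lemma gbefore_lt3 v w : v != w -> gbefore v w = ~~ gbefore w v.
Proof.
move=> vw; rewrite /gbefore -leqNgt ltn_neqAle.
by rewrite (inj_eq val_inj) (inj_eq enum_rank_inj) vw.
Qed.

Lemma parity_split v m : godd n v -> parity m = (before v m + after v m + m v)%N.
Proof.
move=> ov; rewrite /parity (bigD1 v) //= addnC; congr (_ + _)%N.
rewrite (bigID (fun w => gbefore w v)) /=; congr (_ + _)%N.
  apply: eq_bigl => w; rewrite -andbA; case: eqVneq => [->|] //=.
  by rewrite /gbefore ltnn andbF.
apply: eq_bigl => w; rewrite -andbA; case: eqVneq => [->|wv] /=.
  by rewrite /gbefore ltnn andbF.
by rewrite [in RHS]gbefore_lt3 // eq_sym.
Qed.

Lemma koszul1l v m : koszul n (expo1 v) m = (godd n v * before v m)%N.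
Proof.
rewrite /koszul; have [ov|ov] := boolP (godd n v).
  rewrite (bigD1 v) //= [X in (_ + X)%N]big1 ?addn0 ?mul1n.
    by apply: eq_bigr => w _; rewrite ffunE eqxx mul1n.
  by move=> w /andP[_ wv]; rewrite big1 // => w' _; rewrite ffunE (negbTE wv).
rewrite mul0n big1 // => w ow; rewrite big1 // => w' _; rewrite ffunE.
by case: eqP => [e|//]; rewrite e (negbTE ov) in ow.
Qed.

Lemma koszul1r v m : koszul n m (expo1 v) = (godd n v * after v m)%N.
Proof.
rewrite /koszul; have [ov|ov] := boolP (godd n v); last first.
  rewrite mul0n big1 // => w ow; rewrite big1 // => w' /andP[ow' _]; rewrite ffunE.
  by case: eqP => [e|]; rewrite ?muln0 //; rewrite e (negbTE ov) in ow'.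
rewrite mul1n /after big_mkcondr; apply: eq_bigr => w ow; case: ifP => h.
  rewrite (bigD1 v) ?ov //= ffunE eqxx muln1 [X in (_ + X)%N]big1 ?addn0 // => w' /andP[_ wv].
  by rewrite ffunE (negbTE wv) muln0.
rewrite big1 // => w' /andP[_ h']; rewrite ffunE; case: eqP => [e|]; rewrite ?muln0 //.
by rewrite -e h' in h.
Qed.

Lemma koszul0l m : koszul n expo0 m = 0%N.
Proof. by rewrite /koszul big1 // => v _; rewrite big1 // => w _; rewrite ffunE. Qed.

Lemma koszul0r m : koszul n m expo0 = 0%N.
Proof. by rewrite /koszul big1 // => v _; rewrite big1 // => w _; rewrite ffunE muln0. Qed.

(** Moving a monomial past another one exchanges all pairs of odd coordinates. *)
Lemma koszulC a b : admissible n (expo_add a b) ->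
  (koszul n a b + koszul n b a = parity a * parity b)%N.
Proof.
move=> /forallP adm.
have -> : koszul n a b = (\sum_(v | godd n v) a v * before v b)%N.
  by apply: eq_bigr => v _; rewrite big_distrr.
have -> : koszul n b a = (\sum_(v | godd n v) a v * after v b)%N.
  rewrite /koszul (exchange_big_dep (godd n)) /=; last by move=> v w _ /andP[].
  apply: eq_bigr => v ov; rewrite big_distrr; apply: eq_big => [w|w _] /=.
    by rewrite ov.
  by rewrite mulnC.
rewrite -big_split {1}/parity big_distrl; apply: eq_bigr => v ov /=.
rewrite (parity_split b ov) !mulnDr; have /implyP/(_ ov) := adm v; rewrite ffunE.
by case: (a v) => [|[|x]]; case: (b v) => [|[|y]]; rewrite ?mul0n ?muln0 ?addn0.
Qed.

End Exponents.

Arguments expo0 {d r}.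

Section GradedAlgebra.
Context {R : realType} {d r : nat}.
Variable n : nat.
Notation gen := (gen d r).
Notation expo := (expo d r).

(** The fibre of [gfun] over one point of the base. The restriction to admissible
    exponents is what makes it an associative unital ring: elsewhere [gmul] is
    zero, so the unit law would fail. *)
Record galg : Type := Galg {
  gcoef :> expo -> R;
  gcoefP : forall m, ~~ admissible n m -> gcoef m = 0
}.

Lemma galgP (f g : galg) : (forall m, f m = g m) -> f = g.
Proof.
case: f g => [f fP] [g gP] /= /funext fg; rewrite fg in fP *.
by congr Galg; exact: Prop_irrelevance.
Qed.

HB.instance Definition _ := gen_eqMixin galg.
HB.instance Definition _ := gen_choiceMixin galg.

Lemma galg_add_subproof (f g : galg) m : ~~ admissible n m -> f m + g m = 0.
Proof. by move=> h; rewrite !gcoefP // addr0. Qed.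
Definition galg_add f g := Galg (@galg_add_subproof f g).

Lemma galg_opp_subproof (f : galg) m : ~~ admissible n m -> - f m = 0.
Proof. by move=> h; rewrite gcoefP // oppr0. Qed.
Definition galg_opp f := Galg (@galg_opp_subproof f).

Lemma galg_zero_subproof (m : expo) : ~~ admissible n m -> 0 = 0 :> R.
Proof. by []. Qed.
Definition galg_zero := Galg galg_zero_subproof.

Lemma galg_addA : associative galg_add.
Proof. by move=> f g h; apply: galgP => m; rewrite /= addrA. Qed.
Lemma galg_addC : commutative galg_add.
Proof. by move=> f g; apply: galgP => m; rewrite /= addrC. Qed.
Lemma galg_add0 : left_id galg_zero galg_add.
Proof. by move=> f; apply: galgP => m; rewrite /= add0r. Qed.
Lemma galg_addN : left_inverse galg_zero galg_opp galg_add.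
Proof. by move=> f; apply: galgP => m; rewrite /= addNr. Qed.

HB.instance Definition _ := GRing.isZmodule.Build galg
  galg_addA galg_addC galg_add0 galg_addN.

Lemma galg_scale_subproof c (f : galg) m : ~~ admissible n m -> c * f m = 0.
Proof. by move=> h; rewrite gcoefP // mulr0. Qed.
Definition galg_scale c f := Galg (@galg_scale_subproof c f).

Lemma galg_scaleA a b f : galg_scale a (galg_scale b f) = galg_scale (a * b) f.
Proof. by apply: galgP => m; rewrite /= mulrA. Qed.
Lemma galg_scale1 : left_id 1 galg_scale.
Proof. by move=> f; apply: galgP => m; rewrite /= mul1r. Qed.
Lemma galg_scaleDr : right_distributive galg_scale +%R.
Proof. by move=> a f g; apply: galgP => m; rewrite /= mulrDr. Qed.
Lemma galg_scaleDl f : {morph galg_scale^~ f : a b / a + b}.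
Proof. by move=> a b; apply: galgP => m; rewrite /= mulrDl. Qed.

HB.instance Definition _ := GRing.Zmodule_isLmodule.Build R galg
  galg_scaleA galg_scale1 galg_scaleDr galg_scaleDl.

Definition conv (f g : expo -> R) (m : expo) : R :=
  \sum_(p <- splits m) (-1) ^+ koszul n p.1 p.2 * f p.1 * g p.2.

Lemma galg_mul_subproof (f g : galg) m : ~~ admissible n m ->
  (if admissible n m then conv f g m else 0) = 0.
Proof. by move=> /negbTE->. Qed.
Definition galg_mul f g := Galg (@galg_mul_subproof f g).

Lemma galg_one_subproof (m : expo) : ~~ admissible n m -> (m == expo0)%:R = 0 :> R.
Proof. by case: (m =P expo0) => [->|]; rewrite ?admissible0. Qed.
Definition galg_one := Galg galg_one_subproof.

(** Both sides are sums over the ways of splitting [m] in three, with the Koszul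
    sign of the three pairs. *)
Lemma galg_mulA : associative galg_mul.
Proof.
move=> f g h; apply: galgP => m /=; case: ifP => // adm.
pose T (x y z : expo) : R :=
  (-1) ^+ (koszul n x y + koszul n x z + koszul n y z)%N * f x * g y * h z.
transitivity (\sum_(q <- [seq (p.1, t) | p <- splits m, t <- splits p.2]) T q.1 q.2.1 q.2.2).
  rewrite big_allpairs_dep /=; apply: eq_big_seq => -[a bc]; rewrite mem_splits => /eqP abm /=.
  have -> : admissible n bc by rewrite -abm in adm; exact: admissible_addr adm.
  rewrite /conv mulr_sumr; apply: eq_big_seq => -[b c]; rewrite mem_splits => /eqP <- /=.
  rewrite koszulDr /T !exprD.
  generalize ((-1) ^+ koszul n a b : R) ((-1) ^+ koszul n a c : R) ((-1) ^+ koszul n b c : R).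
  by generalize (gcoef f a) (gcoef g b) (gcoef h c) => ? ? ? ? ? ?; ring.
transitivity (\sum_(q <- [seq (t.1, (t.2, p.2)) | p <- splits m, t <- splits p.1])
    T q.1 q.2.1 q.2.2); last first.
  rewrite big_allpairs_dep /=; apply: eq_big_seq => -[ab c]; rewrite mem_splits => /eqP abm /=.
  have -> : admissible n ab by rewrite -abm in adm; exact: admissible_addl adm.
  rewrite /conv mulr_sumr mulr_suml; apply: eq_big_seq => -[a b]; rewrite mem_splits => /eqP <- /=.
  rewrite koszulDl /T !exprD.
  generalize ((-1) ^+ koszul n a b : R) ((-1) ^+ koszul n a c : R) ((-1) ^+ koszul n b c : R).
  by generalize (gcoef f a) (gcoef g b) (gcoef h c) => ? ? ? ? ? ?; ring.
apply: perm_big; apply: uniq_perm.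
- apply: allpairs_uniq_dep => [|p _|]; rewrite ?splits_uniq //.
  move=> _ _ /allpairsPdep[[a x] [[b c] [_ hx ->]]] /allpairsPdep[[a' x'] [[b' c'] [_ hx' ->]]] /=.
  move=> [ea eb ec]; move: hx hx'; rewrite !mem_splits /= => /eqP <- /eqP <-.
  by rewrite ea eb ec.
- apply: allpairs_uniq_dep => [|p _|]; rewrite ?splits_uniq //.
  move=> _ _ /allpairsPdep[[x a] [[b c] [_ hx ->]]] /allpairsPdep[[x' a'] [[b' c'] [_ hx' ->]]] /=.
  move=> [ea eb ec]; move: hx hx'; rewrite !mem_splits /= => /eqP <- /eqP <-.
  by rewrite ea eb ec.
- move=> [a [b c]]; apply/allpairsPdep/allpairsPdep.
    move=> [[a' x] [[b' c'] [h1 h2 /= [-> -> ->]]]].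
    move: h1 h2; rewrite !mem_splits /= => /eqP h1 /eqP h2.
    exists (expo_add a' b', c'), (a', b'); rewrite !mem_splits /= eqxx; split => //.
    by rewrite -expo_addA h2 h1.
  move=> [[x c'] [[a' b'] [h1 h2 /= [-> -> ->]]]].
  move: h1 h2; rewrite !mem_splits /= => /eqP h1 /eqP h2.
  exists (a', expo_add b' c'), (b', c'); rewrite !mem_splits /= eqxx; split => //.
  by rewrite expo_addA h2 h1.
Qed.

Lemma conv_expo0l (g : expo -> R) m : conv (fun a => (a == expo0)%:R) g m = g m.
Proof.
have in0 : (expo0, m) \in splits m by rewrite mem_splits expo_add0.
rewrite /conv (bigD1_seq _ in0 (splits_uniq m)) /= eqxx koszul0l mul1r mul1r.
rewrite big_seq_cond big1 ?addr0 // => -[a b] /=; rewrite mem_splits => /andP[/eqP <-].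
by case: (eqVneq a expo0) => [->|]; rewrite ?expo_add0 ?eqxx // mulr0 mul0r.
Qed.

Lemma conv_expo0r (f : expo -> R) m : conv f (fun a => (a == expo0)%:R) m = f m.
Proof.
have in0 : (m, expo0) \in splits m by rewrite mem_splits expo_addC expo_add0.
rewrite /conv (bigD1_seq _ in0 (splits_uniq m)) /= eqxx koszul0r mul1r mulr1.
rewrite big_seq_cond big1 ?addr0 // => -[a b] /=; rewrite mem_splits => /andP[/eqP <-].
by case: (eqVneq b expo0) => [->|]; rewrite ?mulr0 // expo_addC expo_add0 eqxx.
Qed.

Lemma galg_mul1 : left_id galg_one galg_mul.
Proof.
move=> f; apply: galgP => m /=; case: ifPn => [_|adm]; last by rewrite gcoefP.
exact: conv_expo0l.
Qed.

Lemma galg_mulr1 : right_id galg_one galg_mul.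
Proof.
move=> f; apply: galgP => m /=; case: ifPn => [_|adm]; last by rewrite gcoefP.
exact: conv_expo0r.
Qed.

Lemma galg_mulDl : left_distributive galg_mul +%R.
Proof.
move=> f g h; apply: galgP => m /=; case: ifP => _; last by rewrite addr0.
by rewrite /conv -big_split; apply: eq_bigr => p _ /=; rewrite mulrDr mulrDl.
Qed.

Lemma galg_mulDr : right_distributive galg_mul +%R.
Proof.
move=> f g h; apply: galgP => m /=; case: ifP => _; last by rewrite addr0.
by rewrite /conv -big_split; apply: eq_bigr => p _ /=; rewrite mulrDr.
Qed.

Lemma galg_one_neq0 : galg_one != 0.
Proof.
apply/eqP => /(congr1 (fun f : galg => f expo0)) /=; rewrite eqxx => /eqP.
by rewrite oner_eq0.
Qed.

HB.instance Definition _ := GRing.Zmodule_isNzRing.Build galg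
  galg_mulA galg_mul1 galg_mulr1 galg_mulDl galg_mulDr galg_one_neq0.

Lemma galg_scaleAl (c : R) (f g : galg) : c *: (f * g) = c *: f * g.
Proof.
apply: galgP => m /=; case: ifP => _; last by rewrite mulr0.
by rewrite /conv mulr_sumr; apply: eq_bigr => p _; rewrite /= !mulrA [c * _]mulrC.
Qed.

HB.instance Definition _ := GRing.Lmodule_isLalgebra.Build R galg galg_scaleAl.

Lemma galg_scaleAr (c : R) (f g : galg) : c *: (f * g) = f * (c *: g).
Proof.
apply: galgP => m /=; case: ifP => _; last by rewrite mulr0.
by rewrite /conv mulr_sumr; apply: eq_bigr => p _; rewrite /= mulrCA.
Qed.

HB.instance Definition _ := GRing.Lalgebra_isAlgebra.Build R galg galg_scaleAr.

End GradedAlgebra.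

(** * Gradings and derivatives *)

Section Shift.
Context {R : realType} {d r : nat}.
Notation gen := (gen d r).
Notation expo := (expo d r).

(** Splitting [m] times [v] with [v] in the left factor, counted with the
    multiplicity of [v] there, is splitting [m]. This is the combinatorial
    content of the Leibniz rule. *)
Lemma splits_shiftl (v : gen) (m : expo) (T : expo -> expo -> R) :
  \sum_(p <- splits (expo_add m (expo1 v))) (p.1 v)%:R * T p.1 p.2 =
  \sum_(p <- splits m) (p.1 v).+1%:R * T (expo_add p.1 (expo1 v)) p.2.
Proof.
rewrite (bigID (fun p : expo * expo => (0 < p.1 v)%N)) /= [X in _ + X]big1 ?addr0; last first.
  by move=> p; rewrite -eqn0Ngt => /eqP ->; rewrite mul0r.
rewrite -big_filter.
transitivity (\sum_(p <- [seq (expo_add p.1 (expo1 v), p.2) | p <- splits m]) (p.1 v)%:R * T p.1 p.2).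
  apply: perm_big; apply: uniq_perm.
  - by rewrite filter_uniq // splits_uniq.
  - rewrite map_inj_uniq ?splits_uniq // => -[a b] [a' b'] [].
    by rewrite ![expo_add _ (expo1 v)]expo_addC => /expo_addI -> ->.
  - move=> [a b]; rewrite mem_filter mem_splits /=; apply/andP/mapP.
      move=> [a0 /eqP abm]; pose a' : expo := [ffun w => (a w - expo1 v w)%N].
      have aE : expo_add a' (expo1 v) = a.
        apply/ffunP => w; rewrite !ffunE subnK //.
        by case: eqP => // ->.
      exists (a', b); last by rewrite /= aE.
      rewrite mem_splits; apply/eqP/(expo_addI (a := expo1 v)).
      by rewrite expo_addA [expo_add _ a']expo_addC aE abm expo_addC.
    move=> [[a' b'] h [-> ->]] /=; move: h; rewrite mem_splits => /eqP <-.
    rewrite !ffunE eqxx addn1; split => //; apply/eqP.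
    by rewrite -!expo_addA [expo_add _ b']expo_addC.
rewrite big_map; apply: eq_bigr => p _ /=.
by rewrite !ffunE eqxx addn1.
Qed.

Lemma splits_swap (m : expo) (T : expo -> expo -> R) :
  \sum_(p <- splits m) T p.1 p.2 = \sum_(p <- splits m) T p.2 p.1.
Proof.
transitivity (\sum_(p <- [seq (p.2, p.1) | p <- splits m]) T p.1 p.2); last by rewrite big_map.
apply: perm_big; apply: uniq_perm; first exact: splits_uniq.
  by rewrite map_inj_uniq ?splits_uniq // => -[a b] [a' b'] [-> ->].
move=> [a b]; rewrite mem_splits; apply/idP/mapP.
  by exists (b, a) => //; rewrite mem_splits expo_addC.
by move=> [[a' b'] h [-> ->]] /=; move: h; rewrite mem_splits expo_addC.
Qed.

Lemma splits_shiftr (v : gen) (m : expo) (T : expo -> expo -> R) :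
  \sum_(p <- splits (expo_add m (expo1 v))) (p.2 v)%:R * T p.1 p.2 =
  \sum_(p <- splits m) (p.2 v).+1%:R * T p.1 (expo_add p.2 (expo1 v)).
Proof.
rewrite (splits_swap _ (fun a b => (b v)%:R * T a b)).
rewrite (splits_shiftl _ _ (fun a b => T b a)).
by rewrite (splits_swap _ (fun a b => (a v).+1%:R * T b (expo_add a (expo1 v)))).
Qed.

End Shift.

Section GradedOperations.
Context {R : realType} {d r : nat}.
Variable n : nat.
Notation gen := (gen d r).
Notation expo := (expo d r).
Notation A := (@galg R d r n).
Implicit Types (f g h : A) (v w : gen) (m : expo).

Lemma gaddE f g m : (f + g) m = f m + g m. Proof. by []. Qed.
Lemma gscaleE c f m : (c *: f) m = c * f m. Proof. by []. Qed.
Lemma gzeroE m : (0 : A) m = 0. Proof. by []. Qed.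
Lemma goneE m : (1 : A) m = (m == expo0)%:R. Proof. by []. Qed.
Lemma gmulE f g m : admissible n m -> (f * g) m = conv n f g m.
Proof. by move=> adm; rewrite -[LHS]/(if _ then _ else _) adm. Qed.

Lemma gsumE (I : Type) (s : seq I) (P : pred I) (F : I -> A) m :
  (\sum_(i <- s | P i) F i) m = \sum_(i <- s | P i) F i m.
Proof. by elim/big_rec2: _ => // i x y _ <-. Qed.

(** Weights in an arbitrary group: besides the degree, weights counting only some
    of the coordinates express that others do not occur. *)
Definition homog (V : zmodType) (w : gen -> V) (k : V) f :=
  forall m, f m != 0 -> \sum_v w v *+ m v = k.

Section Homog.
Context {V : zmodType} {w : gen -> V}.

Lemma weightD m1 m2 : \sum_v w v *+ (expo_add m1 m2) v =
  \sum_v w v *+ m1 v + \sum_v w v *+ m2 v.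
Proof. by rewrite -big_split; apply: eq_bigr => v _; rewrite ffunE mulrnDr. Qed.

Lemma weight1 v : \sum_u w u *+ (expo1 v) u = w v.
Proof.
rewrite (bigD1 v) //= ffunE eqxx mulr1n big1 ?addr0 // => u uv.
by rewrite ffunE (negbTE uv).
Qed.

Lemma weight0 : \sum_u w u *+ (@expo0 d r) u = 0.
Proof. by rewrite big1 // => u _; rewrite ffunE. Qed.

Lemma homogD k f g : homog w k f -> homog w k g -> homog w k (f + g).
Proof.
move=> hf hg m; rewrite gaddE; have [f0|/hf//] := eqVneq (f m) 0.
by rewrite f0 add0r; exact: hg.
Qed.

Lemma homogZ k c f : homog w k f -> homog w k (c *: f).
Proof. by move=> hf m; rewrite gscaleE mulf_eq0 negb_or => /andP[_ /hf]. Qed.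

Lemma homogN k f : homog w k f -> homog w k (- f).
Proof. by move=> hf; rewrite -scaleN1r; exact: homogZ. Qed.

Lemma homog0 k : homog w k 0.
Proof. by move=> m; rewrite gzeroE eqxx. Qed.

Lemma homog_sum k (I : Type) (s : seq I) (P : pred I) (F : I -> A) :
  (forall i, P i -> homog w k (F i)) -> homog w k (\sum_(i <- s | P i) F i).
Proof. by move=> hF; apply: big_ind => //; [exact: homog0|move=> ? ?; exact: homogD]. Qed.

Lemma homogM j k f g : homog w j f -> homog w k g -> homog w (j + k) (f * g).
Proof.
move=> hf hg m fg0.
have adm : admissible n m by apply: contraTT fg0 => /gcoefP->; rewrite eqxx.
have [p] : exists p, p \in splits m /\ (f p.1 != 0) && (g p.2 != 0).
  apply: contrapT => H; move: fg0; rewrite gmulE // /conv big_seq big1 ?eqxx // => p ps.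
  have [fp|fp] := eqVneq (f p.1) 0; first by rewrite fp mulr0 mul0r.
  have [gp|gp] := eqVneq (g p.2) 0; first by rewrite gp mulr0.
  by exfalso; apply: H; exists p; rewrite fp gp.
case: p => a b [] /=; rewrite mem_splits => /eqP <- /andP[/hf fa /hg gb].
by rewrite weightD fa gb.
Qed.

Lemma homog1 : homog w 0 1.
Proof.
move=> m; rewrite goneE; case: (m =P expo0) => [-> _|]; last by rewrite eqxx.
exact: weight0.
Qed.

End Homog.

Lemma admissible1 v : admissible n (expo1 v).
Proof. by apply/forallP => w; rewrite ffunE; case: (w == v); rewrite implybT. Qed.

Lemma gX_subproof v m : ~~ admissible n m -> (m == expo1 v)%:R = 0 :> R.
Proof. by case: (m =P expo1 v) => [->|]; rewrite ?admissible1. Qed.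
Definition gX v : A := Galg (@gX_subproof v).

Lemma gXE v m : gX v m = (m == expo1 v)%:R. Proof. by []. Qed.

Lemma homogX (V : zmodType) (w : gen -> V) v : homog w (w v) (gX v).
Proof.
move=> m; rewrite gXE; case: (m =P expo1 v) => [-> _|]; last by rewrite eqxx.
exact: weight1.
Qed.

Lemma gder_subproof v f m : ~~ admissible n m ->
  (-1) ^+ (godd n v * before n v m)%N * (m v).+1%:R * f (expo_add m (expo1 v)) = 0.
Proof.
move=> adm; rewrite (gcoefP f) ?mulr0 //.
by apply: contra adm; exact: admissible_addl.
Qed.
Definition gder v f : A := Galg (@gder_subproof v f).

Lemma gderE v f m : gder v f m =
  (-1) ^+ (godd n v * before n v m)%N * (m v).+1%:R * f (expo_add m (expo1 v)).
Proof. by []. Qed.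

Lemma gder_is_linear v : linear (gder v).
Proof.
move=> c f g; apply: galgP => m; rewrite gaddE gscaleE !gderE gaddE gscaleE.
by rewrite mulrDr mulrCA.
Qed.
HB.instance Definition _ v := GRing.isLinear.Build R A A *:%R (gder v) (gder_is_linear v).

Lemma homog_gder (V : zmodType) (w : gen -> V) k v f : homog w k f ->
  homog w (k - w v) (gder v f).
Proof.
move=> hf m; rewrite gderE mulf_eq0 negb_or => /andP[_ /hf] <-.
by rewrite weightD weight1 addrK.
Qed.

Definition oddz (k : int) : bool := odd `|k|%N.

Lemma oddzD j k : oddz (j + k) = oddz j (+) oddz k.
Proof. rewrite /oddz; lia. Qed.

Lemma oddz_parity m : oddz (\sum_v gdeg n v *+ m v) = odd (parity n m).
Proof.
have E (s : seq gen) : oddz (\sum_(v <- s) gdeg n v *+ m v) =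
    odd (\sum_(v <- s | godd n v) m v).
  elim: s => [|v s IH]; first by rewrite !big_nil.
  rewrite !big_cons oddzD IH; set x := odd (\sum_(_ <- _ | _) _).
  have -> : oddz (gdeg n v *+ m v) = godd n v && odd (m v).
    by rewrite /oddz -mulr_natr natz abszM oddM absz_nat.
  by case: ifP => //=; rewrite oddD.
exact: E.
Qed.

Lemma signr_eq (x y : nat) : odd x = odd y -> (-1) ^+ x = (-1) ^+ y :> R.
Proof. by move=> e; rewrite -signr_odd e signr_odd. Qed.

(** The sign of exchanging two monomials is the product of their parities, which is
    constant on homogeneous elements. *)
Lemma gmulC j k f g : homog (gdeg n) j f -> homog (gdeg n) k g ->
  f * g = (-1) ^+ (oddz j && oddz k) *: (g * f).
Proof.
move=> hf hg; apply: galgP => m; rewrite gscaleE.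
have [adm|adm] := boolP (admissible n m); last by rewrite !gcoefP ?mulr0.
rewrite !gmulE // /conv (splits_swap _ (fun a b => (-1) ^+ koszul n a b * g a * f b)).
rewrite mulr_sumr; apply: eq_big_seq => -[a b]; rewrite mem_splits /= => /eqP abm.
have [fa|fa] := eqVneq (f a) 0; first by rewrite fa !(mulr0, mul0r).
have [gb|gb] := eqVneq (g b) 0; first by rewrite gb !(mulr0, mul0r).
rewrite -(hf a fa) -(hg b gb) !oddz_parity mulrAC !mulrA; congr (_ * _ * _).
rewrite -exprD; apply: signr_eq; rewrite -abm in adm.
have /(congr1 odd) := koszulC adm; rewrite !oddD oddM oddb => <-.
by case: (odd _); case: (odd _).
Qed.

(** On both sides, the coefficient at [m] is a sum over
    the ways of splitting [m] times [v]; the one factor in which [v] is removed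
    determines the sign. *)
Lemma gder_mul j v f g : homog (gdeg n) j f ->
  gder v (f * g) = gder v f * g + (-1) ^+ (godd n v && oddz j) *: (f * gder v g).
Proof.
move=> hf; apply: galgP => m; rewrite gaddE gscaleE.
have [adm|adm] := boolP (admissible n m); last by rewrite !gcoefP ?mulr0 ?addr0.
rewrite !gmulE // gderE.
set e := expo1 v; pose T a b := (-1) ^+ koszul n a b * f a * g b.
have before_e : before n v e = 0%N.
  rewrite /before big1 // => w /andP[_ wv]; rewrite ffunE; case: eqP => // wE.
  by rewrite wE /gbefore ltnn in wv.
have E1 : conv n (gder v f) g m = \sum_(p <- splits (expo_add m e)) (p.1 v)%:R *
    ((-1) ^+ (godd n v * (before n v p.1 + before n v p.2))%N * T p.1 p.2).
  rewrite (splits_shiftl v m (fun a b =>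
    (-1) ^+ (godd n v * (before n v a + before n v b))%N * T a b)).
  apply: eq_bigr => -[a b] _; rewrite [fst _]/= [snd _]/= gderE /T koszulDl koszul1l beforeD before_e addn0.
  have -> : (-1) ^+ (godd n v * (before n v a + before n v b))%N =
     (-1) ^+ (godd n v * before n v a)%N * (-1) ^+ (godd n v * before n v b)%N :> R.
    by rewrite -exprD mulnDr.
  rewrite exprD; set s := (-1) ^+ (godd n v * before n v b)%N.
  have ss : s * s = 1 by rewrite /s -expr2 sqrr_sign.
  generalize ((-1) ^+ (godd n v * before n v a)%N : R) ((-1) ^+ koszul n a b : R).
  generalize (gcoef f (expo_add a (expo1 v))) (gcoef g b) => F G x y.
  transitivity (y * (x * (a v).+1%:R * F) * G * (s * s)); first by rewrite ss mulr1.
  by ring.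
have E2 : conv n f (gder v g) m = \sum_(p <- splits (expo_add m e)) (p.2 v)%:R *
    ((-1) ^+ (godd n v * (after n v p.1 + before n v p.2))%N * T p.1 p.2).
  rewrite (splits_shiftr v m (fun a b =>
    (-1) ^+ (godd n v * (after n v a + before n v b))%N * T a b)).
  apply: eq_bigr => -[a b] _; rewrite [fst _]/= [snd _]/= gderE /T koszulDr koszul1r beforeD before_e addn0.
  have -> : (-1) ^+ (godd n v * (after n v a + before n v b))%N =
     (-1) ^+ (godd n v * after n v a)%N * (-1) ^+ (godd n v * before n v b)%N :> R.
    by rewrite -exprD mulnDr.
  rewrite exprD; set s := (-1) ^+ (godd n v * after n v a)%N.
  have ss : s * s = 1 by rewrite /s -expr2 sqrr_sign.
  generalize ((-1) ^+ (godd n v * before n v b)%N : R) ((-1) ^+ koszul n a b : R).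
  generalize (gcoef f a) (gcoef g (expo_add b (expo1 v))) => F G x y.
  transitivity (y * F * (x * (b v).+1%:R * G) * (s * s)); first by rewrite ss mulr1.
  by ring.
have -> : conv n (gder v f) g m + (-1) ^+ (godd n v && oddz j) * conv n f (gder v g) m =
    \sum_(p <- splits (expo_add m e)) (-1) ^+ (godd n v * before n v m)%N *
      ((p.1 v)%:R + (-1) ^+ (godd n v * p.1 v)%N * (p.2 v)%:R) * T p.1 p.2.
  rewrite E1 E2 mulr_sumr -big_split; apply: eq_big_seq => -[a b].
  rewrite mem_splits /= => /eqP abm.
  have -> : before n v m = (before n v a + before n v b)%N.
    by rewrite -beforeD abm beforeD before_e addn0.
  have [fa|fa] := eqVneq (f a) 0; first by rewrite /T fa !(mulr0, mul0r, addr0).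
  have sE : (-1) ^+ (godd n v && oddz j) * (-1) ^+ (godd n v * (after n v a + before n v b))%N =
     (-1) ^+ (godd n v * (before n v a + before n v b))%N * (-1) ^+ (godd n v * a v)%N :> R.
    rewrite -!exprD; apply: signr_eq; rewrite -(hf a fa) oddz_parity.
    have [ov|] := boolP (godd n v); last by rewrite !mul0n.
    rewrite (parity_split a ov) !mul1n !oddD oddb ?oddD /=.
    by do 4 case: (odd _).
  have aux (s1 s2 s3 s4 x y t : R) : s1 * s2 = s3 * s4 ->
      x * (s3 * t) + s1 * (y * (s2 * t)) = s3 * (x + s4 * y) * t.
    move=> ss; transitivity (s3 * x * t + (s1 * s2) * y * t); first by ring.
    by rewrite ss; ring.
  exact: aux.
have [adm'|adm'] := boolP (admissible n (expo_add m e)).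
  rewrite gmulE // /conv mulr_sumr; apply: eq_big_seq => -[a b].
  rewrite mem_splits /= => /eqP abm; rewrite -/(T a b); congr (_ * _ * _).
  have mv : (m v).+1 = (a v + b v)%N.
    by have /ffunP/(_ v) := abm; rewrite !ffunE eqxx addn1 => ->.
  rewrite mv natrD; congr (_ + _).
  have [ov|ov] := boolP (godd n v); last by rewrite mul0n mul1r.
  have := forallP adm' v; rewrite ov -abm ffunE /= mul1n.
  by case: (a v) => [|x]; [rewrite mul1r|case: (b v) => [|y]; rewrite ?mulr0 // addnS].
rewrite gcoefP // mulr0 big_seq big1 // => -[a b]; rewrite mem_splits /= => /eqP abm.
have /existsP[w] : [exists w, ~~ (godd n w ==> (expo_add m e w <= 1)%N)].
  by rewrite -negb_forall.
rewrite negb_imply ffunE => /andP[ow].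
have := forallP adm w; rewrite ow /= => mw; rewrite ffunE.
have [wv|wv] := eqVneq w v; last by rewrite addn0 mw.
rewrite wv in ow mw * => mv.
have [fa|fa] := eqVneq (f a) 0; first by rewrite /T fa !(mulr0, mul0r).
have [gb|gb] := eqVneq (g b) 0; first by rewrite /T gb !mulr0.
have /forallP/(_ v) : admissible n a by apply: contraTT fa => /gcoefP->; rewrite eqxx.
have /forallP/(_ v) : admissible n b by apply: contraTT gb => /gcoefP->; rewrite eqxx.
rewrite ow /= => bv av.
have abv : (a v + b v = m v + 1)%N by have /ffunP/(_ v) := abm; rewrite !ffunE eqxx.
have [-> ->] : a v = 1%N /\ b v = 1%N.
  move: mv mw av bv abv; rewrite /= !addn1; move: (m v) (a v) (b v) => x y z.
  by case: x => [//|[|//]]; case: y => [|[|//]]; case: z => [|[|//]].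
by rewrite mul1n expr1 mulN1r subrr mulr0 mul0r.
Qed.

Lemma gder_X v w : gder v (gX w) = (v == w)%:R.
Proof.
apply: galgP => m; rewrite gderE gXE.
have [->|vw] := eqVneq v w.
  have -> : (expo_add m (expo1 w) == expo1 w) = (m == expo0).
    apply/eqP/eqP => [e|->]; last exact: expo_add0.
    by apply: (expo_addI (a := expo1 w)); rewrite expo_addC e expo_addC expo_add0.
  rewrite goneE; case: (eqVneq m expo0) => [->|_]; last by rewrite mulr0.
  rewrite ffunE mulr1 mulr1 (_ : before n w expo0 = 0%N) ?muln0 //.
  by rewrite /before big1 // => u _; rewrite ffunE.
rewrite gzeroE (_ : (_ == _) = false) ?mulr0 //; apply/eqP => /ffunP/(_ v).
by rewrite !ffunE eqxx (negbTE vw) addn1.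
Qed.

Lemma gder1 v : gder v 1 = 0.
Proof.
apply: galgP => m; rewrite gderE goneE gzeroE (_ : (_ == _) = false) ?mulr0 //.
by apply/eqP => /ffunP/(_ v); rewrite !ffunE eqxx addn1.
Qed.

End GradedOperations.

(** * The exponential of a vertical vector field *)

Section Derivation.
Context {R : realType} {d r : nat}.
Variable n : nat.
Notation gen := (gen d r).
Notation expo := (expo d r).
Notation A := (@galg R d r n).
Notation X := (gX n).
Implicit Types (f g h b : A) (v w : gen) (m : expo).

(** No coordinate satisfying [P] occurs in [b]. Stated as homogeneity of weight
    zero, so that it inherits the closure properties of gradings. *)
Definition avoids (P : pred gen) b := homog (fun v => (P v)%:R : int) 0 b.

Lemma avoidsP (P : pred gen) b m v : avoids P b -> P v -> b m != 0 -> m v = 0%N.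
Proof.
move=> hb hv /hb e; apply/eqP; move: e; rewrite (bigD1 v) //= hv.
set s := \sum_(_ | _) _ => e; have s0 : 0 <= s.
  by apply: sumr_ge0 => w _; rewrite mulrn_wge0 // ler0n.
move/eqP: e; rewrite paddr_eq0 // ?mulrn_wge0 //.
by rewrite -mulr_natr mul1r pnatr_eq0 => /andP[].
Qed.

Lemma avoids_gder (P : pred gen) b v : avoids P b -> P v -> gder v b = 0.
Proof.
move=> hb hv; apply: galgP => m; rewrite gderE gzeroE.
have [->|/(avoidsP hb hv)] := eqVneq (b (expo_add m (expo1 v))) 0; first by rewrite mulr0.
by rewrite !ffunE eqxx addn1.
Qed.

Lemma avoids_gderW (P : pred gen) b v : avoids P b -> ~~ P v -> avoids P (gder v b).
Proof.
move=> hb /negbTE hv; have := homog_gder (v := v) hb.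
by rewrite hv subr0.
Qed.

Lemma avoidsM (P : pred gen) b g : avoids P b -> avoids P g -> avoids P (b * g).
Proof. by move=> hb hg; have := homogM hb hg; rewrite addr0. Qed.

Lemma avoidsX (P : pred gen) v : ~~ P v -> avoids P (X v).
Proof.
move=> /negbTE hv; have := @homogX R d r n _ (fun v => (P v)%:R : int) v.
by rewrite hv.
Qed.

Definition basic b := avoids (@is_momentum d r) b.

(** The images of the coordinates under the derivation [gD]: only momenta are
    moved, and their images contain no momenta, so that the derivation squares
    to zero on each coordinate. *)
Variable c : gen -> A.
Hypothesis c_deg : forall v, homog (gdeg n) (gdeg n v) (c v).
Hypothesis c_basic : forall v, basic (c v).
Hypothesis c_pos : forall v, ~~ is_momentum v -> c v = 0.

Definition gD f : A := \sum_v c v * gder v f.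

Lemma gD_is_linear : linear gD.
Proof.
move=> a f g; rewrite /gD scaler_sumr -big_split; apply: eq_bigr => v _ /=.
by rewrite linearP mulrDr scalerAr.
Qed.
HB.instance Definition _ := GRing.isLinear.Build R A A *:%R gD gD_is_linear.

Lemma sign_scale2 (s : bool) f : (-1) ^+ s *: ((-1) ^+ s *: f) = f.
Proof. by rewrite scalerA -expr2 sqrr_sign scale1r. Qed.

Lemma gD_mul j f g : homog (gdeg n) j f ->
  gD (f * g) = gD f * g + f * gD g.
Proof.
move=> hf; rewrite /gD mulr_suml mulr_sumr -big_split; apply: eq_bigr => v _ /=.
rewrite (gder_mul v g hf) mulrDr mulrA; congr (_ + _).
by rewrite -scalerAr [c v * (f * _)]mulrA (gmulC (@c_deg v) hf) -scalerAl sign_scale2 mulrA.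
Qed.

Lemma gD_X v f : gD (X v * f) = c v * f + X v * gD f.
Proof.
rewrite (gD_mul f (@homogX R d r n _ (gdeg n) v)); congr (_ * _ + _).
rewrite /gD (bigD1 v) //= gder_X eqxx mulr1 big1 ?addr0 // => w /negbTE wv.
by rewrite gder_X wv mulr0.
Qed.

Lemma gD_basic b : basic b -> gD b = 0.
Proof.
move=> hb; rewrite /gD big1 // => v _; have [hv|/c_pos->] := boolP (is_momentum v).
  by rewrite (avoids_gder (P := @is_momentum d r)) // mulr0.
by rewrite mul0r.
Qed.

Lemma gD1 : gD 1 = 0.
Proof. by apply: gD_basic; exact: homog1. Qed.

Lemma gD_c v f : gD (c v * f) = c v * gD f.
Proof. by rewrite (gD_mul f (@c_deg v)) gD_basic // mul0r add0r. Qed.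

Lemma iter_gD0 k : iter k gD 0 = 0.
Proof. by elim: k => //= k ->; rewrite linear0. Qed.

(** The binomial formula stops after the first term, since [gD] kills [c v]. *)
Lemma iter_gD_X k v f :
  iter k gD (X v * f) = X v * iter k gD f + k%:R *: (c v * iter k.-1 gD f).
Proof.
elim: k => [|k IH]; first by rewrite scale0r addr0.
rewrite iterS IH linearD linearZ /= gD_X gD_c [k.+1%:R]mulrS scalerDl scale1r.
rewrite [c v * _ + X v * _]addrC -addrA; congr (_ + (_ + _)).
by case: k {IH} => [|k]; rewrite ?scale0r.
Qed.

Definition no_mom m := [forall v, is_momentum v ==> (m v == 0%N)].

Lemma gproj_subproof f m : ~~ admissible n m -> (if no_mom m then f m else 0) = 0.
Proof. by move=> adm; rewrite gcoefP ?if_same. Qed.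
Definition gproj f : A := Galg (@gproj_subproof f).

Lemma gprojE f m : gproj f m = if no_mom m then f m else 0.
Proof. by []. Qed.

Lemma gproj_is_linear : linear gproj.
Proof.
move=> a f g; apply: galgP => m; rewrite gaddE gscaleE !gprojE.
by case: ifP => _; rewrite ?mulr0 ?addr0.
Qed.
HB.instance Definition _ := GRing.isLinear.Build R A A *:%R gproj gproj_is_linear.

Lemma no_momP m : reflect (forall v, is_momentum v -> m v = 0%N) (no_mom m).
Proof.
apply: (iffP forallP) => h v; first by move=> hv; apply/eqP; have /implyP := h v; exact.
by apply/implyP => /h ->.
Qed.

Lemma no_mom_add m1 m2 : no_mom (expo_add m1 m2) = no_mom m1 && no_mom m2.
Proof.
apply/no_momP/andP => [h|[/no_momP h1 /no_momP h2] v hv]; last by rewrite ffunE h1 ?h2.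
split; apply/no_momP => v hv; have /eqP := h v hv; rewrite ffunE addn_eq0;
  by case/andP => /eqP ? /eqP.
Qed.

Lemma gproj_X v f : is_momentum v -> gproj (X v * f) = 0.
Proof.
move=> hv; apply: galgP => m; rewrite gprojE gzeroE; case: ifP => // hm.
have [adm|adm] := boolP (admissible n m); last by rewrite gcoefP.
rewrite gmulE // /conv big_seq big1 // => -[a b]; rewrite mem_splits /= => /eqP abm.
case: eqP => [aE|]; rewrite ?mulr0 ?mul0r //.
move: hm; rewrite -abm no_mom_add aE => /andP[/no_momP/(_ v hv)].
by rewrite ffunE eqxx.
Qed.

Lemma gproj_basic b f : basic b -> gproj (b * f) = b * gproj f.
Proof.
move=> hb; apply: galgP => m; rewrite gprojE.
have [adm|adm] := boolP (admissible n m); last by rewrite !gcoefP ?if_same.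
rewrite !gmulE //; have [hm|hm] := boolP (no_mom m); last first.
  rewrite /conv big_seq big1 // => -[a a']; rewrite mem_splits /= => /eqP abm.
  have [->|ba] := eqVneq (b a) 0; first by rewrite mulr0 mul0r.
  move: hm; rewrite -abm no_mom_add negb_and => /orP[/negP[]|/negbTE->].
    by apply/no_momP => v hv; exact: avoidsP hb hv ba.
  by rewrite mulr0.
apply: eq_big_seq => -[a a']; rewrite mem_splits /= => /eqP abm.
by move: hm; rewrite -abm no_mom_add => /andP[_ ->].
Qed.

Definition word (s : seq gen) : A := \prod_(v <- s) X v.

Lemma word_cons v s : word (v :: s) = X v * word s.
Proof. by rewrite /word big_cons. Qed.

Lemma iter_gD_word k s : (size s < k)%N -> iter k gD (word s) = 0.
Proof.
elim: s k => [|v s IH] [//|k] ks.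
  by rewrite iterSr /word big_nil gD1 iter_gD0.
have hs : (size s < k)%N by [].
by rewrite word_cons iter_gD_X (IH _ hs) (IH k.+1 (ltnW hs)) !mulr0 scaler0 addr0.
Qed.

(** On a product of momenta, the exponential of the vector field replaces every
    momentum by its image, up to terms that still contain momenta. *)
Lemma gproj_iter_word k s : all (@is_momentum d r) s ->
  gproj (iter k gD (word s)) = (k`! * (k == size s))%:R *: \prod_(v <- s) c v.
Proof.
elim: s k => [|v s IH] k.
  case: k => [_|k _]; last by rewrite iter_gD_word // linear0 muln0 scale0r.
  rewrite /word !big_nil scale1r; apply: galgP => m; rewrite gprojE goneE.
  case: eqP => [->|]; last by rewrite if_same.
  by rewrite ifT //; apply/no_momP => v _; rewrite ffunE.
move=> /andP[hv hs]; rewrite word_cons iter_gD_X linearD linearZ /= gproj_X // add0r.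
rewrite gproj_basic // IH // big_cons -scalerAr scalerA.
case: k => [|k]; first by rewrite mul0r muln0.
by rewrite /= eqSS factS -natrM mulnA.
Qed.

End Derivation.

(** * The twist as an exponential *)

Lemma index_enumE (T : finType) : index_enum T = enum T.
Proof. by rewrite enumT [index_enum _]unlock. Qed.

Section Lift.
Context {R : realType} {d r : nat}.
Variable n : nat.
Notation gen := (gen d r).
Notation expo := (expo d r).
Notation A := (@galg R d r n).
Notation X := (gX n).
Notation rV := 'rV[R]_d.
Implicit Types (a b phi : rV -> A) (v w : gen) (m : expo) (u : rV).

(** Formal functions that are admissible at each point. On these, the operations
    on formal functions are the pointwise operations of the graded algebra. *)
Definition gof a : gfun := fun u m => a u m.

Lemma gmul_conv (F G : @gfun R d r) u m :
  gmul n F G u m = if admissible n m then conv n (F u) (G u) m else 0.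
Proof.
rewrite /gmul; case: ifP => // _; rewrite /conv /splits big_map.
by rewrite big_enum.
Qed.

Lemma gof_mul a b : gmul n (gof a) (gof b) = gof (fun u => a u * b u).
Proof. by apply/funext => u; apply/funext => m; rewrite gmul_conv. Qed.

Lemma gof_add a b : gadd (gof a) (gof b) = gof (fun u => a u + b u).
Proof. by []. Qed.

Lemma gof_scale c a : gscale c (gof a) = gof (fun u => c *: a u).
Proof. by []. Qed.

Lemma gof_var v : gvar v = gof (fun=> X v).
Proof. by []. Qed.

Lemma gof_cst (f : rV -> R) : gcst f = gof (fun u => (f u)%:A).
Proof.
apply/funext => u; apply/funext => m.
rewrite /gcst /gof gscaleE goneE mulr_natr; congr (_ *+ nat_of_bool _).
apply/forallP/eqP => [h|->] => [|v]; last by rewrite ffunE.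
by apply/ffunP => v; rewrite ffunE; apply/eqP.
Qed.

Lemma gbigE (I : Type) (s : seq I) (P : pred I) (F : I -> @gfun R d r) u m :
  (\big[@gadd R d r/@g0 R d r]_(i <- s | P i) F i) u m = \sum_(i <- s | P i) F i u m.
Proof.
elim: s => [|i s IH]; first by rewrite !big_nil.
by rewrite !big_cons; case: ifP => // _; rewrite /gadd IH.
Qed.

Lemma gof_sum (I : Type) (s : seq I) (P : pred I) (F : I -> rV -> A) :
  \big[@gadd R d r/@g0 R d r]_(i <- s | P i) gof (F i) =
  gof (fun u => \sum_(i <- s | P i) F i u).
Proof.
by apply/funext => u; apply/funext => m; rewrite gbigE /gof gsumE.
Qed.

Lemma gof_prod (I : Type) (s : seq I) (F : I -> rV -> A) :
  \big[gmul n/gcst (fun=> 1)]_(i <- s) gof (F i) =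
  gof (fun u => \prod_(i <- s) F i u).
Proof.
elim: s => [|i s IH].
  by rewrite big_nil gof_cst; congr gof; apply/funext => u; rewrite big_nil scale1r.
rewrite big_cons IH gof_mul; congr gof; apply/funext => u.
by rewrite big_cons.
Qed.

Lemma gof_der v a : lder n v (gof a) = gof (fun u => gder v (a u)).
Proof. by []. Qed.

Lemma gxder_subproof i a u m : ~~ admissible n m -> partial i (fun u' => a u' m) u = 0.
Proof.
move=> adm; rewrite (_ : (fun u' => a u' m) = fun=> 0) ?partial_cst //.
by apply/funext => u'; rewrite gcoefP.
Qed.
Definition gxder i a u : A := Galg (@gxder_subproof i a u).

Lemma gof_xder i a : xder i (gof a) = gof (gxder i a).
Proof. by []. Qed.

Lemma homog_gxder (V : zmodType) (w : gen -> V) k i a u :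
  (forall u, homog w k (a u)) -> homog w k (gxder i a u).
Proof.
move=> ha m; rewrite /= => p0.
have [u' /eqP au'] : exists u', a u' m <> 0.
  apply: contrapT => H; move: p0; rewrite (_ : (fun u' => a u' m) = fun=> 0) ?partial_cst ?eqxx //.
  by apply/funext => u'; apply: contrapT => h; apply: H; exists u'.
exact: ha au'.
Qed.

(** The sign of the right derivative and that of exchanging the two factors
    combine to the sign of the left derivative. *)
Lemma rder_mul v a b k : oddz k = godd n v -> (forall u, homog (gdeg n) k (b u)) ->
  gmul n (rder n v (gof a)) (gof b) = gof (fun u => b u * gder v (a u)).
Proof.
move=> kv hb; apply/funext => u; apply/funext => m; rewrite gmul_conv.
rewrite -[RHS]/(if _ then _ else _); case: ifP => // adm.
rewrite /conv (splits_swap _ (fun x y => (-1) ^+ koszul n x y * b u x * gder v (a u) y)).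
apply: eq_big_seq => -[x y]; rewrite mem_splits [fst _]/= [snd _]/= => /eqP xym.
rewrite gderE /rder /gof -/(after n v x).
have [->|by0] := eqVneq (b u y) 0; first by rewrite !(mulr0, mul0r).
have [->|ax0] := eqVneq (a u (expo_add x (expo1 v))) 0; first by rewrite !(mulr0, mul0r).
have admx : admissible n (expo_add x (expo1 v)).
  by apply: contraTT ax0 => /gcoefP->; rewrite eqxx.
have sE : (-1) ^+ koszul n x y * (-1) ^+ (godd n v * after n v x)%N =
    (-1) ^+ koszul n y x * (-1) ^+ (godd n v * before n v x)%N :> R.
  rewrite -!exprD; apply: signr_eq; rewrite -xym in adm.
  have /(congr1 odd) := koszulC adm; rewrite !oddD !oddM.
  rewrite -(oddz_parity n y) (hb u y by0) kv oddb.
  have [ov|ov] := boolP (godd n v); last by rewrite andbF /=; do 2 case: (odd _).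
  have x0 : x v = 0%N.
    by have := forallP admx v; rewrite ov !ffunE eqxx addn1 ltnS leqn0 => /eqP.
  by rewrite (parity_split x ov) x0 addn0 oddD /=; do 4 case: (odd _).
have aux (s1 s2 s3 s4 p q t : R) : s1 * s2 = s3 * s4 ->
    s1 * (s2 * p * q) * t = s3 * t * (s4 * p * q).
  move=> ss; transitivity ((s1 * s2) * p * q * t); first by ring.
  by rewrite ss; ring.
exact: aux.
Qed.

Lemma gmul_g0r (F : @gfun R d r) b : (forall u, b u = 0) -> gmul n F (gof b) = gof (fun=> 0).
Proof.
move=> hb; apply/funext => u; apply/funext => m; rewrite gmul_conv /gof hb.
case: ifP => // _; rewrite /conv big1 // => p _; exact: mulr0.
Qed.

Lemma big_gen (V : zmodType) (F : gen -> V) : \sum_v F v =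
  \sum_a F (Gq a) + (\sum_i F (Gz i) + (\sum_a F (Gy a) + (\sum_i F (Gxi i) +
  (\sum_a F (Gp a) + (\sum_i F (Gzeta i) + \sum_a F (Geta a)))))).
Proof.
have K : cancel (@gen_of_sum d r) (@gen_to_sum d r) by do 6?case.
rewrite (reindex (@gen_of_sum d r)); last first.
  by exists (@gen_to_sum d r) => v _; [exact: K|exact: gen_to_sumK].
by rewrite !big_sumType.
Qed.

(** The bracket of the momentum [v] with a function [phi] without momenta; the
    other coordinates have zero bracket with such a [phi]. *)
Definition ham phi u v : A := match v with
  | Gxi i => - gxder i phi u
  | Gp a => - ((-1) ^+ (godd n (@Gq d r a) && godd n (@Gp d r a)) *: gder (Gq a) (phi u))
  | Gzeta i => - ((-1) ^+ (godd n (@Gz d r i) && godd n (@Gzeta d r i)) *: gder (Gz i) (phi u))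
  | Geta a => - ((-1) ^+ (godd n (@Gy d r a) && godd n (@Geta d r a)) *: gder (Gy a) (phi u))
  | _ => 0
  end.

Section Hamiltonian.
Variable phi : rV -> A.
Hypothesis phi_deg : forall u, homog (gdeg n) n%:Z (phi u).
Hypothesis phi_basic : forall u, basic (phi u).

Lemma ham_deg u v : homog (gdeg n) (gdeg n v) (ham phi u v).
Proof.
case: v => [a|i|a|i|a|i|a] /=; try exact: homog0.
- by apply: homogN; exact: homog_gxder.
- apply: homogN; apply: homogZ; exact: (homog_gder (v := Gq a) (@phi_deg u)).
- apply: homogN; apply: homogZ; have := homog_gder (v := @Gz d r i) (@phi_deg u).
  by rewrite /= opprB addrC subrK.
- apply: homogN; apply: homogZ; have := homog_gder (v := @Gy d r a) (@phi_deg u).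
  by rewrite /= opprB addrC subrK.
Qed.

Lemma ham_basic u v : basic (ham phi u v).
Proof.
rewrite /basic /avoids.
case: v => [a|i|a|i|a|i|a] /=; try exact: homog0.
- by apply: homogN; apply: homog_gxder => u'; exact: phi_basic.
- by apply: homogN; apply: homogZ; apply: (avoids_gderW (@phi_basic u)).
- by apply: homogN; apply: homogZ; apply: (avoids_gderW (@phi_basic u)).
- by apply: homogN; apply: homogZ; apply: (avoids_gderW (@phi_basic u)).
Qed.

Lemma ham_pos u v : ~~ is_momentum v -> ham phi u v = 0.
Proof. by case: v. Qed.

(** Of the two halves of each conjugate pair, the one that differentiates [phi]
    along a momentum vanishes; the other is a derivation of [a]. *)
Lemma gbr_of a : gbr n (gof a) (gof phi) = gof (fun u => gD (ham phi u) (a u)).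
Proof.
have Z v : is_momentum v -> forall u, gder v (phi u) = 0.
  by move=> hv u; exact: (avoids_gder (@phi_basic u)).
have Dz v k u : homog (gdeg n) (n%:Z - gdeg n v) (gder v (phi u)).
  exact: homog_gder.
have e1 i : gadd (gmul n (xder i (gof a)) (lder n (Gxi i) (gof phi)))
    (gscale (-1) (gmul n (rder n (Gxi i) (gof a)) (xder i (gof phi)))) =
    gof (fun u => ham phi u (Gxi i) * gder (Gxi i) (a u)).
  rewrite gof_der gmul_g0r; last by apply: Z.
  rewrite gof_xder (@rder_mul _ _ _ n%:Z) //; last by move=> u; exact: homog_gxder.
  rewrite gof_scale gof_add; congr gof; apply/funext => u.
  by rewrite add0r scaleN1r mulNr.
have e2 (Q P : gen) : is_momentum P -> oddz (n%:Z - gdeg n Q) = godd n P ->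
    gbr_pair n Q P (gof a) (gof phi) =
    gof (fun u => - ((-1) ^+ (godd n Q && godd n P) *: gder Q (phi u)) * gder P (a u)).
  move=> hP oQP; rewrite /gbr_pair gof_der gmul_g0r; last by apply: Z.
  rewrite gof_der (@rder_mul _ _ _ (n%:Z - gdeg n Q)) //; last by move=> u; exact: homog_gder.
  rewrite !gof_scale gof_add; congr gof; apply/funext => u.
  by rewrite add0r scaleN1r mulNr scalerAl.
have oz : oddz (n%:Z - (n%:Z - 1)) = true by rewrite opprB addrC subrK.
have oy : oddz (n%:Z - (n%:Z - 2)) = false by rewrite opprB addrC subrK.
have GE (F G : @gfun R d r) u m : gadd F G u m = F u m + G u m by [].
apply/funext => u; apply/funext => m; rewrite /gbr 3!GE !gbigE.
have -> : gof (fun u => gD (ham phi u) (a u)) u m =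
    (\sum_v ham phi u v * gder v (a u)) m by [].
rewrite big_gen !gaddE !gsumE.
rewrite [X in _ = X + _]big1 ?add0r; last by move=> ? _; rewrite mul0r.
rewrite [X in _ = X + _]big1 ?add0r; last by move=> ? _; rewrite mul0r.
rewrite [X in _ = X + _]big1 ?add0r; last by move=> ? _; rewrite mul0r.
rewrite !addrA; congr (_ + _ + _ + _); apply: eq_bigr => i _.
- by rewrite e1.
- by rewrite e2.
- by rewrite e2.
- by rewrite e2.
Qed.

Definition theta (H : ('I_n.+1 -> 'I_d) -> rV -> R) u : A :=
  \sum_i word n [:: Gxi i; Gzeta i] + \sum_a word n [:: Gp a; Geta a]
  + ((-1) ^+ (n * n.+1)./2 / (n.+1)`!%:R) *:
    \sum_(I : {ffun 'I_n.+1 -> 'I_d}) H I u *: word n [seq Gzeta (I k) | k <- enum 'I_n.+1].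

Lemma gTheta_of H : gTheta (r := r) H = gof (theta H).
Proof.
have GE (F G : @gfun R d r) u m : gadd F G u m = F u m + G u m by [].
apply/funext => u; apply/funext => m; rewrite /gTheta 2!GE /gscale !gbigE.
rewrite -[RHS]/(theta H u m) /theta !gaddE gscaleE !gsumE.
congr (_ + _ + _ * _); apply: eq_bigr => i _.
- by rewrite !gof_var gof_mul !word_cons /word big_nil mulr1.
- by rewrite !gof_var gof_mul !word_cons /word big_nil mulr1.
- rewrite gof_cst (@gof_prod _ _ (fun k => fun=> X (Gzeta (i k)))) gof_mul.
  rewrite -[LHS]/(((H i u)%:A * \prod_(k < n.+1) X (Gzeta (i k))) m).
  by rewrite -scalerAl mul1r /word big_map -index_enumE.
Qed.

(** [theta] with each momentum replaced by its bracket with [phi]: all that the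
    projection keeps of the twist. *)
Definition twist_base (H : ('I_n.+1 -> 'I_d) -> rV -> R) u : A :=
  \sum_i ham phi u (Gxi i) * ham phi u (Gzeta i)
  + \sum_a ham phi u (Gp a) * ham phi u (Geta a)
  + ((-1) ^+ (n * n.+1)./2 / (n.+1)`!%:R) *:
    \sum_(I : {ffun 'I_n.+1 -> 'I_d}) H I u *: \prod_(k < n.+1) ham phi u (Gzeta (I k)).

Lemma iter_gbr k a : iter k (fun f => gbr n f (gof phi)) (gof a) =
  gof (fun u => iter k (gD (ham phi u)) (a u)).
Proof. by elim: k => //= k ->; rewrite gbr_of. Qed.

Lemma iter_gD_linear k u : linear (iter k (gD (ham phi u))).
Proof. by elim: k => [|k IH] c f g //; rewrite !iterS IH linearP. Qed.

Lemma iter_gD_sum k u (I : Type) (s : seq I) (c : I -> R) (F : I -> A) :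
  iter k (gD (ham phi u)) (\sum_(i <- s) c i *: F i) =
  \sum_(i <- s) c i *: iter k (gD (ham phi u)) (F i).
Proof.
elim: s => [|i s IH]; first by rewrite !big_nil iter_gD0.
by rewrite !big_cons iter_gD_linear IH.
Qed.

(** [theta] as one linear combination of words in the momenta, to which
    [gproj_iter_word] applies uniformly. *)
Definition theta_index : finType := ('I_d + 'I_r + {ffun 'I_n.+1 -> 'I_d})%type.

Definition theta_word (t : theta_index) : seq gen := match t with
  | inl (inl i) => [:: Gxi i; Gzeta i]
  | inl (inr a) => [:: Gp a; Geta a]
  | inr K => [seq Gzeta (K k) | k <- enum 'I_n.+1]
  end.

Definition theta_coef (H : ('I_n.+1 -> 'I_d) -> rV -> R) u (t : theta_index) : R :=
  match t with
  | inr K => (-1) ^+ (n * n.+1)./2 / (n.+1)`!%:R * H K u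
  | _ => 1
  end.

Lemma thetaE H u : theta H u = \sum_t theta_coef H u t *: word n (theta_word t).
Proof.
rewrite !big_sumType /=; congr (_ + _ + _).
- by apply: eq_bigr => i _; rewrite scale1r.
- by apply: eq_bigr => i _; rewrite scale1r.
- by rewrite scaler_sumr; apply: eq_bigr => I _; rewrite scalerA.
Qed.

Lemma twist_baseE H u : twist_base H u =
  \sum_t theta_coef H u t *: \prod_(v <- theta_word t) ham phi u v.
Proof.
rewrite !big_sumType /=; congr (_ + _ + _).
- by apply: eq_bigr => i _; rewrite scale1r !big_cons big_nil mulr1.
- by apply: eq_bigr => i _; rewrite scale1r !big_cons big_nil mulr1.
- rewrite scaler_sumr; apply: eq_bigr => I _; rewrite scalerA; congr (_ *: _).
  by rewrite big_map -index_enumE.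
Qed.

Lemma theta_word_momentum t : all (@is_momentum d r) (theta_word t).
Proof. by case: t => [[i|a]|I] //=; apply/allP => v /mapP[k _ ->]. Qed.

Lemma size_theta_word t : (size (theta_word t) < n.+3)%N.
Proof. by case: t => [[i|a]|I] //=; rewrite size_map size_enum_ord. Qed.

Definition exp_theta (H : ('I_n.+1 -> 'I_d) -> rV -> R) u : A :=
  \sum_(k < n.+3) (k`!%:R)^-1 *: iter k (gD (ham phi u)) (theta H u).

Lemma iter_theta_eq0 H u k : (n.+3 <= k)%N -> iter k (gD (ham phi u)) (theta H u) = 0.
Proof.
move=> hk; rewrite thetaE iter_gD_sum big1 // => t _.
rewrite iter_gD_word ?scaler0 //.
- by move=> v; exact: ham_deg.
- by move=> v; exact: ham_basic.
- by move=> v; exact: ham_pos.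
- exact: leq_trans (size_theta_word t) hk.
Qed.

Lemma gproj_exp_theta H u : gproj (exp_theta H u) = twist_base H u.
Proof.
rewrite twist_baseE /exp_theta linear_sum /=.
under eq_bigr => k _ do rewrite linearZ /= thetaE iter_gD_sum linear_sum scaler_sumr.
rewrite exchange_big; apply: eq_bigr => t _.
have E (k : 'I_n.+3) : (k`!%:R)^-1 *: gproj (theta_coef H u t *:
     iter k (gD (ham phi u)) (word n (theta_word t))) =
   ((k : nat) == size (theta_word t))%:R *:
     (theta_coef H u t *: \prod_(v <- theta_word t) ham phi u v).
  rewrite linearZ /= gproj_iter_word //; last exact: theta_word_momentum.
  - have f0 : k`!%:R != 0 :> R by rewrite pnatr_eq0 -lt0n fact_gt0.
    rewrite !scalerA natrM -mulrA [theta_coef H u t * _]mulrCA mulKf //.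
    by rewrite [theta_coef H u t * _]mulrC.
  - by move=> v; exact: ham_deg.
  - by move=> v; exact: ham_basic.
  - by move=> v; exact: ham_pos.
rewrite (eq_bigr _ (fun k _ => E k)) (bigD1 (Ordinal (size_theta_word t))) //=.
rewrite eqxx scale1r [X in _ + X]big1 ?addr0 // => k kt.
by rewrite (_ : (_ == _) = false) ?scale0r //; apply: contraNF kt => /eqP e; apply/eqP/val_inj.
Qed.

(** The words of [theta] have fewer than [n.+3] letters, so that the series is a
    finite sum. *)
Lemma is_twist_exp_theta (W : set rV) H :
  is_twist n W (gof phi) (gTheta (r := r) H) (gof (exp_theta H)).
Proof.
move=> u m _.
have -> : (fun k => (k`!%:R)^-1 * iter k (gbr n ^~ (gof phi)) (gTheta (r := r) H) u m) =
    (fun k => (k`!%:R)^-1 * iter k (gD (ham phi u)) (theta H u) m) :> (nat -> R).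
  by apply/funext => k; rewrite gTheta_of iter_gbr.
have E N : (n.+3 <= N)%N ->
   series (fun k => (k`!%:R)^-1 * iter k (gD (ham phi u)) (theta H u) m) N =
   gof (exp_theta H) u m.
  move=> hN; rewrite /series /= (big_cat_nat _ hN) //= [X in _ + X]big_nat_cond [X in _ + X]big1 ?addr0.
    by rewrite big_mkord /gof /exp_theta gsumE.
  by move=> k /andP[/andP[hk _] _]; rewrite iter_theta_eq0 // mulr0.
apply: cvg_near_cst; exists n.+3 => // N /= hN; exact: E.
Qed.

(** The twist is unique as a limit, so that its existence and vanishing reduce to
    one equation at each point. *)
Lemma pr_twist_zeroP (W : set rV) H :
  pr_twist_zero n W (gof phi) (gTheta (r := r) H) <-> forall u, W u -> twist_base H u = 0.
Proof.
have P := @is_twist_exp_theta W H.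
split=> [[beta hbeta zbeta] u Wu|h].
  rewrite -gproj_exp_theta; apply: galgP => m; rewrite gprojE gzeroE.
  case: ifP => // hm; have := zbeta u m Wu; rewrite /gpr ifT // => b0.
  have h1 := P u m Wu; have h2 := hbeta u m Wu; rewrite b0 in h2.
  exact: (cvg_unique _ h1 h2).
exists (gof (exp_theta H)) => // u m Wu.
have : gproj (exp_theta H u) m = 0 by rewrite gproj_exp_theta h.
by rewrite gprojE /gpr.
Qed.

End Hamiltonian.
End Lift.

(** * Forms on the algebroid as polynomials in $q$ *)

Lemma size_del2 (T : Type) (i j : nat) (s : seq T) : i != j -> (i < size s)%N -> (j < size s)%N ->
  size (del2 i j s) = (size s).-2.
Proof.
rewrite /del2; case: (ssrnat.ltngtP i j) => // ij _ hi hj.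
  have sj := size_del hj; have ij' : (i < size (del j s))%N by rewrite sj; lia.
  by rewrite (size_del ij') sj.
have si := size_del hi; have ji : (j < size (del i s))%N by rewrite si; lia.
by rewrite (size_del ji) si.
Qed.

Section QPolynomials.
Context {R : realType} {d r : nat}.
Variable n : nat.
Notation gen := (gen d r).
Notation expo := (expo d r).
Notation A := (@galg R d r n).
Notation X := (gX n).
Notation V := 'rV[R]_r.
Implicit Types (f g h : A) (v w : gen) (m : expo) (x y : V) (s : seq V).

Definition is_q v := if v is Gq _ then true else false.
Definition not_q v := ~~ is_q v.
Definition q_weight v : int := (is_q v)%:R.

(** At one point, the forms of degree [k] on [E]. *)
Definition qpoly k f := avoids not_q f /\ homog q_weight k%:Z f.

Lemma qpolyD k f g : qpoly k f -> qpoly k g -> qpoly k (f + g).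
Proof. by move=> [? ?] [? ?]; split; exact: homogD. Qed.

Lemma qpolyZ k (c : R) f : qpoly k f -> qpoly k (c *: f).
Proof. by move=> [? ?]; split; exact: homogZ. Qed.

Lemma qpolyN k f : qpoly k f -> qpoly k (- f).
Proof. by rewrite -scaleN1r; exact: qpolyZ. Qed.

Lemma qpoly0 k : qpoly k 0.
Proof. by split; exact: homog0. Qed.

Lemma qpoly_sum k (I : Type) (t : seq I) (F : I -> A) :
  (forall i, qpoly k (F i)) -> qpoly k (\sum_(i <- t) F i).
Proof. by move=> h; split; apply: homog_sum => i _; have [] := h i. Qed.

Lemma qpolyM j k f g : qpoly j f -> qpoly k g -> qpoly (j + k) (f * g).
Proof.
move=> [f1 f2] [g1 g2]; split; first exact: avoidsM.
by rewrite PoszD; exact: homogM.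
Qed.

Lemma qpolyX a : qpoly 1 (X (Gq a)).
Proof. by split; [exact: avoidsX|exact: (@homogX _ _ _ _ _ q_weight (Gq a))]. Qed.

Lemma qpoly1 : qpoly 0 1.
Proof. by split; exact: homog1. Qed.

Lemma qpoly_gder k f a : qpoly k.+1 f -> qpoly k (gder (Gq a) f).
Proof.
move=> [h1 h2]; split; first exact: avoids_gderW.
have := homog_gder (v := Gq a) h2.
by rewrite /q_weight /= -[k.+1]addn1 PoszD addrK.
Qed.

(** Contraction with the vector [x]. *)
Definition vder x f : A := \sum_a x 0 a *: gder (Gq a) f.

Lemma vder_is_linear x : linear (vder x).
Proof.
move=> c f g; rewrite /vder scaler_sumr -big_split; apply: eq_bigr => a _ /=.
by rewrite linearP scalerDr !scalerA mulrC.
Qed.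
HB.instance Definition _ x := GRing.isLinear.Build R A A *:%R (vder x) (vder_is_linear x).

Lemma vder_delta a f : vder (delta_mx 0 a) f = gder (Gq a) f.
Proof.
rewrite /vder (bigD1 a) //= mxE !eqxx scale1r big1 ?addr0 // => b ba.
by rewrite mxE eqxx (negbTE ba) scale0r.
Qed.

Lemma vder_q x a f : vder x (X (Gq a) * f) = x 0 a *: f - X (Gq a) * vder x f.
Proof.
rewrite /vder mulr_sumr -sumrN.
transitivity (\sum_b ((x 0 b * (b == a)%:R) *: f - X (Gq a) * (x 0 b *: gder (Gq b) f))).
  apply: eq_bigr => b _; rewrite (gder_mul (Gq b) f (@homogX R d r n _ (gdeg n) (Gq a))) gder_X.
  rewrite (_ : (-1) ^+ _ = -1 :> R) // scaleN1r scalerDr scalerN [x 0 b *: (X (Gq a) * _)]scalerAr; congr (_ - _).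
  rewrite -scalerA; congr (_ *: _); have -> : (Gq b == Gq a :> gen) = (b == a).
    by apply/eqP/eqP => [[]|->].
  by case: (b == a); rewrite ?mul1r ?mul0r ?scale1r ?scale0r.
rewrite big_split /=; congr (_ + _); rewrite -scaler_suml; congr (_ *: _).
rewrite (bigD1 a) //= eqxx mulr1 big1 ?addr0 // => b /negbTE->.
by rewrite mulr0.
Qed.

(** The value of a form, by contracting with one vector after the other. *)
Fixpoint ev s f : R := if s is x :: s' then ev s' (vder x f) else f expo0.

Lemma ev_is_linear s : linear (ev s : A -> R^o).
Proof.
elim: s => [|x s IH] c f g //=.
by rewrite linearP IH.
Qed.
HB.instance Definition _ s := GRing.isLinear.Build R A R^o *:%R (ev s) (ev_is_linear s).

(** Contractions are odd derivations, so they hit the factors [q] one at a time,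
    with the alternating sign of the exterior derivative. *)
Lemma ev_qmul s (G : 'I_r -> A) :
  ev s (\sum_a X (Gq a) * G a) =
  \sum_(l < size s) (-1) ^+ l * ev (del l s) (\sum_a nth 0 s l 0 a *: G a).
Proof.
elim: s G => [|x s IH] G /=.
  rewrite big_ord0 gsumE big1 // => a _; rewrite gmulE ?admissible0 // /conv big_seq big1 // => -[m1 m2].
  rewrite mem_splits => /eqP e /=; rewrite (_ : (_ == _) = false) ?mulr0 ?mul0r //.
  apply/eqP => e1; move: e => /ffunP/(_ (Gq a)).
  by rewrite e1 !ffunE eqxx.
have -> : vder x (\sum_a X (Gq a) * G a) =
    \sum_a x 0 a *: G a - \sum_a X (Gq a) * vder x (G a).
  by rewrite linear_sum -sumrB; apply: eq_bigr => a _; exact: vder_q.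
rewrite linearD linearN /= IH big_ord_recl /= del0 mul1r; congr (_ + _).
rewrite -sumrN; apply: eq_bigr => l _; rewrite exprS mulN1r mulNr; congr (- (_ * _)).
rewrite -[RHS]/(ev (del l s) (vder x (\sum_a nth 0 s l 0 a *: G a))).
rewrite (linear_sum (vder x)); congr (ev (del l s) _); apply: eq_bigr => a _.
by rewrite linearZ.
Qed.

(** The derivatives along all [q] vanish by induction, and by the degree at least
    one [q] occurs in every monomial. *)
Lemma qpoly_eq0 k f : qpoly k f ->
  (forall s, size s = k -> ev s f = 0) -> f = 0.
Proof.
elim: k f => [|k IH] f [f1 f2] h; apply: galgP => m; rewrite gzeroE.
  have [//|fm] := eqVneq (f m) 0.
  suff -> : m = expo0 by exact: (h [::]).
  apply/ffunP => v; rewrite ffunE.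
  have [vq|vq] := boolP (is_q v); last exact: (avoidsP f1 vq fm).
  by apply: (avoidsP (P := is_q) _ vq fm); exact: f2.
have [//|fm] := eqVneq (f m) 0.
have D a : gder (Gq a) f = 0.
  apply: IH; first by apply: qpoly_gder.
  by move=> s hs; rewrite -vder_delta; apply: (h (delta_mx 0 a :: s)); rewrite /= hs.
have [a ma] : exists a, (0 < m (Gq a))%N.
  apply: contrapT => H.
  have := f2 m fm; rewrite big1 // => v _; rewrite /q_weight.
  case: v => [a|i|a|i|a|i|a] /=; rewrite ?mul0rn //.
  have -> : m (Gq a) = 0%N by apply/eqP; rewrite -leqn0 leqNgt; apply/negP => ?; apply: H; exists a.
  by [].
pose m' : expo := [ffun w => (m w - expo1 (Gq a) w)%N].
have mE : expo_add m' (expo1 (Gq a)) = m.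
  by apply/ffunP => w; rewrite !ffunE subnK //; case: eqP => // ->.
have := congr1 (fun g : A => g m') (D a); rewrite gderE mE gzeroE => /eqP.
rewrite !mulf_eq0 pnatr_eq0 /= orbF => /orP[|/eqP//].
by rewrite signr_eq0.
Qed.

(** The sum of $F(e_{i_1},\dots,e_{i_k})\,y_{i_1}\cdots y_{i_k}$ over all indices. The
    recursion on [k] avoids multi-indices, and arbitrary [y] allow substitution
    of linear functions for the coordinates. *)
Fixpoint gform (W : lmodType R) (I : finType) (e : I -> W) (y : I -> A) k (F : seq W -> R) : A :=
  if k is k'.+1 then \sum_i y i * gform e y k' (fun t => F (e i :: t)) else (F [::])%:A.

Lemma gform_ext (W : lmodType R) (I : finType) (e : I -> W) (y : I -> A) k F G :
  (forall t, size t = k -> F t = G t) -> gform e y k F = gform e y k G.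
Proof.
elim: k F G => [|k IH] F G h /=; first by rewrite h.
by apply: eq_bigr => i _; congr (_ * _); apply: IH => t ht; apply: h; rewrite /= ht.
Qed.

Lemma gform_sum (W : lmodType R) (I : finType) (e : I -> W) (y : I -> A) k
    (T : Type) (js : seq T) (c : T -> R) (F : T -> seq W -> R) :
  gform e y k (fun t => \sum_(j <- js) c j * F j t) = \sum_(j <- js) c j *: gform e y k (F j).
Proof.
elim: k F => [|k IH] F /=.
  by rewrite scaler_suml; apply: eq_bigr => j _; rewrite scalerA.
under eq_bigr => i _ do rewrite IH mulr_sumr.
rewrite exchange_big; apply: eq_bigr => j _; rewrite scaler_sumr.
by apply: eq_bigr => i _; rewrite scalerAr.
Qed.

Lemma gformZ (W : lmodType R) (I : finType) (e : I -> W) (y : I -> A) k (c : R) F :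
  gform e y k (fun t => c * F t) = c *: gform e y k F.
Proof.
have := gform_sum e y k [:: tt] (fun=> c) (fun=> F).
rewrite big_cons big_nil addr0 => <-; apply: gform_ext => t _.
by rewrite big_cons big_nil addr0.
Qed.

Definition qform := gform (fun a => delta_mx 0 a : V) (fun a => X (Gq a)).

Lemma qpoly_qform k F : qpoly k (qform k F).
Proof.
rewrite /qform; elim: k F => [|k IH] F /=; first by apply: qpolyZ; exact: qpoly1.
by apply: qpoly_sum => a; rewrite -add1n; apply: qpolyM; [exact: qpolyX|exact: IH].
Qed.

(** The factor [k.+1] counts the positions that the derivative can hit; they all
    contribute the same because the form is alternating. *)
Lemma vder_qform k F x : altform k.+1 F ->
  vder x (qform k.+1 F) = k.+1%:R *: qform k (fun s => F (x :: s)).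
Proof.
elim: k F x => [|k IH] F x aF.
  rewrite /qform /= linear_sum scale1r.
  rewrite (eq_bigr (fun a => x 0 a *: (F [:: delta_mx 0 a])%:A)); last first.
    move=> a _; rewrite [LHS]vder_q; apply/eqP; rewrite subr_eq addrC -subr_eq subrr; apply/eqP.
    rewrite linearZ /= (_ : vder x 1 = 0) ?scaler0 ?mulr0 //.
    by rewrite /vder big1 // => b _; rewrite gder1 scaler0.
  rewrite {2}[x]row_sum_delta (@mlinear_sum _ _ 1 F [::] [::]) //; last exact: aF.1.
  by rewrite scaler_suml; apply: eq_bigr => a _; rewrite scalerA.
have sub a : vder x (X (Gq a) * qform k.+1 (fun s => F (delta_mx 0 a :: s))) =
    x 0 a *: qform k.+1 (fun s => F (delta_mx 0 a :: s))
    + k.+1%:R *: (X (Gq a) * qform k (fun s => F (x :: delta_mx 0 a :: s))).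
  rewrite vder_q (IH _ _ (altform_cons _ aF)) -scalerAr -scalerN; congr (_ + _ *: _).
  rewrite -mulrN; congr (_ * _); rewrite -scaleN1r -gformZ; apply: gform_ext => s hs.
  rewrite mulN1r (@altform_swap _ _ _ _ [::] s x _ aF) ?opprK //=.
  by rewrite hs.
rewrite {1}/qform /= linear_sum.
rewrite (eq_bigr _ (fun a _ => sub a)).
rewrite big_split /= -scaler_sumr [in RHS]mulrS scalerDl scale1r; congr (_ + _).
rewrite -gform_sum; apply: gform_ext => s hs.
by rewrite {2}[x]row_sum_delta (@mlinear_sum _ _ k.+2 F [::] s) //= ?hs //; exact: aF.1.
Qed.

Lemma ev_qform k F s : altform k F -> size s = k -> ev s (qform k F) = k`!%:R * F s.
Proof.
elim: s k F => [|x s IH] [|k] F aF //= hs.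
  by rewrite /qform /= eqxx mulr1 mul1r.
rewrite vder_qform // linearZ /= (IH _ _ (altform_cons x aF)); last by case: hs.
by rewrite -[LHS]/(_ * _) factS natrM mulrA.
Qed.

Section Differential.
Variables (rho : 'I_d -> 'I_r -> R) (C : 'I_r -> 'I_r -> 'I_r -> R).
Hypothesis C_skew : forall a b c, C a b c = - C b a c.

(** The vector field $\rho^i_aq^a\partial_i-\frac12C^c_{ab}q^aq^b\partial_{q^c}$, whose action on
    [E]-forms is the differential; [f'] stands for the derivatives of the
    coefficients of [f] along the base. *)
Definition gQ (f' : 'I_d -> A) f : A :=
  \sum_a X (Gq a) * (\sum_i rho i a *: f' i)
  - 2^-1 *: \sum_a X (Gq a) * (\sum_b X (Gq b) * (\sum_c C a b c *: gder (Gq c) f)).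

Lemma qpoly_gQ k (f' : 'I_d -> A) f : (forall i, qpoly k (f' i)) -> qpoly k f -> qpoly k.+1 (gQ f' f).
Proof.
move=> hf' hf; apply: qpolyD.
  apply: qpoly_sum => a; rewrite -add1n; apply: qpolyM; first exact: qpolyX.
  by apply: qpoly_sum => i; exact: qpolyZ.
apply: qpolyN; apply: qpolyZ; apply: qpoly_sum => a; rewrite -add1n.
apply: qpolyM; first exact: qpolyX.
case: k hf {hf'} => [|k] hf.
  rewrite big1; first exact: qpoly0.
  move=> b _; rewrite big1 ?mulr0 // => c _; rewrite (avoids_gder (P := is_q)) ?scaler0 //.
  by case: hf.
apply: qpoly_sum => b; rewrite -add1n; apply: qpolyM; first exact: qpolyX.
by apply: qpoly_sum => c; apply: qpolyZ; exact: qpoly_gder.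
Qed.

(** The anchor part meets each position once. The bracket part meets each pair of
    positions twice, with equal contributions by skew-symmetry, which uses up
    the factor one half. *)
Lemma ev_gQ k (F : seq V -> R) (dF : 'I_d -> seq V -> R) s :
  (0 < k)%N -> altform k F -> (forall i, altform k (dF i)) -> size s = k.+1 ->
  ev s (gQ (fun i => (k`!%:R)^-1 *: qform k (dF i)) ((k`!%:R)^-1 *: qform k F)) =
  dform k rho C F dF s.
Proof.
move=> k0 aF adF hs.
have f0 : k`!%:R != 0 :> R by rewrite pnatr_eq0 -lt0n fact_gt0.
have evF t : size t = k -> ev t ((k`!%:R)^-1 *: qform k F) = F t.
  by move=> ht; rewrite linearZ /= ev_qform // -[LHS]/(_ * _) mulKf.
have evdF i t : size t = k -> ev t ((k`!%:R)^-1 *: qform k (dF i)) = dF i t.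
  by move=> ht; rewrite linearZ /= ev_qform // -[LHS]/(_ * _) mulKf.
rewrite /gQ linearB linearZ /=; congr (_ + _).
  rewrite ev_qmul hs; apply: eq_bigr => l _; congr (_ * _).
  have hl : size (del l s) = k by rewrite size_del hs.
  under eq_bigr => a _ do rewrite scaler_sumr.
  rewrite exchange_big linear_sum; apply: eq_bigr => i _.
  rewrite -(evdF i _ hl) anchorE /= -[RHS]/(_ *: _) -linearZ; congr (ev _ _).
  by rewrite /= scaler_suml; apply: eq_bigr => a _; rewrite scalerA.
pose G i j := F (cbr C (nth 0 s i) (nth 0 s j) :: del2 i j s).
have GE (i j : 'I_k.+1) : i != j -> G j i = - G i j.
  move=> ij; rewrite /G (cbr_skew _ _ C_skew) del2C 1?eq_sym //.
  rewrite -scaleN1r -[- F _]mulN1r.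
  apply: (@mlinearZ _ _ k F [::]); first exact: aF.1.
  by rewrite size_del2 ?hs // prednK.
rewrite ev_qmul hs.
have E (l : 'I_k.+1) : ev (del l s) (\sum_a nth 0 s l 0 a *:
     (\sum_b X (Gq b) * (\sum_c C a b c *: gder (Gq c) ((k`!%:R)^-1 *: qform k F)))) =
   \sum_(m < k) (-1) ^+ m * G l (bump l m).
  have hl : size (del l s) = k by rewrite size_del hs.
  under eq_bigr => a _ do rewrite scaler_sumr.
  rewrite exchange_big /=.
  under eq_bigr => b _ do (under eq_bigr => a _ do rewrite scalerAr; rewrite -mulr_sumr).
  rewrite ev_qmul hl; apply: eq_bigr => m _; congr (_ * _).
  rewrite /G -del_bump -evF; last by rewrite /= size_del hl // prednK.
  rewrite /=; congr (ev _ _); rewrite /vder.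
  rewrite nth_del ?hs 1?ltnW //.
  under eq_bigr => b _ do rewrite scaler_sumr.
  rewrite exchange_big /=.
  under eq_bigr => a _ do under eq_bigr => b _ do rewrite !scaler_sumr.
  under eq_bigr => a _ do rewrite exchange_big /=.
  rewrite exchange_big /=; apply: eq_bigr => c _.
  rewrite cbrE scaler_suml; apply: eq_bigr => a _.
  rewrite scaler_suml; apply: eq_bigr => b _.
  by rewrite !scalerA [_ * nth 0 s l 0 a]mulrC.
under eq_bigr => l _ do rewrite E mulr_sumr.
under eq_bigr => l _ do under eq_bigr => m _ do rewrite mulrA -exprD.
rewrite (sum_lift_pairs k G) -[LHS]/(- (_ * _)) mulr_sumr -sumrN.
apply: eq_bigr => i _; rewrite mulr_sumr -sumrN; apply: eq_bigr => j ij.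
rewrite GE ?neq_ltn ?ij // /G /del2 ij.
by set g := F _; set t := (-1) ^+ _; lra.
Qed.

End Differential.
End QPolynomials.

(** * The function $\phi$ at a point *)

Section FormSums.
Context {R : realType} {d r : nat}.
Variable n : nat.
Notation A := (@galg R d r n).

Lemma big_ffunS (V : zmodType) (I : finType) k (G : {ffun 'I_k.+1 -> I} -> V) :
  \sum_B G B = \sum_i \sum_(B : {ffun 'I_k -> I})
     G [ffun j => if unlift ord0 j is Some j' then B j' else i].
Proof.
rewrite pair_big /=.
pose h (p : I * {ffun 'I_k -> I}) : {ffun 'I_k.+1 -> I} :=
  [ffun j => if unlift ord0 j is Some j' then p.2 j' else p.1].
rewrite (reindex h) //.
exists (fun B : {ffun 'I_k.+1 -> I} => (B ord0, [ffun j => B (lift ord0 j)])) => [[i B] _|B _].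
  congr (_, _); first by rewrite ffunE unlift_none.
  by apply/ffunP => j; rewrite !ffunE liftK.
by apply/ffunP => j; rewrite ffunE; case: unliftP => [j' ->|->] //=; rewrite ffunE.
Qed.

(** The sums over multi-indices in the statement are the recursive ones. *)
Lemma gform_ffun (W : lmodType R) (I : finType) (e : I -> W) (y : I -> A) k F :
  \sum_(B : {ffun 'I_k -> I})
    F [seq e (B j) | j <- enum 'I_k] *: \prod_(j < k) y (B j) = gform e y k F.
Proof.
elim: k F => [|k IH] F /=.
  pose B0 : {ffun 'I_0 -> I} := ffun0 (card_ord 0).
  rewrite (big_pred1 B0) => [|B]; last by apply/esym/eqP/ffunP => -[].
  by rewrite big_ord0 (_ : enum 'I_0 = [::]) //; apply: size0nil; rewrite size_enum_ord.
rewrite big_ffunS; apply: eq_bigr => i _; rewrite -IH mulr_sumr; apply: eq_bigr => B _.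
rewrite big_ord_recl ffunE unlift_none -scalerAr; congr (F _ *: (_ * _)).
  rewrite enum_ordSl /= ffunE unlift_none -map_comp; congr (_ :: _).
  by apply: eq_map => j; rewrite /= ffunE liftK.
by apply: eq_bigr => j _; rewrite ffunE liftK.
Qed.

Lemma altform_map (V W : lmodType R) (g : V -> W) k F :
  (forall c x y, g (c *: x + y) = c *: g x + g y) -> altform k F ->
  altform k (fun s => F (map g s)).
Proof.
move=> lg [lF aF]; split=> [s1 s2 c x y h|s1 s2 x h].
  by rewrite !map_cat /= lg lF // !size_map.
by rewrite map_cat /= aF // !size_map.
Qed.

End FormSums.

Section LocalTwist.
Context {R : realType} {d r : nat}.
Variable n : nat.
Hypothesis n_gt0 : (0 < n)%N.
Notation gen := (gen d r).
Notation expo := (expo d r).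
Notation A := (@galg R d r n).
Notation X := (gX n).
Notation V := 'rV[R]_r.
Notation qform := (@qform R d r n).
Implicit Types (f g h : A) (v w : gen) (s : seq V).
Implicit Types (rho : 'I_d -> 'I_r -> R) (C : 'I_r -> 'I_r -> 'I_r -> R).

(** The value of [gphi] at a point, in terms of the values of its coefficients. The
    same expression in the derivatives of the coefficients is the derivative. *)
Definition Phi rho C (Jf : ('I_n -> 'I_r) -> R) : A :=
  \sum_i \sum_a rho i a *: (X (Gz i) * X (Gq a))
  + ((-1) ^+ n.-1 / 2) *:
     (\sum_a \sum_b \sum_c C a b c *: (X (Gq a) * X (Gq b) * X (Gy c)))
  - (n`!%:R)^-1 *: \sum_(B : {ffun 'I_n -> 'I_r}) Jf B *: \prod_(j < n) X (Gq (B j)).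

(** The components of the anchor, as one-forms on [E], and those of the bracket, as
    two-forms. *)
Definition rho_form rho i s : R := anchor rho (nth 0 s 0) 0 i.
Definition C_form C c s : R := cbr C (nth 0 s 0) (nth 0 s 1) 0 c.

(** The form with values [F] on alternating [F]; the factorial compensates for the
    sum over all multi-indices. *)
Definition nform k (F : seq V -> R) : A := (k`!%:R)^-1 *: qform k F.

Lemma nform1 rho i : nform 1 (rho_form rho i) = \sum_a rho i a *: X (Gq a).
Proof.
rewrite /nform invr1 scale1r; apply: eq_bigr => a _ /=.
rewrite -scalerAr mulr1 /rho_form /= anchorE (bigD1 a) //= mxE !eqxx mul1r.
by rewrite [X in _ + X]big1 ?addr0 // => b ba; rewrite mxE eqxx (negbTE ba) mul0r.
Qed.

Lemma cbr_delta C a b c : cbr C (delta_mx 0 a) (delta_mx 0 b) 0 c = C a b c.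
Proof.
rewrite cbrE (bigD1 a) //= (bigD1 b) //= !mxE !eqxx !mul1r.
rewrite [X in _ + X + _]big1 ?addr0; last first.
  by move=> e eb; rewrite !mxE (negbTE eb) mulr0 mul0r.
rewrite [X in _ + X]big1 ?addr0 // => e ea; rewrite big1 // => e' _.
by rewrite mxE (negbTE ea) !mul0r.
Qed.

Lemma nform2 C c : nform 2 (C_form C c) =
  2^-1 *: \sum_a X (Gq a) * (\sum_b C a b c *: X (Gq b)).
Proof.
rewrite /nform; congr (_ *: _); apply: eq_bigr => a _ /=; congr (_ * _).
by apply: eq_bigr => b _; rewrite -scalerAr mulr1 /C_form /= cbr_delta.
Qed.

Let eps : R := (-1) ^+ n.-1.

Lemma gdegz i : gdeg n (@Gz d r i) = n.-1%:Z.
Proof. by rewrite /=; lia. Qed.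

Lemma oddz_nat (k : nat) : oddz k%:Z = odd k. Proof. by []. Qed.

Lemma godd_z i : godd n (@Gz d r i) = odd n.-1.
Proof. by rewrite /godd gdegz. Qed.

Lemma qpoly_deg k f : qpoly k f -> homog (gdeg n) k%:Z f.
Proof.
move=> [f1 f2] m fm; rewrite -(f2 m fm); apply: eq_bigr => v _.
case: (boolP (is_q v)) => [|vq]; first by case: v.
by rewrite (avoidsP f1 vq fm).
Qed.

Lemma gder_qmul k v f g : qpoly k f -> not_q v ->
  gder v (f * g) = (-1) ^+ (godd n v && odd k) *: (f * gder v g).
Proof.
move=> hf hv; rewrite (gder_mul v g (qpoly_deg hf)) oddz_nat.
by rewrite (avoids_gder hf.1 hv) mul0r add0r.
Qed.

Lemma gder_qlin k v (I : finType) (w : I -> gen) (G : I -> A) : not_q v ->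
  (forall i, qpoly k (G i)) ->
  gder v (\sum_i G i * X (w i)) =
  (-1) ^+ (godd n v && odd k) *: \sum_i (v == w i)%:R *: G i.
Proof.
move=> hv hG; rewrite (linear_sum (gder v)) scaler_sumr; apply: eq_bigr => i _ /=.
by rewrite (gder_qmul _ (hG i)) // gder_X mulr_natr scaler_nat.
Qed.

(** The derivatives along [z] and [y] pick out the components of a function that is
    linear in these coordinates. *)
Lemma gder_z_forms j k (Z : 'I_d -> A) (Y : 'I_r -> A) i :
  (forall i, qpoly j (Z i)) -> (forall c, qpoly k (Y c)) ->
  gder (Gz i) (\sum_i Z i * X (Gz i) + \sum_c Y c * X (Gy c)) =
  (-1) ^+ (odd n.-1 && odd j) *: Z i.
Proof.
move=> hZ hY; rewrite (linearD (gder (Gz i))) /= (gder_qlin _ _ hZ) // (gder_qlin _ _ hY) // godd_z.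
rewrite [X in _ + _ *: X]big1 ?scaler0 ?addr0 => [|c _]; last by rewrite scale0r.
rewrite (bigD1 i) //= eqxx scale1r [X in _ *: (_ + X)]big1 ?addr0 // => t /negbTE ti.
rewrite (_ : (Gz i == Gz t :> gen) = (i == t)); first by rewrite eq_sym ti scale0r.
by apply/eqP/eqP => [[]|->].
Qed.

Lemma gder_y_forms j k (Z : 'I_d -> A) (Y : 'I_r -> A) c :
  (forall i, qpoly j (Z i)) -> (forall c, qpoly k (Y c)) ->
  gder (Gy c) (\sum_i Z i * X (Gz i) + \sum_c Y c * X (Gy c)) =
  (-1) ^+ (godd n (@Gy d r c) && odd k) *: Y c.
Proof.
move=> hZ hY; rewrite (linearD (gder (Gy c))) /= (gder_qlin _ _ hZ) // (gder_qlin _ _ hY) //.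
rewrite [X in _ *: X + _]big1 ?scaler0 ?add0r => [|i _]; last by rewrite scale0r.
rewrite (bigD1 c) //= eqxx scale1r [X in _ *: (_ + X)]big1 ?addr0 // => t /negbTE tc.
rewrite (_ : (Gy c == Gy t :> gen) = (c == t)); first by rewrite eq_sym tc scale0r.
by apply/eqP/eqP => [[]|->].
Qed.

Lemma qpoly_nform k F : qpoly k (nform k F).
Proof. by apply: qpolyZ; exact: qpoly_qform. Qed.

(** [Phi] with the coordinates [z] and [y] moved to the right. The remaining
    factors are forms on [E]; moving the odd factor [q] past [z] gives the sign. *)
Definition phi_forms rho C (J : seq V -> R) : A :=
  eps *: (\sum_i nform 1 (rho_form rho i) * X (Gz i)
          + \sum_c nform 2 (C_form C c) * X (Gy c)) - nform n J.

Lemma PhiE rho C Jf J : (forall B, Jf B = J [seq delta_mx 0 (B j) | j <- enum 'I_n]) ->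
  Phi rho C Jf = phi_forms rho C J.
Proof.
move=> hJ; rewrite /Phi /phi_forms scalerDr /nform; congr (_ + _ - _ *: _).
- rewrite scaler_sumr; apply: eq_bigr => i _; rewrite -/(nform 1 _) nform1 mulr_suml scaler_sumr.
  apply: eq_bigr => a _; rewrite -scalerAl scalerA mulrC -scalerA; congr (_ *: _).
  rewrite (gmulC (@homogX R d r n _ (gdeg n) (Gz i)) (@homogX R d r n _ (gdeg n) (Gq a))).
  by rewrite gdegz oddz_nat andbT /eps signr_odd.
- rewrite -scalerA; congr (_ *: _).
  under eq_bigr => a _ do rewrite exchange_big /=.
  rewrite exchange_big /= scaler_sumr; apply: eq_bigr => c _.
  rewrite -/(nform 2 _) nform2 -scalerAl; congr (_ *: _).
  rewrite mulr_suml; apply: eq_bigr => a _; rewrite mulr_sumr mulr_suml; apply: eq_bigr => b _.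
  by rewrite -scalerAr scalerAl.
- rewrite /qform -gform_ffun; apply: eq_bigr => B _; congr (_ *: _).
  exact: hJ.
Qed.

Lemma Phi_deg rho C Jf : homog (gdeg n) n%:Z (Phi rho C Jf).
Proof.
have hX v : homog (gdeg n) (gdeg n v) (X v : A) by exact: homogX.
apply: homogD; first apply: homogD.
- apply: homog_sum => i _; apply: homog_sum => a _; apply: homogZ.
  by have := homogM (hX (Gz i)) (hX (Gq a)); rewrite /= subrK.
- apply: homogZ; apply: homog_sum => a _; apply: homog_sum => b _.
  apply: homog_sum => c _; apply: homogZ.
  have := homogM (homogM (hX (Gq a)) (hX (Gq b))) (hX (Gy c)).
  by rewrite /= addrC subrK.
- apply: homogN; apply: homogZ; apply: homog_sum => B _; apply: homogZ.
  have H k (F : 'I_k -> gen) : (forall j, gdeg n (F j) = 1) ->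
      homog (gdeg n) k%:Z (\prod_(j < k) X (F j) : A).
    elim: k F => [|k IH] F hF; first by rewrite big_ord0; exact: homog1.
    rewrite big_ord_recl (_ : k.+1%:Z = gdeg n (F ord0) + k%:Z); last by rewrite hF -PoszD.
    apply: homogM; first exact: hX.
    by apply: IH => j; exact: hF.
  exact: H.
Qed.

Lemma Phi_basic rho C Jf : basic (Phi rho C Jf).
Proof.
have hX v : ~~ is_momentum v -> avoids (@is_momentum d r) (X v : A) by exact: avoidsX.
apply: homogD; first apply: homogD.
- apply: homog_sum => i _; apply: homog_sum => a _; apply: homogZ.
  by apply: avoidsM; apply: hX.
- apply: homogZ; apply: homog_sum => a _; apply: homog_sum => b _.
  apply: homog_sum => c _; apply: homogZ.
  by apply: avoidsM; [apply: avoidsM|]; apply: hX.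
- apply: homogN; apply: homogZ; apply: homog_sum => B _; apply: homogZ.
  by apply: big_ind => [||j _]; [exact: homog1|move=> ? ?; exact: avoidsM|exact: hX].
Qed.

Section PhiParts.
Variables (rho : 'I_d -> 'I_r -> R) (C : 'I_r -> 'I_r -> 'I_r -> R) (J : seq V -> R).

Lemma gder_z_Phi i : gder (Gz i) (phi_forms rho C J) = nform 1 (rho_form rho i).
Proof.
rewrite /phi_forms linearB [X in _ - X](avoids_gder (qpoly_nform n J).1) // subr0.
rewrite [LHS]linearZ /= (@gder_z_forms 1 2) => [|j|c]; [|exact: qpoly_nform..].
by rewrite andbT signr_odd scalerA /eps -expr2 sqrr_sign scale1r.
Qed.

Lemma gder_y_Phi c : gder (Gy c) (phi_forms rho C J) = eps *: nform 2 (C_form C c).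
Proof.
rewrite /phi_forms linearB [X in _ - X](avoids_gder (qpoly_nform n J).1) // subr0.
rewrite [LHS]linearZ /= (@gder_y_forms 1 2) => [|j|e]; [|exact: qpoly_nform..].
by rewrite andbF scale1r.
Qed.

End PhiParts.

End LocalTwist.

(** * Substitution in forms and linearity of the differential *)

Section Substitution.
Context {R : realType} {d r : nat}.
Variable n : nat.
Hypothesis n_gt0 : (0 < n)%N.
Notation gen := (gen d r).
Notation A := (@galg R d r n).
Notation X := (gX n).
Notation V := 'rV[R]_r.
Notation qform := (@qform R d r n).
Notation nform := (@nform R d r n).
Implicit Types (f h : A) (v w : gen).

Lemma gform_scale (W : lmodType R) (I : finType) (e : I -> W) (y : I -> A) (c : R) k F :
  gform e (fun i => c *: y i) k F = c ^+ k *: gform e y k F.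
Proof.
elim: k F => [|k IH] F /=; first by rewrite scale1r.
rewrite scaler_sumr; apply: eq_bigr => i _.
by rewrite IH -scalerAr -scalerAl scalerA mulrC exprS.
Qed.

(** Substituting linear functions for the coordinates pulls the form back along the
    transposed linear map. The anchor will do this to [H]. *)
Lemma gform_pullback (W W' : lmodType R) (I I' : finType) (e : I -> W) (e' : I' -> W')
    (y : I -> A) (y' : I' -> A) (L : I' -> I -> R) (g : W' -> W) k F :
  mlinear k F -> (forall a, g (e' a) = \sum_i L a i *: e i) ->
  (forall i, y i = \sum_a L a i *: y' a) ->
  gform e y k F = gform e' y' k (fun s => F (map g s)).
Proof.
move=> lF hg hy; elim: k F lF => [|k IH] F lF //=.
under eq_bigr => i _ do rewrite hy mulr_suml.
rewrite exchange_big /=; apply: eq_bigr => a _.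
under eq_bigr => i _ do rewrite -scalerAl scalerAr.
rewrite -mulr_sumr -gform_sum; congr (_ * _).
transitivity (gform e y k (fun t => F (g (e' a) :: t))).
  by apply: gform_ext => t ht; rewrite hg (@mlinear_sum _ _ k.+1 F [::] t) //= ht.
apply: IH => s1 s2 c x z hs.
exact: (lF (g (e' a) :: s1) s2 c x z (congr1 S hs)).
Qed.

Section Linearity.
Variables (rho : 'I_d -> 'I_r -> R) (C : 'I_r -> 'I_r -> 'I_r -> R).
Notation gQ := (@gQ R d r n rho C).

Lemma gQD (f' g' : 'I_d -> A) f g :
  gQ (fun i => f' i + g' i) (f + g) = gQ f' f + gQ g' g.
Proof.
rewrite /gQ.
under eq_bigr => a _ do (under eq_bigr => i _ do rewrite scalerDr;
  rewrite big_split mulrDr /=).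
under [X in _ - _ *: X]eq_bigr => a _ do (under eq_bigr => b _ do
  (under eq_bigr => c _ do rewrite linearD scalerDr; rewrite big_split mulrDr /=);
  rewrite big_split mulrDr /=).
by rewrite !big_split /= scalerDr opprD addrACA.
Qed.

Lemma gQZ (c : R) (f' : 'I_d -> A) f : gQ (fun i => c *: f' i) (c *: f) = c *: gQ f' f.
Proof.
have E (b x : R) g : b *: (x *: g) = x *: (b *: g) by rewrite !scalerA mulrC.
rewrite /gQ.
under eq_bigr => a _ do (under eq_bigr => i _ do rewrite E;
  rewrite -scaler_sumr -scalerAr).
under [X in _ - _ *: X]eq_bigr => a _ do (under eq_bigr => b _ do
  (under eq_bigr => e _ do rewrite linearZ /= E; rewrite -scaler_sumr -scalerAr);
  rewrite -scaler_sumr -scalerAr).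
by rewrite -!scaler_sumr E scalerBr.
Qed.

Lemma gQ_sum (I : Type) (s : seq I) (f' : 'I_d -> I -> A) (f : I -> A) :
  gQ (fun i => \sum_(t <- s) f' i t) (\sum_(t <- s) f t) = \sum_(t <- s) gQ (fun i => f' i t) (f t).
Proof.
elim: s => [|t s IH].
  transitivity (gQ (fun=> 0 *: (0 : A)) (0 *: (0 : A))).
    by congr gQ; [apply/funext => i|]; rewrite scale0r big_nil.
  by rewrite gQZ scale0r big_nil.
rewrite !big_cons -IH -gQD; congr gQ.
by apply/funext => i; rewrite big_cons.
Qed.

(** The differential only involves the coordinates [q], so others are constants. *)
Lemma gQ_mulX k v (f' : 'I_d -> A) f : homog (gdeg n) k f -> not_q v ->
  gQ (fun i => f' i * X v) (f * X v) = gQ f' f * X v.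
Proof.
move=> hf hv; rewrite /gQ mulrBl -scalerAl !mulr_suml; congr (_ - _ *: _).
  apply: eq_bigr => a _; rewrite -mulrA mulr_suml; congr (_ * _).
  by apply: eq_bigr => i _; rewrite scalerAl.
apply: eq_bigr => a _; rewrite -mulrA mulr_suml; congr (_ * _).
apply: eq_bigr => b _; rewrite -mulrA mulr_suml; congr (_ * _).
apply: eq_bigr => c _; rewrite -scalerAl; congr (_ *: _).
rewrite (gder_mul _ _ hf) gder_X (_ : (_ == _) = false) ?mulr0 ?scaler0 ?addr0 //.
by apply/eqP => e; move: hv; rewrite -e.
Qed.

End Linearity.
End Substitution.

(** * The twist at zero momenta *)

Section TwistValue.
Context {R : realType} {d r : nat}.
Variable n : nat.
Hypothesis n_gt0 : (0 < n)%N.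
Notation gen := (gen d r).
Notation A := (@galg R d r n).
Notation X := (gX n).
Notation V := 'rV[R]_r.
Notation T := 'rV[R]_d.
Notation nform := (@nform R d r n).
Variables (rho : 'I_d -> 'I_r -> R) (C : 'I_r -> 'I_r -> 'I_r -> R) (J : seq V -> R).
Variables (drho : 'I_d -> 'I_d -> 'I_r -> R) (dC : 'I_d -> 'I_r -> 'I_r -> 'I_r -> R)
  (dJ : 'I_d -> seq V -> R) (Hl : seq T -> R).
Let eps : R := (-1) ^+ n.-1.
Let phi := phi_forms n rho C J.
Let dphi i := phi_forms n (drho i) (dC i) (dJ i).

(** The sign in [phi] against that of moving a one-form past a function of
    degree [n]. *)
Lemma epsn : eps * (-1) ^+ n = -1.
Proof. by rewrite /eps -{2}(prednK n_gt0) exprS mulrCA -expr2 sqrr_sign mulr1. Qed.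

Lemma godd_zz i : godd n (@Gz d r i) && godd n (@Gzeta d r i) = odd n.-1.
Proof. by rewrite godd_z //= andbT. Qed.

(** The images of [zeta] and [eta] are the forms that [phi] contracts with [z] and
    [y], that is, the anchor and the bracket; multiplied by the derivatives of
    [phi] along the base and along [q], they make up the vector field [gQ]. *)
Lemma ham_terms (phi0 : T -> A) u : phi0 u = phi ->
  (forall i, gxder i phi0 u = dphi i) -> homog (gdeg n) n%:Z phi ->
  (forall i, homog (gdeg n) n%:Z (dphi i)) ->
  \sum_i ham phi0 u (Gxi i) * ham phi0 u (Gzeta i)
  + \sum_a ham phi0 u (Gp a) * ham phi0 u (Geta a) = - gQ rho C dphi phi.
Proof.
move=> e0 e1 h0 h1; rewrite /gQ opprB [RHS]addrC; congr (_ + _).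
  transitivity (- \sum_i nform 1 (rho_form rho i) * dphi i).
    rewrite -sumrN; apply: eq_bigr => i _; rewrite /ham e0 e1 /phi gder_z_Phi // godd_zz.
    rewrite mulrNN signr_odd -scalerAr (gmulC (h1 i) (qpoly_deg (qpoly_nform n 1 _))).
    by rewrite oddz_nat oddz_nat andbT signr_odd scalerA epsn scaleN1r.
  congr (- _).
  transitivity (\sum_i \sum_a X (Gq a) * (rho i a *: dphi i)).
    apply: eq_bigr => i _; rewrite nform1 mulr_suml; apply: eq_bigr => a _.
    by rewrite -scalerAl scalerAr.
  by rewrite exchange_big /=; apply: eq_bigr => a _; rewrite mulr_sumr.
transitivity (\sum_a nform 2 (C_form C a) * gder (Gq a) phi).
  apply: eq_bigr => a _; rewrite /ham e0 /phi gder_y_Phi // -/phi.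
  have -> : godd n (@Gq d r a) && godd n (@Gp d r a) = odd n.-1.
    by rewrite /godd /= -predn_int.
  have -> : godd n (@Gy d r a) && godd n (@Geta d r a) = false by rewrite andbF.
  rewrite mulrNN scale1r signr_odd -scalerAl -scalerAr scalerA /eps -expr2 sqrr_sign scale1r.
  rewrite (gmulC (homog_gder (v := Gq a) h0) (qpoly_deg (qpoly_nform n 2 _))).
  by rewrite oddz_nat andbF scale1r.
transitivity (2^-1 *: \sum_a \sum_b X (Gq b) * (\sum_c X (Gq c) * (C b c a *: gder (Gq a) phi))).
  rewrite scaler_sumr; apply: eq_bigr => a _; rewrite nform2 -scalerAl; congr (_ *: _).
  rewrite mulr_suml; apply: eq_bigr => b _; rewrite -mulrA mulr_suml; congr (_ * _).
  by apply: eq_bigr => c _; rewrite -scalerAl scalerAr.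
rewrite exchange_big /=; congr (_ *: _); apply: eq_bigr => b _.
rewrite -mulr_sumr exchange_big /=; congr (_ * _).
by apply: eq_bigr => c _; rewrite mulr_sumr.
Qed.

(** The images of the [zeta] are the components of the anchor up to sign, so the
    term with [H] becomes its pullback; the [n.+1] signs cancel. *)
Lemma twist_baseE_forms (phi0 : T -> A) (H : ('I_n.+1 -> 'I_d) -> T -> R) u :
  phi0 u = phi -> (forall i, gxder i phi0 u = dphi i) -> homog (gdeg n) n%:Z phi ->
  (forall i, homog (gdeg n) n%:Z (dphi i)) -> mlinear n.+1 Hl ->
  (forall I : {ffun 'I_n.+1 -> 'I_d}, H I u = Hl [seq delta_mx 0 (I k) | k <- enum 'I_n.+1]) ->
  twist_base phi0 H u = - gQ rho C dphi phi
    + (-1) ^+ (n * n.+1)./2 *: nform n.+1 (fun s => Hl (map (anchor rho) s)).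
Proof.
move=> e0 e1 h0 h1 lH hH; rewrite /twist_base ham_terms //; congr (_ + _).
rewrite -scalerA; congr (_ *: _); rewrite /nform; congr (_ *: _).
pose y i := - eps *: nform 1 (rho_form rho i).
transitivity (gform (fun i => delta_mx 0 i : T) y n.+1 Hl).
  rewrite -gform_ffun; apply: eq_bigr => I _; rewrite hH; congr (_ *: _).
  apply: eq_bigr => k _; rewrite /ham e0 /phi gder_z_Phi // godd_zz signr_odd.
  by rewrite /y scaleNr.
rewrite /y gform_scale.
have -> : (- eps) ^+ n.+1 = 1.
  have -> : - eps = (-1) ^+ n by rewrite /eps -{2}(prednK n_gt0) exprS mulN1r.
  by rewrite -exprM mulnC -signr_odd oddM /= andNb.
rewrite scale1r; apply: (@gform_pullback _ _ _ _ _ _ _ _ _ _ _ _ (fun a i => rho i a)) => //.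
  move=> a; apply/rowP => i; rewrite anchorE summxE (bigD1 a) //= mxE !eqxx mul1r.
  rewrite [X in _ + X]big1 ?addr0; last by move=> b ba; rewrite mxE eqxx (negbTE ba) mul0r.
  rewrite (bigD1 i) //= !mxE !eqxx mulr1 [X in _ + X]big1 ?addr0 // => j ji.
  by rewrite !mxE eqxx eq_sym (negbTE ji) mulr0.
by move=> i; exact: nform1.
Qed.

(** The differentials of the components of the anchor and of the bracket, as forms
    on [E]: the coefficients of [z] and [y] in the differential of [phi]. *)
Definition Zpart i := gQ rho C (fun j => nform 1 (rho_form (drho j) i)) (nform 1 (rho_form rho i)).
Definition Ypart c := gQ rho C (fun j => nform 2 (C_form (dC j) c)) (nform 2 (C_form C c)).

Lemma gQ_phi : gQ rho C dphi phi =
  eps *: (\sum_i Zpart i * X (Gz i) + \sum_c Ypart c * X (Gy c))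
  - gQ rho C (fun j => nform n (dJ j)) (nform n J).
Proof.
have -> : \sum_i Zpart i * X (Gz i) = gQ rho C
    (fun j => \sum_i nform 1 (rho_form (drho j) i) * X (Gz i)) (\sum_i nform 1 (rho_form rho i) * X (Gz i)).
  rewrite gQ_sum; apply: eq_bigr => i _.
  by rewrite (gQ_mulX _ _ _ (qpoly_deg (qpoly_nform n 1 _))).
have -> : \sum_c Ypart c * X (Gy c) = gQ rho C
    (fun j => \sum_c nform 2 (C_form (dC j) c) * X (Gy c)) (\sum_c nform 2 (C_form C c) * X (Gy c)).
  rewrite gQ_sum; apply: eq_bigr => i _.
  by rewrite (gQ_mulX _ _ _ (qpoly_deg (qpoly_nform n 2 _))).
rewrite -gQD -gQZ -scaleN1r -gQZ -gQD /phi /phi_forms -/eps scaleN1r; congr (gQ _ _ _ _).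
by apply/funext => j; rewrite scaleN1r.
Qed.

(** The derivatives along [z] and [y] separate the components. *)
Lemma forms_independent j k l (Z : 'I_d -> A) (Y : 'I_r -> A) W :
  (forall i, qpoly j (Z i)) -> (forall c, qpoly k (Y c)) -> qpoly l W ->
  \sum_i Z i * X (Gz i) + \sum_c Y c * X (Gy c) + W = 0 <->
  [/\ forall i, Z i = 0, forall c, Y c = 0 & W = 0].
Proof.
move=> hZ hY hW; split=> [e|[eZ eY ->]]; last first.
  rewrite addr0 !big1 ?addr0 // => i _; [rewrite eY|rewrite eZ]; exact: mul0r.
have D v : not_q v -> gder v (\sum_i Z i * X (Gz i) + \sum_c Y c * X (Gy c)) = 0.
  move=> hv; move: e; set f := (\sum_i _ + \sum_c _) => e.
  have := linearD (gder v) f W; rewrite e linear0 /= (avoids_gder hW.1) // addr0.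
  by move=> <-.
have eZ i : Z i = 0.
  have /eqP := D (Gz i) isT; rewrite (gder_z_forms n_gt0 i hZ hY).
  by rewrite scaler_eq0 signr_eq0 => /eqP.
have eY c : Y c = 0.
  have /eqP := D (Gy c) isT; rewrite (gder_y_forms c hZ hY).
  by rewrite scaler_eq0 signr_eq0 => /eqP.
split=> //; move: e; rewrite big1 ?add0r => [|i _]; last by rewrite eZ mul0r.
by rewrite big1 ?add0r // => c _; rewrite eY mul0r.
Qed.

Lemma qpoly_eq0P k (f : A) (G : seq V -> R) : qpoly k f ->
  (forall s, size s = k -> ev s f = G s) -> (f = 0 <-> forall s, size s = k -> G s = 0).
Proof.
move=> hf hG; split=> [f0 s hs|h].
  by rewrite -hG // f0 linear0.
by apply: (qpoly_eq0 hf) => s hs; rewrite hG // h.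
Qed.

Lemma rho_form_alt (rho0 : 'I_d -> 'I_r -> R) i : altform 1 (rho_form rho0 i).
Proof.
split=> [[|//] [|//] c x y _|[|//] [|//] //].
by rewrite /rho_form /= anchorD anchorZ !mxE.
Qed.

Lemma C_form_alt (C0 : 'I_r -> 'I_r -> 'I_r -> R) c :
  (forall a b c, C0 a b c = - C0 b a c) -> altform 2 (C_form C0 c).
Proof.
move=> sk; split=> [[|s0 [|//]] [|t0 [|//]] //= b x y _|[|//] [|//] //= x _].
- by rewrite /C_form /= cbrDl cbrZl !mxE.
- by rewrite /C_form /= cbrDr cbrZr !mxE.
rewrite /C_form /=; have /rowP/(_ c) := cbr_skew x x sk; rewrite !mxE.
by move=> h; lra.
Qed.

Hypothesis C_skew : forall a b c, C a b c = - C b a c.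
Hypothesis dC_skew : forall i a b c, dC i a b c = - dC i b a c.
Hypothesis J_alt : altform n J.
Hypothesis dJ_alt : forall i, altform n (dJ i).
Hypothesis H_alt : altform n.+1 Hl.

(** The three groups of equations are the coefficients of [z], of [y], and of
    neither of them. *)
Lemma twist_value0P :
  - gQ rho C dphi phi
    + (-1) ^+ (n * n.+1)./2 *: nform n.+1 (fun s => Hl (map (anchor rho) s)) = 0 <->
  [/\ forall i s, size s = 2 ->
        dform 1 rho C (rho_form rho i) (fun j => rho_form (drho j) i) s = 0,
      forall c s, size s = 3 ->
        dform 2 rho C (C_form C c) (fun j => C_form (dC j) c) s = 0 &
      forall s, size s = n.+1 -> dform n rho C J dJ s
        + (-1) ^+ (n * n.+1)./2 * Hl (map (anchor rho) s) = 0].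
Proof.
have hN k F : qpoly k (nform k F) by exact: qpoly_nform.
have alt1 : altform n.+1 (fun s => Hl (map (anchor rho) s)).
  by apply: altform_map => // b x y; rewrite anchorD anchorZ.
have hZ i : qpoly 2 (- (eps *: Zpart i)) by apply: qpolyN; apply: qpolyZ; apply: qpoly_gQ.
have hY c : qpoly 3 (- (eps *: Ypart c)) by apply: qpolyN; apply: qpolyZ; apply: qpoly_gQ.
pose W := gQ rho C (fun j => nform n (dJ j)) (nform n J)
  + (-1) ^+ (n * n.+1)./2 *: nform n.+1 (fun s => Hl (map (anchor rho) s)).
have hW : qpoly n.+1 W.
  by apply: qpolyD; [exact: qpoly_gQ|exact: qpolyZ].
rewrite gQ_phi opprD opprK -addrA -/W.
have -> : - (eps *: (\sum_i Zpart i * X (Gz i) + \sum_c Ypart c * X (Gy c))) + W =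
    \sum_i (- (eps *: Zpart i)) * X (Gz i) + \sum_c (- (eps *: Ypart c)) * X (Gy c) + W.
  rewrite scalerDr opprD; congr (_ + _ + _); rewrite scaler_sumr -sumrN; apply: eq_bigr => t _;
    by rewrite scalerAl mulNr.
have EZ (t : A) : - (eps *: t) = 0 <-> t = 0.
  split=> [/eqP|->]; last by rewrite scaler0 oppr0.
  by rewrite oppr_eq0 scaler_eq0 signr_eq0 => /eqP.
rewrite (forms_independent hZ hY hW).
have PZ i : Zpart i = 0 <-> forall s, size s = 2 ->
    dform 1 rho C (rho_form rho i) (fun j => rho_form (drho j) i) s = 0.
  apply: qpoly_eq0P; first exact: qpoly_gQ.
  by move=> s hs; apply: ev_gQ => // [|j]; exact: rho_form_alt.
have PY c : Ypart c = 0 <-> forall s, size s = 3 ->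
    dform 2 rho C (C_form C c) (fun j => C_form (dC j) c) s = 0.
  apply: qpoly_eq0P; first exact: qpoly_gQ.
  by move=> s hs; apply: ev_gQ => // [|j]; exact: C_form_alt.
have PW : W = 0 <-> forall s, size s = n.+1 -> dform n rho C J dJ s
        + (-1) ^+ (n * n.+1)./2 * Hl (map (anchor rho) s) = 0.
  apply: qpoly_eq0P => // s hs; rewrite linearD; congr (_ + _); first exact: ev_gQ.
  rewrite !linearZ /= ev_qform // -[LHS]/(_ * (_ * _)); congr (_ * _).
  by rewrite mulKf // pnatr_eq0 -lt0n fact_gt0.
split=> [[h1 h2 h3]|[h1 h2 h3]]; split.
- by move=> i; apply/PZ/EZ.
- by move=> c; apply/PY/EZ.
- exact/PW.
- by move=> i; apply/EZ/PZ; exact: h1.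
- by move=> c; apply/EZ/PY; exact: h2.
- exact/PW.
Qed.

End TwistValue.

(** * The function $\phi$ in a chart *)

Section LocalPhi.
Context {R : realType} {d r : nat}.
Variable n : nat.
Notation gen := (gen d r).
Notation A := (@galg R d r n).
Notation X := (gX n).
Notation T := 'rV[R]_d.
Implicit Types (u : T).

(** Differentiability is part of it, since partial derivatives of sums and products
    are only computed for differentiable functions. *)
Definition has_gxder j u (a : T -> A) (b : A) := forall m,
  differentiable (fun u' => a u' m) u /\ partial j (fun u' => a u' m) u = b m.

Lemma gxderE j u (a : T -> A) (b : A) : has_gxder j u a b -> gxder j a u = b.
Proof. by move=> h; apply: galgP => m; have [_ <-] := h m. Qed.

Lemma has_gxder_scale j u (f : T -> R) (g : A) : differentiable f u ->
  has_gxder j u (fun u' => f u' *: g) (partial j f u *: g).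
Proof.
move=> df m; rewrite gscaleE.
have dc : differentiable (fun _ : T => g m) u by [].
split; first exact: (differentiableM df dc).
by rewrite (partialM _ df dc) partial_cst mulr0 addr0.
Qed.

Lemma has_gxder_sum j u (I : Type) (s : seq I) (a : I -> T -> A) (b : I -> A) :
  (forall i, has_gxder j u (a i) (b i)) ->
  has_gxder j u (fun u' => \sum_(i <- s) a i u') (\sum_(i <- s) b i).
Proof.
move=> h m; rewrite gsumE (_ : (fun u' => _) = (fun u' => \sum_(i <- s) a i u' m)); last first.
  by apply/funext => u'; rewrite gsumE.
have D i : true -> differentiable (fun u' => a i u' m) u by move=> _; have [] := h i m.
split; first exact: differentiable_bigsum.
by rewrite partial_sum //; apply: eq_bigr => i _; have [_ ->] := h i m.
Qed.

Lemma has_gxderD j u (a1 a2 : T -> A) (b1 b2 : A) : has_gxder j u a1 b1 -> has_gxder j u a2 b2 ->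
  has_gxder j u (fun u' => a1 u' + a2 u') (b1 + b2).
Proof.
move=> h1 h2 m; have [d1 e1] := h1 m; have [d2 e2] := h2 m.
split; first exact: (differentiableD d1 d2).
by rewrite gaddE -e1 -e2 -partialD.
Qed.

Lemma has_gxderZ j u (c : R) (a : T -> A) (b : A) : has_gxder j u a b ->
  has_gxder j u (fun u' => c *: a u') (c *: b).
Proof.
move=> h m; have [d1 e1] := h m; have dc : differentiable (fun _ : T => c) u by [].
split; first exact: (differentiableM dc d1).
by rewrite gscaleE -e1 -[RHS]add0r -(mul0r (a u m)) -(partial_cst j c u) -partialM.
Qed.

Variables (rho : 'I_d -> 'I_r -> T -> R) (C : 'I_r -> 'I_r -> 'I_r -> T -> R).
Variable Jf : ('I_n -> 'I_r) -> T -> R.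

Definition phi_at u : A :=
  Phi (fun i a => rho i a u) (fun a b c => C a b c u) (fun B => Jf B u).

Lemma gxder_phi_at j u :
  (forall i a, differentiable (rho i a) u) -> (forall a b c, differentiable (C a b c) u) ->
  (forall B, differentiable (Jf B) u) ->
  gxder j phi_at u = Phi (fun i a => partial j (rho i a) u)
    (fun a b c => partial j (C a b c) u) (fun B => partial j (Jf B) u).
Proof.
move=> dr dC dJ; apply: gxderE; apply: has_gxderD; first apply: has_gxderD.
- apply: has_gxder_sum => i; apply: has_gxder_sum => a; exact: has_gxder_scale.
- apply: has_gxderZ; apply: has_gxder_sum => a; apply: has_gxder_sum => b.
  apply: has_gxder_sum => c; exact: has_gxder_scale.
- rewrite -scaleN1r; under [X in has_gxder _ _ X]funext => u' do rewrite -scaleN1r.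
  apply: has_gxderZ; apply: has_gxderZ; apply: has_gxder_sum => B.
  exact: has_gxder_scale.
Qed.

Lemma gphi_of : gphi rho C Jf = gof phi_at.
Proof.
rewrite /gphi /gphi_Lie /gJ.
under eq_bigr => i _ do (under eq_bigr => a _ do
  rewrite (gof_cst n) !(gof_var n) !gof_mul; rewrite gof_sum).
rewrite gof_sum.
under eq_bigr => a _ do (under eq_bigr => b _ do (under eq_bigr => c _ do
  rewrite (gof_cst n) !(gof_var n) !gof_mul; rewrite gof_sum); rewrite gof_sum).
rewrite gof_sum.
under eq_bigr => B _ do rewrite (gof_cst n) (gof_prod _ (fun k => fun=> X (Gq (B k)))) gof_mul.
rewrite gof_sum !gof_scale !gof_add; congr gof; apply/funext => u.
rewrite scaleN1r; congr (_ + _ *: _ - _ *: _).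
- by apply: eq_bigr => i _; apply: eq_bigr => a _; rewrite -!scalerAl mul1r.
- apply: eq_bigr => a _; apply: eq_bigr => b _; apply: eq_bigr => c _.
  by rewrite -!scalerAl mul1r.
- by apply: eq_bigr => B _; rewrite -scalerAl mul1r.
Qed.

End LocalPhi.

(** * The structure equations *)

Section StructureEquations.
Context {R : realType} {d r : nat}.
Variables (rho : 'I_d -> 'I_r -> R) (C : 'I_r -> 'I_r -> 'I_r -> R).
Variables (drho : 'I_d -> 'I_d -> 'I_r -> R) (dC : 'I_d -> 'I_r -> 'I_r -> 'I_r -> R).
Hypothesis C_skew : forall a b c, C a b c = - C b a c.
Hypothesis dC_skew : forall i a b c, dC i a b c = - dC i b a c.
Notation V := 'rV[R]_r.
Implicit Types (v w : V).

Lemma along_rho_sum z w i :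
  anchor (along_rho drho z) w 0 i = \sum_j z 0 j * anchor (drho j) w 0 i.
Proof.
rewrite anchorE; under eq_bigr => a _ do rewrite mulr_sumr.
rewrite exchange_big; apply: eq_bigr => j _.
rewrite anchorE mulr_sumr; apply: eq_bigr => a _.
by rewrite mulrCA.
Qed.

Lemma along_C_sum z v w c :
  cbr (along_C dC z) v w 0 c = \sum_j z 0 j * cbr (dC j) v w 0 c.
Proof.
rewrite cbrE.
under eq_bigr => a _ do (under eq_bigr => b _ do rewrite mulr_sumr; rewrite exchange_big /=).
rewrite exchange_big; apply: eq_bigr => j _ /=.
rewrite cbrE mulr_sumr; apply: eq_bigr => a _; rewrite mulr_sumr; apply: eq_bigr => b _.
by rewrite mulrCA.
Qed.

(** The components of the anchor are closed exactly when it respects brackets. *)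
Lemma dform_anchor i v w :
  dform 1 rho C (rho_form rho i) (fun j => rho_form (drho j) i) [:: v; w] =
  anchor_defect rho drho C v w 0 i.
Proof.
rewrite /anchor_defect !rowDE !rowNE !along_rho_sum /dform.
under [X in _ + X = _]eq_bigr => m _ do rewrite big_mkcond.
rewrite !big_ord_recl !big_ord0 /= /rho_form /=.
move: (\sum_j _) (\sum_j _) (anchor rho _ 0 i).
by move=> a1 a2 b1; rewrite /bump /=; ring.
Qed.

(** The components of the bracket are closed exactly when the Jacobi identity holds
    for constant sections; skew-symmetry brings the six terms into cyclic form. *)
Lemma dform_jacobi c v1 v2 v3 :
  dform 2 rho C (C_form C c) (fun j => C_form (dC j) c) [:: v1; v2; v3] =
  jacobi_defect rho C dC v1 v2 v3 0 c.
Proof.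
rewrite /jacobi_defect /jacobi_term !rowDE !along_C_sum.
have s1 : cbr C v1 (cbr C v2 v3) 0 c = - cbr C (cbr C v2 v3) v1 0 c.
  by rewrite (cbr_skew v1 _ C_skew) rowNE.
have s2 : cbr C v2 (cbr C v3 v1) 0 c = cbr C (cbr C v1 v3) v2 0 c.
  by rewrite (cbr_skew v2 _ C_skew) (cbr_skew v3 _ C_skew) cbrNl opprK.
have s3 : cbr C v3 (cbr C v1 v2) 0 c = - cbr C (cbr C v1 v2) v3 0 c.
  by rewrite (cbr_skew v3 _ C_skew) rowNE.
have s4 : \sum_j anchor rho v2 0 j * cbr (dC j) v3 v1 0 c =
    - \sum_j anchor rho v2 0 j * cbr (dC j) v1 v3 0 c.
  rewrite -sumrN; apply: eq_bigr => j _.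
  by rewrite (cbr_skew v3 _ (@dC_skew j)) rowNE mulrN.
rewrite s1 s2 s3 s4 /dform.
under [X in _ + X = _]eq_bigr => i _ do rewrite big_mkcond.
rewrite !big_ord_recl !big_ord0 /= /C_form /=.
move: (\sum_j _) (\sum_j _) (\sum_j _) (cbr C _ v1 0 c) (cbr C _ v2 0 c) (cbr C _ v3 0 c).
by move=> a1 a2 a3 b1 b2 b3; rewrite /bump /=; ring.
Qed.

End StructureEquations.

(** * Local equations and global identities *)

Section LocalCriterion.
Context {R : realType} {d : nat} {M : manifold R d} {r : nat} {E : vbundle M r}.
Variable n : nat.
Hypothesis n_gt0 : (0 < n)%N.
Variables (rho : forall x : M, {linear E x -> tangent x}).
Hypothesis rho_map : is_bundle_map rho.
Variables (br : section_of E -> section_of E -> section_of E).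
Hypothesis brP : is_bracket rho br.
Variable J : forall x : M, ('I_n -> E x) -> R.
Hypothesis J_form : is_Eform J.
Variable H : forall x : M, ('I_n.+1 -> tangent x) -> R.
Hypothesis H_form : is_form H.

(** What the vanishing of the twist says at one point, and what the axioms of a
    Lie algebroid and compatibility say in coordinates. *)
Definition structure_equations k l u :=
  let rho0 := rho_at (loc_rho rho k l) u in
  let C0 := C_at (loc_C br k l) u in
  [/\ forall v w, anchor_defect rho0 (drho_at (loc_rho rho k l) u) C0 v w = 0,
      forall v1 v2 v3, jacobi_defect rho0 C0 (dC_at (loc_C br k l) u) v1 v2 v3 = 0 &
      forall s, size s = n.+1 ->
        dform n rho0 C0 (Jloc J k l u) (dJloc J k l u) s =
        - Hloc H k u (rev (map (anchor rho0) s))].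

Section Chart.
Variables (k : chart_idx M) (l : frame_idx E).
Notation U := (coord_dom k l).
Notation lrho := (loc_rho rho k l).
Notation lC := (loc_C br k l).

Notation defect u := (anchor_defect (rho_at lrho u) (drho_at lrho u) (C_at lC u)).

Lemma loc_phi_of : loc_phi rho br J k l = gof (phi_at lrho lC (loc_J J k l)).
Proof. exact: gphi_of. Qed.

(** Both sides are conditions at each point. Smoothness of the local data makes the
    derivative of [phi] the same expression in the derivatives of its
    coefficients. *)
Lemma twist_local :
  pr_twist_zero n U (loc_phi rho br J k l) (@loc_Theta R d M r n H k) <->
  forall u, U u -> structure_equations k l u.
Proof.
rewrite loc_phi_of /loc_Theta pr_twist_zeroP; last 2 first.
- by move=> u; exact: Phi_deg.
- by move=> u; exact: Phi_basic.
suff P u : U u -> twist_base (phi_at lrho lC (loc_J J k l)) (loc_H H k) u = 0 <->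
    structure_equations k l u.
  by split=> h u Uu; apply/(P u Uu); exact: h.
move=> Uu; have oU : open U := open_coord_dom (k := k) (l := l).
have dr i a : differentiable (lrho i a) u.
  exact: (smooth_on_differentiable (loc_rho_smooth rho_map i a)).
have dC a b c : differentiable (lC a b c) u.
  exact: (smooth_on_differentiable (loc_C_smooth brP a b c)).
have JE B : loc_J J k l B = fun u' => Jloc J k l u' [seq delta_mx 0 (B j) | j <- enum 'I_n].
  by apply/funext => u'; exact: loc_JE.
have dJ B : differentiable (loc_J J k l B) u.
  rewrite JE; apply: (smooth_on_differentiable (Jloc_smooth J_form _)) => //.
  by rewrite size_map size_enum_ord.
have e0 : phi_at lrho lC (loc_J J k l) u =
    phi_forms n (rho_at lrho u) (C_at lC u) (Jloc J k l u).
  by apply: PhiE => // B; rewrite JE.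
have e1 j : gxder j (phi_at lrho lC (loc_J J k l)) u =
    phi_forms n (drho_at lrho u j) (dC_at lC u j) (dJloc J k l u j).
  rewrite gxder_phi_at //.
  have hJ B : partial j (loc_J J k l B) u =
      dJloc J k l u j [seq delta_mx 0 (B i) | i <- enum 'I_n] by rewrite JE.
  exact: (PhiE n_gt0 (drho_at lrho u j) (dC_at lC u j) hJ).
have C_skew a b c : C_at lC u a b c = - C_at lC u b a c by exact: (loc_C_skew brP).
have dC_skew j a b c : dC_at lC u j a b c = - dC_at lC u j b a c.
  rewrite /dC_at (@partial_near _ _ j _ (fun u' => -1 * lC b a c u')).
    have d1 : differentiable (fun _ : 'rV[R]_d => -1 : R) u by [].
    by rewrite (partialM _ d1 (dC b a c)) partial_cst mul0r add0r mulN1r.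
  have := near_coord_dom Uu; apply: filterS => u' Uu'.
  by rewrite mulN1r; exact: (loc_C_skew brP).
rewrite (twist_baseE_forms n_gt0 (Hl := Hloc H k u) e0 e1); last 4 first.
- by rewrite -e0; exact: Phi_deg.
- by move=> i; rewrite -e1; apply: homog_gxder => u'; exact: Phi_deg.
- exact: (altform_Hloc H_form k u).1.
- by move=> I; exact: loc_HE.
have aH := altform_Hloc H_form k u.
rewrite (twist_value0P n_gt0 (rho_at lrho u) (drho_at lrho u) C_skew dC_skew (altform_Jloc J_form k l u)
  (fun j => altform_dJloc J_form j Uu) aH).
have HR s : size s = n.+1 -> Hloc H k u (rev (map (anchor (rho_at lrho u)) s)) =
    (-1) ^+ (n * n.+1)./2 * Hloc H k u (map (anchor (rho_at lrho u)) s).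
  by move=> hs; rewrite (altform_rev aH) ?size_map // mulnC.
split=> [[h1 h2 h3]|[h1 h2 h3]]; split.
- by move=> v w; apply/rowP => i; rewrite -dform_anchor h1 ?mxE.
- move=> v1 v2 v3; apply/rowP => c.
  by rewrite -(dform_jacobi _ C_skew dC_skew) h2 // mxE.
- by move=> s hs; apply/eqP; rewrite -addr_eq0 HR // h3.
- by move=> i [|v [|w [|//]]] // _; rewrite dform_anchor h1 mxE.
- move=> c [|v1 [|v2 [|v3 [|//]]]] // _.
  by rewrite (dform_jacobi _ C_skew dC_skew) h2 mxE.
- by move=> s hs; rewrite -HR // h3 // addNr.
Qed.

Lemma section_coords u (g : 'I_r -> M -> R) : U u ->
  (forall a, msmooth_on (frame_dom l) (g a)) ->
  exists2 s, ssmooth s &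
    \forall u' \near u, scoord k l s u' = \row_a g a (chart_inv k u').
Proof.
move=> Uu sg; have [_ lu _] := coord_domP Uu.
have [s ss sE] := section_extend lu sg; exists s => //.
have := near_chart_inv Uu sE; apply: filterS2 (near_coord_dom Uu) => u' Uu' e.
have [_ lu' _] := coord_domP Uu'.
apply/rowP => a; rewrite scoordE e linear_sum mxE (bigD1 a) //= linearZ /= fcoord_frame // eqxx.
rewrite -[X in X + _]/(_ * _) mulr1 [X in _ + X]big1 ?addr0 // => b ba.
by rewrite linearZ /= fcoord_frame // eq_sym (negbTE ba) -[LHS]/(_ * _) mulr0.
Qed.

Lemma vdird_near_cst z (S : 'rV[R]_d -> 'rV[R]_r) u v :
  (\forall u' \near u, S u' = v) -> vdird z S u = 0.
Proof.
move=> Sv; apply/rowP => a; rewrite vdirdE mxE -[RHS](dird_cst z (v 0 a) u).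
by apply: dird_near; apply: filterS Sv => u' ->.
Qed.

Lemma vdird0 (S : 'rV[R]_d -> 'rV[R]_r) u : vdird 0 S u = 0.
Proof.
by apply/rowP => a; rewrite vdirdE mxE /dird big1 // => i _; rewrite mxE mul0r.
Qed.

Lemma const_section u v : U u ->
  exists2 s, ssmooth s & \forall u' \near u, scoord k l s u' = v.
Proof.
move=> Uu; have [s ss sE] := section_coords Uu (g := fun a _ => v 0 a)
  (fun a => @msmooth_on_cst _ _ _ _ _).
by exists s => //; apply: filterS sE => u' ->; apply/rowP => a; rewrite mxE.
Qed.

Lemma scoord_jacobiator s t w u : ssmooth s -> ssmooth t -> ssmooth w -> U u ->
  scoord k l (fun x => br s (br t w) x + br t (br w s) x + br w (br s t) x) u =
  jacobi_defect (rho_at lrho u) (C_at lC u) (dC_at lC u)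
    (scoord k l s u) (scoord k l t u) (scoord k l w u)
  + vdird (defect u (scoord k l s u) (scoord k l t u)) (scoord k l w) u
  + vdird (defect u (scoord k l t u) (scoord k l w u)) (scoord k l s) u
  + vdird (defect u (scoord k l w u) (scoord k l s u)) (scoord k l t) u.
Proof.
move=> ss st sw Uu; rewrite (scoord_jacobi brP) //.
apply: (lbr_jacobi (U := U)) => //; try exact: vsmooth_scoord.
- exact: open_coord_dom.
- exact: (loc_rho_smooth rho_map).
- exact: (loc_C_smooth brP).
- by move=> a b c u' Uu'; exact: (loc_C_skew brP).
Qed.

(** Testing on sections with constant coordinates gives the Jacobi identity for
    the structure functions; a section with one linear coordinate and the others
    zero then isolates each component of the anchor defect. *)
Lemma equations_of_algebroid u : U u -> jacobi br -> compatible_form rho br J H ->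
  structure_equations k l u.
Proof.
move=> Uu jac comp; have [ku lu uE] := coord_domP Uu.
have jac0 s t w : ssmooth s -> ssmooth t -> ssmooth w ->
    scoord k l (fun x => br s (br t w) x + br t (br w s) x + br w (br s t) x) u = 0.
  by move=> ss st sw; apply/rowP => a; rewrite scoordE jac // linear0 mxE.
have J0 v1 v2 v3 : jacobi_defect (rho_at lrho u) (C_at lC u) (dC_at lC u) v1 v2 v3 = 0.
  have [s ss sE] := const_section v1 Uu; have [t st tE] := const_section v2 Uu.
  have [w sw wE] := const_section v3 Uu.
  have := scoord_jacobiator ss st sw Uu; rewrite jac0 //.
  rewrite (vdird_near_cst _ sE) (vdird_near_cst _ tE) (vdird_near_cst _ wE) !addr0.
  by rewrite (nbhs_singleton sE) (nbhs_singleton tE) (nbhs_singleton wE).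
split=> // [v1 v2|s hs].
  apply/rowP => i; rewrite [RHS]mxE.
  (* The test section needs a frame vector; in rank zero the anchor vanishes. *)
  have [[a0]|r0] := pselect (inhabited 'I_r); last first.
    have Z (rho' : 'I_d -> 'I_r -> R) v : anchor rho' v 0 i = 0.
      by rewrite anchorE big1 // => a; case: r0; exists.
    by rewrite /anchor_defect !rowDE !rowNE !Z !oppr0 !addr0.
  have [f sf fE] := msmooth_extend (@chart_dom_open _ _ M k) ku (@msmooth_on_coord _ _ M k i).
  pose g a : M -> R := if a == a0 then f else fun=> 0.
  have sg a : msmooth_on (frame_dom l) (g a).
    by rewrite /g; case: eqP => _; [exact: msmooth_onT|exact: msmooth_on_cst].
  have [s ss sE] := const_section v1 Uu; have [t st tE] := const_section v2 Uu.
  have [w sw wE] := section_coords Uu sg.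
  have := scoord_jacobiator ss st sw Uu; rewrite jac0 // J0.
  rewrite (vdird_near_cst _ sE) (vdird_near_cst _ tE) !addr0 add0r.
  rewrite (nbhs_singleton sE) (nbhs_singleton tE); set z := anchor_defect _ _ _ _ _.
  move=> /rowP/(_ a0); rewrite mxE vdirdE => ->.
  rewrite (@dird_near _ _ z _ (fun u' => u' 0 i)).
    rewrite /dird (bigD1 i) //= partial_coord eqxx mulr1 [X in _ + X]big1 ?addr0 //.
    by move=> j ji; rewrite partial_coord (negbTE ji) mulr0.
  have := near_chart_inv Uu fE; apply: filterS3 (near_coord_dom Uu) wE => u' Uu' e1 e2.
  by rewrite e1 mxE /g eqxx e2; have [_ _ ->] := coord_domP Uu'.
have /choice[e he] : forall q : 'I_n.+1, exists e : section_of E, ssmooth e /\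
    scoord k l e u = nth 0 s q.
  move=> q; have [e se eE] := const_section (nth 0 s q) Uu.
  by exists e; split=> //; exact: nbhs_singleton eE.
have se q : ssmooth (e q) by have [] := he q.
have sE : [seq scoord k l (e q) u | q <- enum 'I_n.+1] = s.
  apply: (@eq_from_nth _ 0) => [|q]; first by rewrite size_map size_enum_ord hs.
  rewrite size_map size_enum_ord => hq.
  by rewrite (nth_map_ord 0 (fun q => scoord k l (e q) u) (Ordinal hq)) (he _).2.
have := comp e se (chart_inv k u).
by rewrite (Ed_loc brP J_form Uu se) (Hloc_sections rho H e Uu) sE.
Qed.

End Chart.

(** Every point lies in some chart and frame domain, where the local formulas for
    the Jacobiator and for the differential apply. *)
Lemma algebroid_of_equations :
  (forall k l u, coord_dom k l u -> structure_equations k l u) ->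
  jacobi br /\ compatible_form rho br J H.
Proof.
move=> eqs.
have loc (x : M) : exists k (l : frame_idx E) u, coord_dom k l u /\ chart_inv k u = x.
  have [l lx] := frame_cover E x; have kx := chart_atP x.
  exists (chart_at x), l, (chart (chart_at x) x); rewrite chartK //; split=> //.
  by exists x.
split=> [s t w ss st sw x|e se x].
  have [k [l [u [Uu <-]]]] := loc x; have [e1 e2 _] := eqs k l u Uu.
  have [_ lu _] := coord_domP Uu.
  rewrite [LHS](fcoordK _ lu) big1 // => a _.
  have := scoord_jacobiator ss st sw Uu; rewrite e2 !e1 !vdird0 !addr0.
  by move=> /rowP/(_ a); rewrite scoordE mxE => ->; rewrite scale0r.
have [k [l [u [Uu <-]]]] := loc x; have [_ _ e3] := eqs k l u Uu.
rewrite (Ed_loc brP J_form Uu se) (Hloc_sections rho H e Uu).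
by rewrite e3 // size_map size_enum_ord.
Qed.

Lemma loc_phi_homogeneous k l :
  homogeneous_on n (coord_dom k l) n%:Z (loc_phi rho br J k l).
Proof.
move=> u m _; rewrite loc_phi_of => h.
exact: (@Phi_deg _ _ _ n _ _ _ m h).
Qed.

End LocalCriterion.

Theorem proposition7p4 (R : realType) (d r n : nat) (n_ge1 : (1 <= n)%N)
    (M : manifold R d) (E : vbundle M r)
    (rho : forall x : M, {linear E x -> tangent x})
    (rho_map : is_bundle_map rho)
    (br : section_of E -> section_of E -> section_of E)
    (br_bracket : is_bracket rho br)
    (J : forall x : M, ('I_n -> E x) -> R) (J_form : is_Eform J)
    (H : forall x : M, ('I_n.+1 -> tangent x) -> R) (H_form : is_form H)
    (H_closed : closed_form H) :
  (lie_algebroid rho br /\ compatible_form rho br J H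
     <-> twist_vanishes rho br J H) /\
  (twist_vanishes rho br J H <-> twisted_QP rho br J H).
Proof.
split; last by split=> [h|[]//]; split=> // k l; exact: loc_phi_homogeneous.
split=> [[[_ _ jac] comp] k l|tw].
  apply/(twist_local n_ge1 rho_map br_bracket J_form H_form) => u Uu.
  exact: equations_of_algebroid.
have [|jac comp] := @algebroid_of_equations _ _ _ _ _ n rho rho_map br br_bracket J J_form H.
  move=> k l; exact/(twist_local n_ge1 rho_map br_bracket J_form H_form).
by split.
Qed.
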